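(* Let $m$ be a positive integer and let $T$ be a Calderón–Zygmund operator with kernel $K$ satisfying $Tf(x)=\int_{\mathbb{R}^n}K(x-y)f(y)\,dy$ for a.e. $x\in\mathbb{R}^n$. Let $0<\delta<\min\{n/m,1\}$, $b\in\Lambda(\delta)$, $1\leq p<n/(m\delta)$ and let $q$ be such that $1/q=1/p-m\delta/n$. If $u,v$ are weights on $\mathbb{R}^n$ satisfying either (i) $u\in A_1$ and $v^{q/p}\in A_1$, or (ii) $uv^{-q/p'}\in A_1$ and $v^q\in A_\infty(uv^{-q/p'})$, then there exists a positive constant $C$ such that \[ \left(uv^{q/p}\left(\left\{x\in\mathbb{R}^n:\frac{|T_b^m(fv)(x)|}{v(x)}>t\right\}\right)\right)^{1/q}\leq\frac{C}{t}\,\|b\|_{\Lambda(\delta)}^m\left(\int_{\mathbb{R}^n}|f(x)|^p\,u(x)^{p/q}\,v(x)\,dx\right)^{1/p} \] for every $t>0$ and every bounded function $f$ with compact support.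
   Context: A weight $w$ is a locally integrable function on $\mathbb{R}^n$ with $0<w(x)<\infty$ for a.e. $x$. For a nonnegative function $w$ and a measurable set $E$, $w(E)=\int_E w(x)\,dx$. $p'$ is the conjugate exponent of $p$, with $p'=\infty$ if $p=1$ (so $q/p'=0$ when $p=1$). Cubes $Q\subset\mathbb{R}^n$ have sides parallel to the coordinate axes; infima of weights over cubes are essential infima. $w\in A_1$ means there is $C>0$ with $\frac{1}{|Q|}\int_Q w\leq C\inf_Q w$ for every cube $Q$. For a weight $\mu$: $w\in A_r(\mu)$, $1<r<\infty$, means there is $C>0$ such that $\left(\frac{1}{\mu(Q)}\int_Q w\,\mu\,dx\right)\left(\frac{1}{\mu(Q)}\int_Q w^{-\frac{1}{r-1}}\mu\,dx\right)^{r-1}\leq C$ for every cube $Q$; $w\in A_1(\mu)$ means $\frac{1}{\mu(Q)}\int_Q w\,\mu\,dx\leq C\inf_Q w$ for every cube $Q$; $A_\infty(\mu)=\bigcup_{1\le r<\infty}A_r(\mu)$. $\Lambda(\delta)$ is the class of (real-valued) $b\in L^1_{\mathrm{loc}}$ for which there is $C>0$ with $|b(x)-b(y)|\leq C|x-y|^\delta$ for all $x,y\in\mathbb{R}^n$; the smallest such $C$ is $\|b\|_{\Lambda(\delta)}$. A Calderón–Zygmund operator (of convolution type) is a linear operator $T$ bounded on $L^2(\mathbb{R}^n)$ such that for $f\in L^2$ with compact support, $Tf(x)=\int_{\mathbb{R}^n}K(x-y)f(y)\,dy$ for $x\notin\operatorname{supp}f$, where $K$ is a measurable function defined away from the origin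 which is a standard kernel: writing $K(x,y)=K(x-y)$, there is a constant $c$ with $|K(x,y)|\leq \frac{c}{|x-y|^{n}}$; $|K(x,y)-K(x,z)|\leq c\frac{|y-z|}{|x-y|^{n+1}}$ if $|x-y|>2|y-z|$; and $|K(x,y)-K(w,y)|\leq c\frac{|x-w|}{|x-y|^{n+1}}$ if $|x-y|>2|x-w|$. The additional hypothesis in the claim is that the integral representation holds for a.e. $x\in\mathbb{R}^n$ (not only outside $\operatorname{supp} f$), for the functions to which $T$ is applied. Higher order commutators are defined by $T_b^0=T$ and $T_b^m=[b,T_b^{m-1}]$ for $m\geq1$, where $[b,S]f=b\,Sf-S(bf)$. Under the additional hypothesis one has, for every such $m$, $T_b^mf(x)=\int_{\mathbb{R}^n}(b(x)-b(y))^mK(x-y)f(y)\,dy$ for a.e. $x$. *)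

(* Defs.v *)
From HB Require Import structures.
From mathcomp Require Import all_boot all_order all_algebra.
From mathcomp Require Import all_classical all_reals all_analysis.
From mathcomp Require Import measurable_realfun ess_sup_inf hoelder.

Set Implicit Arguments.
Unset Strict Implicit.
Unset Printing Implicit Defensive.

Import Order.TTheory GRing.Theory Num.Theory.
Import numFieldNormedType.Exports.

Local Open Scope classical_set_scope.
Local Open Scope ring_scope.

Section measurable_rV.
Context {R : realType} {n : nat}.

Let coor (i : 'I_n) (x : 'rV[R]_n) : R := x ord0 i.

Let rV_set0 : g_sigma_preimage coor set0.
Proof. exact: sigma_algebra0. Qed.

Let rV_setC A : g_sigma_preimage coor A -> g_sigma_preimage coor (~` A).
Proof. exact: sigma_algebraC. Qed.

Let rV_bigcup (F : _^nat) : (forall i, g_sigma_preimage coor (F i)) ->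
  g_sigma_preimage coor (\bigcup_i (F i)).
Proof. exact: sigma_algebra_bigcup. Qed.

(* The sigma-algebra of R^n is generated by the coordinates, i.e. it is the
   product (= Borel) sigma-algebra. *)
HB.instance Definition _ := @isMeasurable.Build default_measure_display
  'rV[R]_n (g_sigma_preimage coor) rV_set0 rV_setC rV_bigcup.

Lemma measurable_coor (i : 'I_n) :
  measurable_fun [set: 'rV[R]_n] (fun x : 'rV[R]_n => x ord0 i).
Proof.
move=> _ Y mY; rewrite setTI; apply: sub_sigma_algebra => /=.
rewrite -bigcup_seq/=; exists i => /=; first by rewrite mem_index_enum.
by exists Y => //; rewrite setTI.
Qed.

Lemma measurable_fun_rV d (T : measurableType d) (f : T -> 'rV[R]_n) :
  (forall i, measurable_fun [set: T] (fun t => f t ord0 i)) ->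
  measurable_fun [set: T] f.
Proof.
move=> mf.
have H : g_sigma_preimage (fun i => coor i \o f) `<=` measurable.
  apply: smallest_sub; first exact: sigma_algebra_measurable.
  rewrite -bigcup_seq; apply: bigcup_sub => i _.
  by move=> A [B mB <-]; exact: mf.
move: H; rewrite g_sigma_preimage_comp => H _ A mA.
by apply: H; exists A.
Qed.

End measurable_rV.

Section lebesgue_rV.
Context {R : realType}.
Local Open Scope ereal_scope.

Definition cons_rV n (p : R * 'rV[R]_n) : 'rV[R]_n.+1 :=
  row_mx (const_mx p.1 : 'rV[R]_1) p.2.

Definition uncons_rV n (x : 'rV[R]_n.+1) : R * 'rV[R]_n :=
  (x ord0 ord0, \row_i x ord0 (lift ord0 i)).

Lemma cons_rV0 n p : @cons_rV n p ord0 ord0 = p.1.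
Proof. by rewrite mxE; case: splitP => // j _; rewrite mxE. Qed.

Lemma cons_rVS n p i : @cons_rV n p ord0 (lift ord0 i) = p.2 ord0 i.
Proof.
rewrite mxE; case: splitP => [j|j /= /eqP]; first by case: j => -[].
by rewrite /bump/= eqn_add2l => /eqP ij; congr (p.2 _ _); exact/val_inj.
Qed.

Lemma cons_rVK n : cancel (@cons_rV n) (@uncons_rV n).
Proof.
move=> [a x]; rewrite /uncons_rV cons_rV0; congr (_, _).
by apply/rowP => i; rewrite mxE cons_rVS.
Qed.

Lemma measurable_cons_rV n : measurable_fun [set: R * 'rV[R]_n] (@cons_rV n).
Proof.
apply: measurable_fun_rV => i.
case: (unliftP ord0 i) => [j ->|->].
  rewrite (_ : (fun _ => _) = (fun x : 'rV[R]_n => x ord0 j) \o snd).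
    exact: (measurableT_comp (measurable_coor j)).
  by apply/funext => p; exact: cons_rVS.
rewrite (_ : (fun _ => _) = fst)//.
by apply/funext => p; exact: cons_rV0.
Qed.

Lemma measurable_uncons_rV n :
  measurable_fun [set: 'rV[R]_n.+1] (@uncons_rV n).
Proof.
apply/measurable_fun_pairP; split => /=; first exact: measurable_coor.
apply: measurable_fun_rV => i.
by under eq_fun do rewrite mxE; exact: measurable_coor.
Qed.

Section step.
Context (n : nat) (m : {sigma_finite_measure set 'rV[R]_n -> \bar R}).

Definition cons_measure : set 'rV[R]_n.+1 -> \bar R :=
  pushforward (@lebesgue_measure R \x m) (@cons_rV n).

Let cons_measure0 : cons_measure set0 = 0.
Proof. by rewrite /cons_measure /pushforward preimage_set0 measure0. Qed.

Let cons_measure_ge0 A : 0 <= cons_measure A.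
Proof. by rewrite /cons_measure /pushforward; exact: measure_ge0. Qed.

Let cons_measure_sigma_additive : semi_sigma_additive cons_measure.
Proof.
move=> F mF tF mUF; rewrite /cons_measure /pushforward preimage_bigcup.
have mc A : measurable A -> measurable (@cons_rV n @^-1` A).
  by move=> mA; rewrite -[X in measurable X]setTI; exact: measurable_cons_rV.
apply: measure_semi_sigma_additive.
- by move=> k; exact: mc.
- apply/trivIsetP => /= i j _ _ ij; rewrite -preimage_setI.
  by move/trivIsetP : tF => /(_ _ _ _ _ ij) ->//; rewrite preimage_set0.
- by rewrite -preimage_bigcup; exact: mc.
Qed.

HB.instance Definition _ := isMeasure.Build _ _ _ cons_measure
  cons_measure0 cons_measure_ge0 cons_measure_sigma_additive.

Let cons_measure_sigma_finite : sigma_finite setT cons_measure.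
Proof.
have /sigma_finiteP[F [TF ndF Foo]] := sigma_finiteT (@lebesgue_measure R).
have /sigma_finiteP[G [TG ndG Goo]] := sigma_finiteT m.
exists (fun k => @uncons_rV n @^-1` (F k `*` G k)).
  apply/esym; rewrite -subTset => x _.
  have : [set: R] (uncons_rV x).1 by [].
  have : [set: 'rV[R]_n] (uncons_rV x).2 by [].
  rewrite TF TG => -[j _ Gj] [i _ Fi]; exists (maxn i j) => //; split => /=.
    by move: Fi; exact/subsetPset/ndF/leq_maxl.
  by move: Gj; exact/subsetPset/ndG/leq_maxr.
move=> k; have [mF Fk] := Foo k; have [mG Gk] := Goo k; split.
  rewrite -[X in measurable X]setTI; apply: measurable_uncons_rV => //.
  exact: measurableX.
rewrite /cons_measure /pushforward -comp_preimage.
rewrite (_ : _ \o _ = id); last by apply/funext => x /=; exact: cons_rVK.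
rewrite preimage_id product_measure1E//.
by rewrite lte_mul_pinfty// ge0_fin_numE.
Qed.

HB.instance Definition _ := Measure_isSigmaFinite.Build _ _ _ cons_measure
  cons_measure_sigma_finite.

End step.

Fixpoint lebesgue_rV (n : nat) : {sigma_finite_measure set 'rV[R]_n -> \bar R} :=
  match n with
  | 0%N => \d_ (0%R : 'rV[R]_0)
  | k.+1 => cons_measure (lebesgue_rV k)
  end.

End lebesgue_rV.

Section boxes.
Context {R : realType}.

Definition box n (a b : 'rV[R]_n) : set 'rV[R]_n :=
  [set x | forall i, a ord0 i <= x ord0 i <= b ord0 i].

Lemma measurable_box n (a b : 'rV[R]_n) : measurable (box a b).
Proof.
rewrite (_ : box a b = \big[setI/setT]_(i < n)
    ((fun x : 'rV[R]_n => x ord0 i) @^-1` `[a ord0 i, b ord0 i]%classic)).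
  apply: bigsetI_measurable => i _; rewrite -[X in measurable X]setTI.
  exact: measurable_coor.
rewrite -bigcap_seq; apply/seteqP; split => x /= H i.
  by move=> _ /=; rewrite in_itv/=.
by have := H i; rewrite /= in_itv /= => /(_ (mem_index_enum _)).
Qed.

Lemma lebesgue_rV_box n (a b : 'rV[R]_n) :
  (forall i, a ord0 i <= b ord0 i) ->
  lebesgue_rV n (box a b) = (\prod_i (b ord0 i - a ord0 i))%:E.
Proof.
elim: n a b => [|n IHn] a b ab.
  by rewrite big_ord0 /= diracE mem_set//= => -[].
rewrite big_ord_recl /= /cons_measure /pushforward.
rewrite (_ : _ @^-1` _ = `[a ord0 ord0, b ord0 ord0]%classic `*`
    box (uncons_rV a).2 (uncons_rV b).2); last first.
  apply/seteqP; split => [[t x]|[t x] /= [+ H] i].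
    move=> /= H; split => [|i] /=.
      by have := H ord0; rewrite cons_rV0 in_itv.
    by have := H (lift ord0 i); rewrite cons_rVS !mxE.
  rewrite in_itv/= => tab; case: (unliftP ord0 i) => [j ->|->].
    by rewrite cons_rVS; have := H j; rewrite !mxE.
  by rewrite cons_rV0.
rewrite product_measure1E//=; last exact: measurable_box.
rewrite lebesgue_measure_itv/= lte_fin IHn => [|i]; last by rewrite !mxE.
under eq_bigr do rewrite !mxE.
have := ab ord0; rewrite le_eqVlt => /predU1P[->|->].
  by rewrite ltxx subrr mul0r mul0e.
by rewrite EFinM.
Qed.

End boxes.

Section weights.
Context {R : realType} {n : nat}.
Local Notation Rn := 'rV[R]_n.
Local Notation mu := (@lebesgue_rV R n).
Implicit Types (w : Rn -> R) (E : set Rn).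
Local Open Scope ereal_scope.

Definition cube (a : Rn) (l : R) : set Rn := box a (a + const_mx l)%R.

Lemma measurable_cube (a : Rn) (l : R) : measurable (cube a l).
Proof. exact: measurable_box. Qed.

Definition loc_integrable w :=
  forall A : set Rn, compact A -> mu.-integrable A (EFin \o w).

(* Weights are real-valued; since they only matter almost everywhere, the
   requirement w < +oo a.e. is built into the type. *)
Definition weight w := loc_integrable w /\ \forall x \ae mu, (0 < w x)%R.

Definition wmeasure w E : \bar R := \int[mu]_(x in E) (w x)%:E.

Definition cube_ess_inf w (a : Rn) (l : R) : \bar R :=
  ess_inf (mrestr mu (measurable_cube a l)) (EFin \o w).

Definition A1 w := exists2 C : R, (0 < C)%R &
  forall (a : Rn) (l : R), (0 < l)%R ->
    wmeasure w (cube a l) / mu (cube a l) <= C%:E * cube_ess_inf w a l.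

Definition A1_wrt (m w : Rn -> R) := exists2 C : R, (0 < C)%R &
  forall (a : Rn) (l : R), (0 < l)%R ->
    wmeasure (w \* m)%R (cube a l) / wmeasure m (cube a l)
      <= C%:E * cube_ess_inf w a l.

Definition Ar_wrt (m : Rn -> R) (r : R) w := exists2 C : R, (0 < C)%R &
  forall (a : Rn) (l : R), (0 < l)%R ->
    (wmeasure (w \* m)%R (cube a l) / wmeasure m (cube a l)) *
    (wmeasure (fun x => w x `^ (- (r - 1)^-1) * m x)%R (cube a l) /
       wmeasure m (cube a l)) `^ (r - 1) <= C%:E.

Definition Ainfty_wrt (m w : Rn -> R) :=
  A1_wrt m w \/ exists2 r : R, (1 < r)%R & Ar_wrt m r w.

End weights.

Section operators.
Context {R : realType} {n : nat}.
Local Notation Rn := 'rV[R]_n.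
Local Notation mu := (@lebesgue_rV R n).
Local Notation operator := ({mfun Rn >-> R} -> {mfun Rn >-> R}).

(* the Euclidean norm; the library norm `|x| on 'rV[R]_n is the sup norm *)
Definition enorm (x : Rn) : R := Num.sqrt (\sum_i x ord0 i ^+ 2).

Definition lipschitz_bound (delta : R) (b : Rn -> R) (C : R) :=
  forall x y, `|b x - b y| <= C * enorm (x - y) `^ delta.

Definition Lambda (delta : R) (b : Rn -> R) :=
  loc_integrable b /\ exists2 C, 0 < C & lipschitz_bound delta b C.

Definition Lambda_norm (delta : R) (b : Rn -> R) : R :=
  inf [set C | 0 < C /\ lipschitz_bound delta b C].

Definition compact_support (f : Rn -> R) := compact (closure [set x | f x != 0]).

(* The value of K at the origin is irrelevant: no condition involves it, and
   {0} is a null set in the integrals below. *)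
Definition standard_kernel (K : Rn -> R) :=
  measurable_fun ([set~ 0] : set Rn) K /\
  exists c : R,
    [/\ forall x y, x != y -> `|K (x - y)| <= c / enorm (x - y) ^+ n,
        forall x y z, 2 * enorm (y - z) < enorm (x - y) ->
          `|K (x - y) - K (x - z)| <= c * enorm (y - z) / enorm (x - y) ^+ n.+1 &
        forall x y w, 2 * enorm (x - w) < enorm (x - y) ->
          `|K (x - y) - K (w - y)| <= c * enorm (x - w) / enorm (x - y) ^+ n.+1].

Definition L2_fun (f : {mfun Rn >-> R}) := ('N[mu]_2%:E[EFin \o f] < +oo)%E.

(* Equality in \bar R with the real number T f x forces the positive and the
   negative part of the integrand to have finite integrals, so this includes
   the absolute convergence of the integral. *)
Definition kernel_formula (K : Rn -> R) (T : operator) (f : {mfun Rn >-> R})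
  (x : Rn) := (T f x)%:E = (\int[mu]_y (K (x - y) * f y)%:E)%E.

Definition calderon_zygmund (K : Rn -> R) (T : operator) :=
  [/\ standard_kernel K,
      forall (a : R) (f g : {mfun Rn >-> R}), L2_fun f -> L2_fun g ->
        \forall x \ae mu, T (a *: f + g) x = a * T f x + T g x,
      exists c : R, forall f : {mfun Rn >-> R}, L2_fun f ->
        ('N[mu]_2%:E[EFin \o T f] <= c%:E * 'N[mu]_2%:E[EFin \o f])%E &
      forall f : {mfun Rn >-> R}, L2_fun f -> compact_support f ->
        \forall x \ae mu, ~ closure [set y | f y != 0] x ->
          kernel_formula K T f x].

(* q / p', which is 0 when p = 1 *)
Definition over_conjugate (q p : R) : R :=
  fine (q%:E / hoelder_conjugate p%:E)%E.

(* The functions b^j f v (f bounded with compact support, v a weight, b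
   continuous) to which T is applied in T_b^m (f v) are integrable with compact
   support, but need not be in L^2; T is defined on all measurable functions,
   with unspecified values outside L^2 and this class. *)
Definition everywhere_represented (K : Rn -> R) (T : operator) :=
  forall g : {mfun Rn >-> R}, mu.-integrable setT (EFin \o g) ->
    compact_support g -> \forall x \ae mu, kernel_formula K T g x.

Definition commutator (b : {mfun Rn >-> R}) (S : operator) : operator :=
  fun f => b * S f - S (b * f).

Definition iter_commutator (m : nat) (b : {mfun Rn >-> R}) (T : operator) :=
  iter m (commutator b) T.

End operators.

(* Main.v *)
Require Import Defs.
From mathcomp Require Import all_boot all_order all_algebra.
From mathcomp Require Import all_classical all_reals all_analysis.
From mathcomp Require Import measurable_realfun ess_sup_inf.
From mathcomp Require Import ring lra zify.

Import Order.TTheory GRing.Theory Num.Theory.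
Import numFieldNormedType.Exports.

Set Implicit Arguments.
Unset Strict Implicit.
Unset Printing Implicit Defensive.

Local Open Scope classical_set_scope.
Local Open Scope ring_scope.

(** Since the kernel representation holds almost everywhere, no cancellation is left in
    the problem. The commutator is an integral operator with kernel
    [(b x - b y) ^+ m * K (x - y)], and the Hoelder continuity of [b] bounds this kernel by
    a multiple of [|x - y| ^ (m delta - n)]. Hence the commutator of [g = f v] is dominated
    almost everywhere by a fractional integral of [|g|] of order [m delta]
    ([iter_commutator_le_riesz]), written here as a sum over dyadic radii
    ([riesz_series]), and what has to be proved is a mixed weak-type inequality for that
    positive operator ([mixed_bound]).

    Put [gam = p / q], a number in ]0, 1[. The two hypotheses on the weights are brought to
    one form, with an A1 weight, again called [u], and a weight [V]; the measure on the
    left-hand side is [u V dx] in both cases.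
    - In case (i) the A1 weight is the original one and [V = v ^ (q / p)].
    - In case (ii) it is [u v ^ (- q / p')], and [V = v ^ q].
    The right-hand side becomes the integral of [H u ^ gam], where [H] is [|f| ^ p v] or
    [|f| ^ p v ^ p], and [|g| = H ^ (1 / p) z ^ b] with [z = V] and [b = (p - 1) / q] in case
    (i), with [z = 1] and [b = 0] in case (ii).

    The fractional integral is not attacked directly. Consider instead the operator
    [potential], the sum over dyadic balls [B] centred at [x] of
    [|B| ^ - gam * u(B) ^ - kap * \int_B H], where [kap > 0] is an auxiliary exponent with
    [gam + kap < 1]. It is linear in [H], and enters twice.
    - A Hedberg-type argument ([hedberg]) bounds the fractional integral at almost every
      point by [z ^ b] times a product of powers of the potential and of the integral of
      [H u ^ gam]. So a large fractional integral at [x] forces the potential at [x] to be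
      at least a multiple of [V x ^ (gam + kap)].
    - Weak-type bounds of this kind for the potential follow by duality from a testing
      condition ([testing], [testing_weak_type]): for every set [E] of finite measure, the
      transposed sum of the restriction to [E] of [u V ^ (1 - gam - kap)] is at most
      [K * u y ^ gam * (uV)(E) ^ (1 - gam - kap)] at almost every [y].
    Both parts sum over all dyadic scales at no cost, because the mass of the ball of
    radius [r] for an A1 weight grows geometrically with [r] ([A1_reverse_doubling]), as does
    that for [u V] in case (ii) ([negative_power_share]): a sequence whose terms are at most
    [min (X ^ e) (X ^ - e)], with [X] such a mass up to a factor, has a bounded sum
    ([sum_lacunary]).

    The testing condition is where the two hypotheses differ. In case (ii) the A-infinity
    condition is used through integrals of negative powers of [V]
    ([Ainfty_negative_power_bound], [testing_Ainfty]). In case (i) it rests on the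
    inequality [\int_Q u V ^ e <= K u(Q) (avg_Q V) ^ e] for small [e > 0] ([A1_power],
    [testing_A1]), a form of the reverse Hoelder inequality for [u]. That inequality comes
    from a power-type absolute continuity of A1 weights ([A1_abs_cont]), which is proved
    without maximal functions or stopping times, by induction over dyadic subcubes with a
    Bellman function ([bellman]). *)

(** * Nonnegative functions, cubes and balls of the sup norm *)

Section integrals_of_nonnegative_functions.
Context {R : realType} {n : nat}.
Local Notation Rn := 'rV[R]_n.
Local Notation mu := (@lebesgue_rV R n).
Implicit Types (f g u w : Rn -> R) (A B : set Rn).
Local Open Scope ereal_scope.

Definition nnmeas f := measurable_fun [set: Rn] f /\ forall x, (0 <= f x)%R.

Lemma nnmeas_EFin A f : nnmeas f -> measurable_fun A (EFin \o f).
Proof.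
by move=> [mf _]; apply/measurable_EFinP; apply: measurable_funS mf.
Qed.

Lemma nnmeas_cst (c : R) : (0 <= c)%R -> nnmeas (fun=> c).
Proof. by move=> c0; split => //; exact: measurable_cst. Qed.

Lemma nnmeasD f g : nnmeas f -> nnmeas g -> nnmeas (fun x => f x + g x)%R.
Proof.
move=> [mf f0] [mg g0]; split; first exact: measurable_funD.
by move=> x; rewrite addr_ge0.
Qed.

Lemma nnmeasM f g : nnmeas f -> nnmeas g -> nnmeas (fun x => f x * g x)%R.
Proof.
move=> [mf f0] [mg g0]; split; first exact: measurable_funM.
by move=> x; rewrite mulr_ge0.
Qed.

Lemma nnmeasZ (c : R) f : (0 <= c)%R -> nnmeas f -> nnmeas (fun x => c * f x)%R.
Proof. by move=> c0 hf; apply: nnmeasM => //; exact: nnmeas_cst. Qed.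

Lemma nnmeas_powR f (e : R) : nnmeas f -> nnmeas (fun x => f x `^ e)%R.
Proof.
move=> [mf f0]; split; last by move=> x; exact: powR_ge0.
exact: (measurableT_comp (measurable_powR _) mf).
Qed.

Lemma wmeasure_ge0 f A : nnmeas f -> 0 <= wmeasure f A.
Proof. by move=> [_ f0]; apply: integral_ge0 => x _; rewrite lee_fin. Qed.

Lemma wmeasure_subset f A B : nnmeas f -> measurable A -> measurable B ->
  A `<=` B -> wmeasure f A <= wmeasure f B.
Proof.
move=> hf mA mB AB; apply: ge0_subset_integral => //; first exact: nnmeas_EFin.
by move=> x _; rewrite lee_fin; exact: hf.2.
Qed.

Lemma le_wmeasure_ae f g A : nnmeas f -> nnmeas g -> measurable A ->
  {ae mu, forall x, A x -> (f x <= g x)%R} -> wmeasure f A <= wmeasure g A.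
Proof.
move=> hf hg mA fg; apply: ae_ge0_le_integral => //.
- by move=> x _; rewrite lee_fin; exact: hf.2.
- exact: nnmeas_EFin.
- by move=> x _; rewrite lee_fin; exact: hg.2.
- exact: nnmeas_EFin.
Qed.

Lemma le_wmeasure f g A : nnmeas f -> nnmeas g -> measurable A ->
  (forall x, A x -> (f x <= g x)%R) -> wmeasure f A <= wmeasure g A.
Proof. by move=> hf hg mA fg; apply: le_wmeasure_ae => //; exact: nearW. Qed.

Lemma wmeasureD f g A : nnmeas f -> nnmeas g -> measurable A ->
  wmeasure (fun x => f x + g x)%R A = wmeasure f A + wmeasure g A.
Proof.
move=> hf hg mA; rewrite /wmeasure.
under eq_integral do rewrite EFinD.
rewrite ge0_integralD//.
- by move=> x _; rewrite lee_fin; exact: hf.2.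
- exact: nnmeas_EFin.
- by move=> x _; rewrite lee_fin; exact: hg.2.
- exact: nnmeas_EFin.
Qed.

Lemma wmeasureZ (c : R) f A : (0 <= c)%R -> nnmeas f -> measurable A ->
  wmeasure (fun x => c * f x)%R A = c%:E * wmeasure f A.
Proof.
move=> c0 hf mA; rewrite /wmeasure.
under eq_integral do rewrite EFinM.
rewrite ge0_integralZl_EFin//; last exact: nnmeas_EFin.
by move=> x _; rewrite lee_fin; exact: hf.2.
Qed.

Lemma wmeasure_cst (c : R) A : measurable A ->
  wmeasure (fun=> c) A = c%:E * mu A.
Proof. by move=> mA; rewrite /wmeasure -(integral_cst mu mA c%:E). Qed.

Lemma wmeasure_null f A : nnmeas f -> measurable A -> mu A = 0 ->
  wmeasure f A = 0.
Proof.
move=> hf mA A0; rewrite /wmeasure.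
rewrite (ge0_negligible_integral _ _ _ _ A0)// ?setDv ?integral_set0//.
  exact: nnmeas_EFin.
by move=> x _; rewrite lee_fin; exact: hf.2.
Qed.

End integrals_of_nonnegative_functions.

Section cubes.
Context {R : realType} {n : nat}.
Local Notation Rn := 'rV[R]_n.
Local Notation mu := (@lebesgue_rV R n).
Implicit Types (a x y : Rn) (l r : R).

Lemma cubeP a l x :
  cube a l x <-> forall i, a ord0 i <= x ord0 i <= a ord0 i + l.
Proof. by split=> H i; have := H i; rewrite !mxE. Qed.

Lemma mu_cube a l : 0 <= l -> mu (cube a l) = (l ^+ n)%:E.
Proof.
move=> l0; rewrite /cube lebesgue_rV_box => [|i]; last first.
  by rewrite !mxE lerDl.
congr (_%:E); rewrite -[in RHS](card_ord n) -prodr_const; apply: eq_bigr => i _.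
by rewrite !mxE addrAC subrr add0r.
Qed.

(** Half-open cubes are disjoint unions of their dyadic subcubes. *)
Definition hcube a l : set Rn :=
  [set x | forall i, a ord0 i <= x ord0 i < a ord0 i + l].

Lemma measurable_hcube a l : measurable (hcube a l).
Proof.
rewrite (_ : hcube a l = \big[setI/setT]_(i < n)
    ((fun x : Rn => x ord0 i) @^-1` `[a ord0 i, a ord0 i + l[%classic)).
  apply: bigsetI_measurable => i _; rewrite -[X in measurable X]setTI.
  exact: measurable_coor.
rewrite -bigcap_seq; apply/seteqP; split => x /= H i.
  by move=> _ /=; rewrite in_itv/=.
by have := H i; rewrite /= in_itv /= => /(_ (mem_index_enum _)).
Qed.

Lemma hcube_sub a l : hcube a l `<=` cube a l.
Proof.
by move=> x H; apply/cubeP => i; have /andP[-> /ltW ->] := H i.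
Qed.

Lemma mu_cubeD a l : 0 <= l -> mu (cube a l `\` hcube a l) = 0%E.
Proof.
move=> l0.
pose F i := box (\row_j if j == i then a ord0 j + l else a ord0 j)
                (a + const_mx l).
have mF i : measurable (F i) by exact: measurable_box.
have F0 i : mu (F i) = 0%E.
  rewrite /F lebesgue_rV_box.
    by rewrite (bigD1 i)//= !mxE eqxx subrr mul0r.
  by move=> j; rewrite !mxE; case: ifPn => _ //; rewrite lerDl.
have sub : cube a l `\` hcube a l `<=` \bigcup_(i in [set: 'I_n]) F i.
  move=> x [/cubeP ax /existsNP[i xi]]; exists i => // j; rewrite !mxE.
  have /andP[ai ail] := ax j; rewrite ail andbT; case: eqP => [ji|//].
  have /andP[bi _] := ax i.
  by rewrite leNgt ji; apply/negP => lt; apply: xi; rewrite bi lt.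
apply: (subset_measure0 _ _ sub).
- by apply: measurableD; [exact: measurable_cube|exact: measurable_hcube].
- by apply: fin_bigcup_measurable => // i _; exact: mF.
have -> : \bigcup_(i in [set: 'I_n]) F i = \big[setU/set0]_(i < n) F i.
  rewrite -bigcup_seq; apply/seteqP; split => z [i _ Fi]; exists i => //=.
  by rewrite mem_index_enum.
suff [] : measurable (\big[setU/set0]_(i < n) F i) /\
  mu (\big[setU/set0]_(i < n) F i) = 0%E by [].
elim/big_ind : _ => //.
move=> A B [mA A0] [mB B0]; split; first exact: measurableU.
apply/eqP; rewrite -measure_le0.
apply: (@le_trans _ _ (mu A + mu B)%E); first exact: measureU2.
by rewrite A0 B0 adde0.
Qed.

Lemma mu_hcube a l : 0 <= l -> mu (hcube a l) = (l ^+ n)%:E.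
Proof.
move=> l0; rewrite -(mu_cube a l0) -[in RHS](setDUK (@hcube_sub a l)).
rewrite measureU //; last by rewrite setDIK.
- by rewrite [X in (_ + X)%E](mu_cubeD a l0) adde0.
- exact: measurable_hcube.
- by apply: measurableD; [exact: measurable_cube|exact: measurable_hcube].
Qed.

(** The closed ball of the sup norm: a cube, but with the symmetry in the centre and the
    point ([sball_sym]) that the exchange of integrals below requires. *)
Definition sball x r : set Rn := cube (x - const_mx r) (2 * r).

Lemma sballP x r y :
  sball x r y <-> forall i, `|x ord0 i - y ord0 i| <= r.
Proof.
rewrite /sball; split.
  move/cubeP => H i; have := H i; rewrite !mxE => /andP[h1 h2].
  by rewrite ler_norml; lra.
move=> H; apply/cubeP => i; rewrite !mxE; have := H i.
by rewrite ler_norml => /andP[h1 h2]; lra.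
Qed.

Lemma sball_sym x r y : sball x r y -> sball y r x.
Proof. by move=> /sballP H; apply/sballP => i; rewrite distrC. Qed.

Lemma sball_center x r : 0 <= r -> sball x r x.
Proof. by move=> r0; apply/sballP => i; rewrite subrr normr0. Qed.

Lemma measurable_sball x r : measurable (sball x r).
Proof. exact: measurable_cube. Qed.

Lemma mu_sball x r : 0 <= r -> mu (sball x r) = ((2 * r) ^+ n)%:E.
Proof. by move=> r0; rewrite mu_cube// mulr_ge0. Qed.

Lemma sball_sub x y r s : sball x s y -> sball x r `<=` sball y (s + r).
Proof.
move=> /sballP xy z /sballP xz; apply/sballP => i.
rewrite -(subrKA (x ord0 i)) (le_trans (ler_normD _ _))// lerD// distrC.
exact: xy.
Qed.

Lemma subset_sball x r s : r <= s -> sball x r `<=` sball x s.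
Proof. by move=> rs z /sballP H; apply/sballP => i; exact: le_trans (H i) rs. Qed.

Lemma compact_cube a l : compact (cube a l).
Proof.
have -> : cube a l = [set v : Rn | forall i,
    (`[a ord0 i, a ord0 i + l]%classic : set R) (v ord0 i)].
  apply/seteqP; split => x; first by move/cubeP => H i; rewrite /= in_itv/=.
  by move=> H; apply/cubeP => i; have := H i; rewrite /= in_itv.
apply: (@rV_compact R n
  (fun i => `[a ord0 i, a ord0 i + l]%classic : set R)) => i.
exact: segment_compact.
Qed.

End cubes.

(** * A1 weights *)

Section muckenhoupt_one.
Context {R : realType} {n : nat}.
Local Notation Rn := 'rV[R]_n.
Local Notation mu := (@lebesgue_rV R n).
Implicit Types (a x y : Rn) (l r s : R) (f g u : Rn -> R) (A : set Rn).

Lemma eq_wmeasure_ae f g A : measurable_fun setT f -> measurable_fun setT g ->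
  measurable A -> {ae mu, forall x, f x = g x} -> wmeasure f A = wmeasure g A.
Proof.
move=> mf mg mA fg; rewrite /wmeasure; apply: ae_eq_integral => //.
- by apply/measurable_EFinP; apply: measurable_funS mf.
- by apply/measurable_EFinP; apply: measurable_funS mg.
- by apply: filterS fg => x -> _.
Qed.

Lemma cube_ess_inf_ae f a l : {ae mu, forall y, cube a l y ->
  (cube_ess_inf f a l <= (f y)%:E)%E}.
Proof.
have [N [mN N0 sub]] :=
  ess_inf_le (mrestr mu (measurable_cube a l)) (EFin \o f).
exists (N `&` cube a l); split.
- by apply: measurableI => //; exact: measurable_cube.
- exact: N0.
- by move=> y /= /not_implyP[yl yN]; split => //; exact: sub.
Qed.

Lemma ae_exists A (P : Rn -> Prop) : measurable A -> (0 < mu A)%E ->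
  {ae mu, forall x, A x -> P x} -> exists2 x, A x & P x.
Proof.
move=> mA A0 [N [mN N0 sub]]; apply: contrapT => /forall2NP H.
move: A0; rewrite ltNge => /negP; apply; rewrite -N0.
apply: le_measure; rewrite ?inE// => x Ax; apply: sub => /= /(_ Ax) Px.
by have [|] := H x.
Qed.

(** A weight is positive only almost everywhere. Its powers and quotients are easier to
    handle for a representative that is positive at every point. *)
Definition strict_weight u := [/\ measurable_fun [set: Rn] u, (forall x, 0 < u x) &
  forall a l, (wmeasure u (cube a l) < +oo)%E].

(** Unlike in the definition of A1, the exceptional null set is the same for all cubes, so
    that at a given point the inequality is available at all scales at once. *)
Definition A1_const (C : R) u := {ae mu, forall y, forall a l, 0 < l -> cube a l y ->
  (wmeasure u (cube a l) <= (C * l ^+ n * u y)%:E)%E}.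

Definition mass u (A : set Rn) : R := fine (wmeasure u A).

Lemma strict_weight_nnmeas u : strict_weight u -> nnmeas u.
Proof. by move=> [mu_ u0 _]; split => // x; exact: ltW. Qed.

Lemma massE u a l : strict_weight u -> wmeasure u (cube a l) = (mass u (cube a l))%:E.
Proof.
move=> hu; rewrite fineK// ge0_fin_numE; first by case: hu.
exact: wmeasure_ge0 (strict_weight_nnmeas hu).
Qed.

Lemma mass_ge0 u A : nnmeas u -> 0 <= mass u A.
Proof. by move=> hu; rewrite fine_ge0// wmeasure_ge0. Qed.

Lemma wmeasure_gt0 u A : measurable_fun [set: Rn] u -> (forall x, 0 < u x) ->
  measurable A -> (0 < mu A -> 0 < wmeasure u A)%E.
Proof.
move=> mfu u0 mA A0; have hu : nnmeas u by split => // x; exact: ltW.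
rewrite lt_neqAle wmeasure_ge0// andbT eq_sym; apply/negP => /eqP H.
have : (\int[mu]_(x in A) `|(u x)%:E| = 0)%E.
  by rewrite -[RHS]H; apply: eq_integral => x _; rewrite /= ger0_norm// ltW.
move/(ae_eq_integral_abs mu mA (nnmeas_EFin hu)) => [N [mN N0 sub]].
move: A0; rewrite ltNge => /negP; apply; rewrite -N0.
apply: le_measure; rewrite ?inE// => x Ax; apply: sub => /= /(_ Ax) [] ux0.
by have := u0 x; rewrite ux0 ltxx.
Qed.

Lemma mass_gt0 u a l : strict_weight u -> 0 < l -> 0 < mass u (cube a l).
Proof.
move=> hu l0; rewrite -lte_fin -massE//; case: hu => mfu u0 _.
apply: wmeasure_gt0 => //; first exact: measurable_cube.
by rewrite mu_cube ?ltW// lte_fin exprn_gt0.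
Qed.

(** Uncountably many cubes are handled by enlarging each one to a cube with
    rational data; this is what allows the almost-everywhere quantifier to be
    pulled in front of the quantifier over cubes. *)
Lemma A1_A1_const u u' : A1 u -> measurable_fun [set: Rn] u ->
  measurable_fun [set: Rn] u' -> (forall x, 0 < u' x) ->
  {ae mu, forall x, u x = u' x} ->
  strict_weight u' /\ exists2 C, 1 <= C & A1_const C u'.
Proof.
move=> [C C0 HC] mfu mfu' u'0 uu'.
have hu' : nnmeas u' by split => // x; exact: ltW.
have W a l : wmeasure u (cube a l) = wmeasure u' (cube a l).
  by apply: eq_wmeasure_ae => //; exact: measurable_cube.
have key a l : 0 < l -> {ae mu, forall y, cube a l y ->
    (wmeasure u' (cube a l) <= (C * l ^+ n * u' y)%:E)%E}.
  move=> l0; have := HC a l l0; rewrite W (mu_cube a (ltW l0)).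
  rewrite inver gt_eqF ?exprn_gt0// => H.
  apply: filterS2 uu' (cube_ess_inf_ae u a l) => y <- Hy /Hy {}Hy.
  rewrite mulrAC EFinM -lee_pdivrMr ?exprn_gt0//.
  apply: le_trans H _; rewrite EFinM; apply: lee_wpmul2l => //.
  by rewrite lee_fin ltW.
pose F k : 'rV[rat]_n * rat := odflt (0, 0) (unpickle k).
pose Fa k : Rn := \row_i ratr ((F k).1 ord0 i).
pose Fl k : R := ratr (F k).2.
have keyF : {ae mu, forall y, forall k, 0 < Fl k -> cube (Fa k) (Fl k) y ->
    (wmeasure u' (cube (Fa k) (Fl k)) <= (C * (Fl k) ^+ n * u' y)%:E)%E}.
  apply: ae_foralln => k; have [l0|l0] := ltP 0 (Fl k).
    by apply: filterS (key (Fa k) _ l0) => y Hy _.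
  exact: nearW.
(* the rational cube has side at most [3 * l], which costs a factor [3 ^+ n] *)
have find a l : 0 < l -> exists k, [/\ cube a l `<=` cube (Fa k) (Fl k),
    0 < Fl k & Fl k <= 3 * l].
  move=> l0.
  have /boolp.choice[f hf] : forall i, exists q : rat,
      a ord0 i - l < ratr q < a ord0 i.
    move=> i; have [|q] := @rat_in_itvoo R (a ord0 i - l) (a ord0 i).
      by rewrite ltrBlDr ltrDl.
    by rewrite in_itv /= => qi; exists q.
  have [|ql] := @rat_in_itvoo R (2 * l) (3 * l); first lra.
  rewrite in_itv /= => /andP[ql1 ql2].
  exists (pickle (\row_i f i, ql)).
  rewrite /Fa /Fl /F pickleK /=; split; [|lra|exact: ltW].
  move=> x /cubeP H; apply/cubeP => i; rewrite !mxE.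
  by have := hf i; have := H i; lra.
have l01 l : 0 < Num.max l 1 by rewrite lt_max ltr01 orbT.
have fin_cube a l : (wmeasure u' (cube a l) < +oo)%E.
  have [k [sub l0 _]] := find a (Num.max l 1) (l01 l).
  have Fk0 : (0 < mu (cube (Fa k) (Fl k)))%E.
    by rewrite mu_cube ?ltW// lte_fin exprn_gt0.
  have [y _] := ae_exists (measurable_cube _ _) Fk0 (key (Fa k) _ l0).
  move=> /le_lt_trans; move/(_ _ (ltry _)).
  apply: le_lt_trans; apply: wmeasure_subset => //; try exact: measurable_cube.
  apply: subset_trans sub => x /cubeP H; apply/cubeP => i.
  have /andP[-> H2] := H i; rewrite (le_trans H2)// lerD2l.
  by rewrite le_max lexx.
split; first by split.
exists (Num.max 1 (C * 3 ^+ n)); first by rewrite le_max lexx.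
apply: filterS keyF => y Hy a l l0 aly.
have [k [sub Fl0 Fl3]] := find a l l0.
apply: (@le_trans _ _ (wmeasure u' (cube (Fa k) (Fl k)))).
  by apply: wmeasure_subset => //; exact: measurable_cube.
apply: le_trans (Hy k Fl0 (sub _ aly)) _; rewrite lee_fin ler_pM2r//.
apply: (@le_trans _ _ (C * 3 ^+ n * l ^+ n)).
  by rewrite -mulrA -exprMn ler_pM2l// lerXn2r// ?nnegrE ?ltW// mulr_gt0.
by rewrite ler_pM2r ?exprn_gt0// le_max lexx orbT.
Qed.

(** The A1 inequality for the larger cube is integrated over the smaller one. *)
Lemma A1_share C u a l a' l' : strict_weight u -> A1_const C u -> 0 <= C -> 0 < l -> 0 < l' ->
  cube a l `<=` cube a' l' ->
  mass u (cube a' l') * l ^+ n <= C * l' ^+ n * mass u (cube a l).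
Proof.
move=> hu hC C0 l0 l'0 sub; rewrite -lee_fin !EFinM -!massE//.
rewrite -(mu_cube a (ltW l0)) (massE _ _ hu) -wmeasure_cst; last exact: measurable_cube.
rewrite -EFinM -wmeasureZ; first last.
- exact: measurable_cube.
- exact: strict_weight_nnmeas.
- by rewrite mulr_ge0// exprn_ge0// ltW.
apply: le_wmeasure_ae.
- by apply: nnmeas_cst; apply: mass_ge0; exact: strict_weight_nnmeas.
- by apply: nnmeasZ; [rewrite mulr_ge0// exprn_ge0// ltW|exact: strict_weight_nnmeas].
- exact: measurable_cube.
apply: filterS hC => y Hy ya; have := Hy a' l' l'0 (sub _ ya).
by rewrite massE.
Qed.

Lemma A1_share_sball C u x y r s : strict_weight u -> A1_const C u -> 0 <= C -> 0 < r -> 0 < s ->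
  sball x r `<=` sball y s -> mass u (sball y s) * r ^+ n <= C * s ^+ n * mass u (sball x r).
Proof.
move=> hu hC C0 r0 s0 sub.
have := A1_share hu hC C0 (mulr_gt0 (ltr0n R 2) r0)
  (mulr_gt0 (ltr0n R 2) s0) sub.
rewrite !exprMn /sball; set X := mass u _; set Y := mass u _ => H.
by rewrite -(ler_pM2l (exprn_gt0 n (ltr0n R 2))); lra.
Qed.

(** The side of the corner cube is an eighth of that of the ball of radius [2 * r]: this is
    the origin of the constant [8 ^+ n] below. *)
Lemma corner_sub x r : 0 < r ->
  cube (x + const_mx (3 / 2 * r)) (r / 2) `<=`
  cube (x - const_mx (2 * r)) (2 * (2 * r)).
Proof.
move=> r0 y /cubeP H; apply/cubeP => i.
by have := H i; rewrite !mxE; lra.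
Qed.

(** The corner cube of [sball x (2 * r)] is disjoint from [sball x r], so its share of
    the mass comes on top of that of the smaller ball. *)
Lemma reverse_doubling (hn : (0 < n)%N) u (k : R) x r : strict_weight u -> 0 < r -> 0 <= k ->
  k * mass u (sball x (2 * r)) <= mass u (cube (x + const_mx (3 / 2 * r)) (r / 2)) ->
  (1 + k) * mass u (sball x r) <= mass u (sball x (2 * r)).
Proof.
move=> hu r0 k0 hk.
have nn := strict_weight_nnmeas hu.
set Q := cube _ _ in hk.
have mQ : measurable Q by exact: measurable_cube.
have mb s : measurable (sball x s) by exact: measurable_sball.
have dis : sball x r `&` Q = set0.
  rewrite -subset0 => y [/sballP H1 /cubeP H2].
  have := H1 (Ordinal hn); have := H2 (Ordinal hn); rewrite !mxE ler_norml.
  by lra.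
have sub : sball x r `|` Q `<=` sball x (2 * r).
  move=> y [|/cubeP H]; first by apply: (@subset_sball _ _ x r (2 * r)); lra.
  by apply/sballP => i; have := H i; rewrite !mxE ler_norml; lra.
have mono : mass u (sball x r) <= mass u (sball x (2 * r)).
  rewrite -lee_fin -!massE//; apply: wmeasure_subset => //;
    try exact: measurable_cube.
  by apply: (@subset_sball _ _ x r (2 * r)); lra.
have : mass u (sball x r) + mass u Q <= mass u (sball x (2 * r)).
  rewrite -lee_fin EFinD -!massE// /wmeasure -ge0_integral_setU//.
  - apply: wmeasure_subset => //; first by apply: measurableU => //; exact: measurable_cube.
    exact: measurable_cube.
  - exact: measurable_cube.
  - exact: nnmeas_EFin.
  - by move=> y _; rewrite lee_fin; exact: nn.2.
  - by apply/disj_set2P.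
by have := ler_wpM2l k0 mono; lra.
Qed.

Lemma A1_corner C u x r : strict_weight u -> A1_const C u -> 1 <= C -> 0 < r ->
  (C * 8 ^+ n)^-1 * mass u (sball x (2 * r)) <=
  mass u (cube (x + const_mx (3 / 2 * r)) (r / 2)).
Proof.
move=> hu hC C1 r0; have C0 : 0 < C by lra.
have l0 : 0 < r / 2 by lra.
have l'0 : 0 < 2 * (2 * r) by lra.
have := A1_share hu hC (ltW C0) l0 l'0 (corner_sub (x:=x) r0).
rewrite {2}(_ : 2 * (2 * r) = 8 * (r / 2)); last by field.
rewrite (exprMn n 8) ler_pdivrMl ?mulr_gt0 ?exprn_gt0// => H.
rewrite -(ler_pM2r (exprn_gt0 n l0)); apply: le_trans H _.
by rewrite !mulrA [leRHS]mulrAC.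
Qed.

Lemma A1_reverse_doubling (hn : (0 < n)%N) C u x r : strict_weight u -> A1_const C u -> 1 <= C ->
  0 < r -> (1 + (C * 8 ^+ n)^-1) * mass u (sball x r) <= mass u (sball x (2 * r)).
Proof.
move=> hu hC C1 r0; have C0 : 0 < C by lra.
apply: reverse_doubling => //; first by rewrite invr_ge0 mulr_ge0// ltW.
exact: A1_corner.
Qed.

End muckenhoupt_one.

(** * Scalar inequalities and sums over dyadic scales *)

Section scalar_inequalities.
Context {R : realType}.
Implicit Types x y a b e f g X : R.

(** The scalar case of the substitute for Hoelder's inequality in [local_bound]. *)
Lemma powR_mul_le x y a b : 0 <= x -> 0 <= y -> 0 <= a -> 0 <= b ->
  a + b <= 1 -> x `^ a * y `^ b <= 1 + x + y.
Proof.
move=> x0 y0 a0 b0 ab1; set M := 1 + x + y.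
have M1 : 1 <= M by rewrite /M; lra.
apply: (@le_trans _ _ (M `^ a * M `^ b)).
  apply: ler_pM; rewrite ?powR_ge0//; apply: ge0_ler_powR; rewrite ?nnegrE//;
    rewrite /M; lra.
rewrite -powRD; last by rewrite (gt_eqF (lt_le_trans ltr01 M1)) implybT.
by rewrite -[leRHS]powRr1 ?(le_trans ler01)// ler_powR.
Qed.

Lemma powR_mul_inv x a : 0 < x -> x `^ a * x `^ (- a) = 1.
Proof.
by move=> x0; rewrite powRN mulfV// gt_eqF// powR_gt0.
Qed.

Lemma powR_add x a b : 0 < x -> x `^ (a + b) = x `^ a * x `^ b.
Proof. by move=> x0; rewrite powRD// (gt_eqF x0) implybT. Qed.

(** On an interval [[f, X * f]] the increments of the power [1 + e] control those of the
    power [e]; the factor [e] on the right is what a small exponent gains in [bellman]. *)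
Lemma bellman_scalar X f g e : 0 < f -> f <= g -> g <= X * f -> 1 <= X ->
  0 < e -> e <= 1 ->
  g * (g `^ e - f `^ e) <= X ^+ 2 * e * (g `^ (1 + e) - f `^ (1 + e)).
Proof.
move=> f0 fg gXf X1 e0 e1; have g0 : 0 < g by lra.
(* with [x = g / f], both sides are homogeneous in [f] and only [1 <= x <= X] matters *)
set x := g / f; have gE : g = x * f by rewrite /x divfK// gt_eqF.
have x1 : 1 <= x by rewrite /x ler_pdivlMr// mul1r.
have xX : x <= X by rewrite /x ler_pdivrMr.
have x0 : 0 < x by lra.
have xe1 : x - 1 <= x `^ (1 + e) - 1.
  by rewrite lerD2r -[leLHS](powRr1 (ltW x0)) ler_powR//; lra.
have xeX : x `^ e <= X.
  by apply: le_trans xX; rewrite -[leRHS](powRr1 (ltW x0)) ler_powR.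
have lnx : e * ln x <= e * (x - 1).
  have := @le_ln1Dx R (x - 1) ltac:(lra); rewrite [1 + _]addrC subrK => H.
  by rewrite ler_pM2l.
have lnx0 : 0 <= e * ln x by rewrite mulr_ge0 ?ln_ge0// ltW.
have diff : x `^ e - 1 <= x `^ e * (e * ln x).
  have H : 1 - e * ln x <= x `^ (- e).
    rewrite /powR gt_eqF// (le_trans _ (expR_ge1Dx _))//; lra.
  have := powR_mul_inv e x0; have := powR_gt0 e x0; nra.
have main : x * (x `^ e - 1) <= X ^+ 2 * e * (x `^ (1 + e) - 1).
  apply: (@le_trans _ _ (X * (X * (e * (x - 1))))).
    apply: ler_pM => //; first exact: ltW.
      rewrite subr_ge0 [leLHS](_ : _ = 1 `^ e); last by rewrite powR1.
      by apply: ge0_ler_powR; rewrite ?nnegrE// ltW.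
    by apply: le_trans diff _; apply: ler_pM => //; exact: powR_ge0.
  by rewrite expr2 -!mulrA !ler_pM2l//; lra.
have fe0 := powR_gt0 (1 + e) f0.
have f1e : f `^ (1 + e) = f * f `^ e by rewrite powR_add// powRr1 ?ltW.
have gpow c : g `^ c = x `^ c * f `^ c by rewrite gE powRM// ltW.
have -> : g * (g `^ e - f `^ e) = f `^ (1 + e) * (x * (x `^ e - 1)).
  by rewrite gpow f1e gE; ring.
have -> : X ^+ 2 * e * (g `^ (1 + e) - f `^ (1 + e)) =
    f `^ (1 + e) * (X ^+ 2 * e * (x `^ (1 + e) - 1)).
  by rewrite gpow; ring.
by rewrite ler_pM2l.
Qed.

End scalar_inequalities.

Section dyadic_radii.
Context {R : realType}.
Implicit Types (r : R) (m : R -> R).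

(** The integers are enumerated by natural numbers in order to write a sum over all dyadic
    scales, small and large, as an ordinary series of nonnegative terms. *)
Definition zenum (j : nat) : int := if odd j then Negz j./2 else Posz j./2.

Definition dyadic (j : nat) : R := 2 `^ (zenum j)%:~R.

Lemma dyadic_gt0 j : 0 < dyadic j. Proof. by rewrite powR_gt0. Qed.

Lemma dyadic_find r : 0 < r -> exists j, r <= dyadic j < 2 * r.
Proof.
move=> r0; have l2 : 0 < ln 2 :> R by rewrite ln_gt0// ltr1n.
pose z := Num.ceil (ln r / ln 2).
have [j jz] : exists j, zenum j = z.
  rewrite /zenum; case: (z) => k.
    by exists k.*2; rewrite odd_double doubleK.
  by exists k.*2.+1; rewrite /= odd_double /= uphalf_double.
exists j; rewrite /dyadic jz.
have E (a : R) : 2 `^ a = expR (a * ln 2) by rewrite /powR gt_eqF.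
rewrite E -{1}(lnK (x := r)) ?posrE// -{2}(lnK (x := r)) ?posrE//.
rewrite -[X in X * expR _](lnK (x := 2)) ?posrE// -expRD ler_expR ltr_expR.
have := @ceil_itv R (ln r / ln 2); rewrite -/z intrD => /andP[z1 z2].
apply/andP; split; first by rewrite -ler_pdivrMr.
by move: z1; rewrite ltr_pdivlMr// mulrDl; lra.
Qed.

(** The terms are dominated by the increments of the bounded increasing function
    [x / (1 + x)] along the geometrically growing sequence [m (2 ^ z)], so that
    the sum telescopes. *)
Lemma sum_lacunary m (k : R) : 0 < k -> (forall r, 0 < r -> 0 < m r) ->
  (forall r, 0 < r -> (1 + k) * m r <= m (2 * r)) ->
  forall J, \sum_(j < J) Num.min (m (dyadic j)) (m (dyadic j))^-1 <= 4 * (1 + k) / k.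
Proof.
move=> k0 m0 mk.
pose a (z : int) : R := m (2 `^ z%:~R).
pose phi x : R := x / (1 + x).
have a0 z : 0 < a z by apply: m0; rewrite powR_gt0.
have step z : Num.min (a z) (a z)^-1 <=
    4 * (1 + k) / k * (phi (a (z + 1)) - phi (a z)).
  have : (1 + k) * a z <= a (z + 1).
    rewrite /a intrD powR_add// powRr1// [_ * 2]mulrC; apply: mk.
    by rewrite powR_gt0.
  move: (a (z + 1)) (a0 (z + 1)) (a z) (a0 z) => y y0 x x0 xy.
  rewrite /phi => {a0 a}; set t := Num.min _ _.
  have t0 : 0 <= t by rewrite le_min ltW//= invr_ge0 ltW.
  have x10 : 0 < 1 + x by lra.
  have y10 : 0 < 1 + y by lra.
  have tx : t * (1 + x) ^+ 2 <= 4 * x.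
    have [x1|x1] := lerP x 1.
      have tx : t <= x by rewrite ge_min lexx.
      have : (1 + x) ^+ 2 <= 4 by nra.
      by nra.
    have : t * x <= 1.
      by rewrite -ler_pdivlMr// div1r ge_min lexx orbT.
    by nra.
  have -> : y / (1 + y) - x / (1 + x) = (y - x) / ((1 + x) * (1 + y)).
    by field; rewrite !gt_eqF.
  rewrite mulrA ler_pdivlMr ?mulr_gt0// mulrAC ler_pdivlMr//.
  have h1 : k * (1 + y) <= (1 + k) * (y - x) * (1 + x) / x.
    rewrite ler_pdivlMr//; nra.
  rewrite ler_pdivlMr// in h1.
  have h2 : 0 <= t * (1 + x) * (k * (1 + y)) by rewrite !mulr_ge0// ltW.
  rewrite -(ler_pM2r x0).
  apply: (@le_trans _ _ (t * (1 + x) * ((1 + k) * (y - x) * (1 + x)))).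
    rewrite (_ : _ * x = t * (1 + x) * (k * (1 + y) * x)); last by ring.
    by apply: ler_wpM2l => //; rewrite mulr_ge0// ltW.
  rewrite (_ : t * _ * _ = t * (1 + x) ^+ 2 * ((1 + k) * (y - x))); last by ring.
  rewrite (_ : _ * x = 4 * x * ((1 + k) * (y - x))); last by ring.
  by apply: ler_wpM2r => //; rewrite mulr_ge0//; nra.
have mn_ge0 j : 0 <= Num.min (m (dyadic j)) (m (dyadic j))^-1.
  by rewrite le_min ltW ?m0 ?dyadic_gt0//= invr_ge0 ltW// m0 ?dyadic_gt0.
have phi01 z : 0 <= phi (a z) <= 1.
  by rewrite /phi; have := a0 z; move: (a z) => x x0;
    rewrite divr_ge0 ?ler_pdivrMr; lra.
have tele J : \sum_(j < J.*2) Num.min (m (dyadic j)) (m (dyadic j))^-1 <=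
    4 * (1 + k) / k * (phi (a J) - phi (a (- J%:Z))).
  elim: J => [|J IH]; first by rewrite big_ord0 oppr0 subrr mulr0.
  rewrite doubleS !big_ord_recr /=.
  have -> : dyadic J.*2 = 2 `^ (Posz J)%:~R by rewrite /dyadic /zenum odd_double doubleK.
  have -> : dyadic J.*2.+1 = 2 `^ (Negz J)%:~R.
    by rewrite /dyadic /zenum /= odd_double /= uphalf_double.
  have := step (Posz J); have := step (Negz J).
  have -> : Negz J + 1 = - J%:Z by rewrite NegzE; lia.
  have -> : Posz J + 1 = J.+1%:Z by lia.
  have <- : Negz J = - J.+1%:Z by rewrite NegzE.
  by rewrite -!/(a _); lra.
move=> J; apply: (@le_trans _ _ (\sum_(j < J.*2) Num.min (m (dyadic j)) (m (dyadic j))^-1)).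
  rewrite -addnn big_split_ord /= lerDl sumr_ge0// => i _; exact: mn_ge0.
apply: le_trans (tele J) _.
have K0 : 0 < 4 * (1 + k) / k by rewrite divr_gt0 ?mulr_gt0; lra.
by have := phi01 J; have := phi01 (- J%:Z); nra.
Qed.

End dyadic_radii.

(** * Dyadic approximation of measurable sets *)

Section measurable_sets_of_Rn.
Context {R : realType} {n : nat}.
Local Notation Rn := 'rV[R]_n.
Local Notation mu := (@lebesgue_rV R n).
Implicit Types (a x y : Rn) (l r : R) (u f g : Rn -> R) (A B D : set Rn).

(** The induction principle behind [approx_measurable]. *)
Lemma rV_measurable_ind (P : set (set Rn)) : sigma_algebra setT P ->
  (forall i c, P [set x : Rn | x ord0 i < c]) -> measurable `<=` P.
Proof.
move=> sP Pray; apply: smallest_sub => //.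
rewrite -bigcup_seq; apply: bigcup_sub => i _ _ [B mB <-].
rewrite setTI.
have [P0 PC PU] := sP.
suff : (measurable : set (set R)) `<=` [set B | P ((fun x : Rn => x ord0 i) @^-1` B)].
  by apply.
rewrite [X in X `<=` _](_ : _ = <<s @RGenInftyO.G R >>); last first.
  exact: RGenInftyO.measurableE.
apply: smallest_sub.
  split => /=; first by rewrite preimage_set0.
  - by move=> A PA; rewrite setTD preimage_setC -setTD; exact: PC.
  - by move=> F PF; rewrite preimage_bigcup; exact: PU.
move=> _ [c ->] /=; rewrite (_ : _ @^-1` _ = [set x : Rn | x ord0 i < c])//.
Qed.

Lemma wmeasure_bigcup_le f (F : (set Rn)^nat) (K : \bar R) : nnmeas f ->
  (forall i, measurable (F i)) -> nondecreasing_seq F ->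
  (forall i, (wmeasure f (F i) <= K)%E) -> (wmeasure f (\bigcup_i F i) <= K)%E.
Proof.
move=> hf mF ndF H.
have cv := ge0_nondecreasing_set_cvg_integral (f := EFin \o f) (mu := mu) ndF mF
  (fun i => nnmeas_EFin hf) (fun i x _ => hf.2 x).
rewrite /wmeasure -(cvg_lim _ cv)//; apply: lime_le; first exact: cvgP cv.
exact: nearW.
Qed.

(** A real-valued set function localized to one cube, which keeps the additivity and
    approximation arguments below free of infinite values. *)
Definition hmass f a l A : R := mass f (A `&` hcube a l).

Lemma wmeasure_hcube_fin f a l A : strict_weight f -> measurable A ->
  wmeasure f (A `&` hcube a l) = (hmass f a l A)%:E.
Proof.
move=> hf mA; rewrite fineK// ge0_fin_numE; last exact: wmeasure_ge0 (strict_weight_nnmeas hf).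
have [_ _ fin] := hf; apply: le_lt_trans (fin a l).
apply: wmeasure_subset; first exact: strict_weight_nnmeas.
- by apply: measurableI => //; exact: measurable_hcube.
- exact: measurable_cube.
- by move=> x [_]; exact: hcube_sub.
Qed.

Lemma hmass_ge0 f a l A : strict_weight f -> 0 <= hmass f a l A.
Proof. by move=> hf; apply: mass_ge0; exact: strict_weight_nnmeas. Qed.

Lemma hmass_subset f a l A B : strict_weight f -> measurable A -> measurable B ->
  A `&` hcube a l `<=` B -> hmass f a l A <= hmass f a l B.
Proof.
move=> hf mA mB AB; rewrite -lee_fin -!wmeasure_hcube_fin//.
apply: wmeasure_subset; first exact: strict_weight_nnmeas.
- by apply: measurableI => //; exact: measurable_hcube.
- by apply: measurableI => //; exact: measurable_hcube.
- by move=> x [Ax Qx]; split => //; apply: AB.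
Qed.

Lemma hmassU f a l A B : strict_weight f -> measurable A -> measurable B ->
  hmass f a l (A `|` B) <= hmass f a l A + hmass f a l B.
Proof.
move=> hf mA mB; have nn := strict_weight_nnmeas hf.
have mh := @measurable_hcube R n a l.
have -> : hmass f a l (A `|` B) = hmass f a l A + hmass f a l (B `\` A).
  apply: EFin_inj; rewrite EFinD -!wmeasure_hcube_fin//; try exact: measurableU; try exact: measurableD.
  rewrite -ge0_integral_setU//.
  - congr (wmeasure f _); rewrite -setIUl; congr (_ `&` _).
    by rewrite setDE setUIr setUv setIT.
  - exact: measurableI.
  - by apply: measurableI => //; exact: measurableD.
  - exact: nnmeas_EFin.
  - by move=> y _; rewrite lee_fin; exact: nn.2.
  - apply/disj_set2P; rewrite -subset0 => x [[Ax _] [[_ nAx] _]]; exact: nAx.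
rewrite lerD2l; apply: hmass_subset => //; first exact: measurableD.
by move=> x [[]].
Qed.

Lemma hmassD f a l A B : strict_weight f -> measurable A -> measurable B -> A `<=` B ->
  hmass f a l B = hmass f a l A + hmass f a l (B `\` A).
Proof.
move=> hf mA mB AB; have nn := strict_weight_nnmeas hf.
have mh := @measurable_hcube R n a l.
apply: EFin_inj; rewrite EFinD -!wmeasure_hcube_fin//; try exact: measurableD.
rewrite -ge0_integral_setU//.
- by congr (wmeasure f _); rewrite -setIUl setDUK.
- exact: measurableI.
- by apply: measurableI => //; exact: measurableD.
- exact: nnmeas_EFin.
- by move=> y _; rewrite lee_fin; exact: nn.2.
- apply/disj_set2P; rewrite -subset0 => x [[Ax _] [[_ nAx] _]]; exact: nAx.
Qed.

Lemma hmass_bigcup f a l (F : (set Rn)^nat) (e : R) : strict_weight f ->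
  (forall i, measurable (F i)) -> nondecreasing_seq F -> 0 < e ->
  exists i, hmass f a l ((\bigcup_i F i) `\` F i) <= e.
Proof.
move=> hf mF ndF e0; set B := \bigcup_i F i.
have mB : measurable B by exact: bigcup_measurable.
apply: contrapT => /forallNP H.
have : (wmeasure f (\bigcup_i (F i `&` hcube a l)) <= (hmass f a l B - e)%:E)%E.
  apply: wmeasure_bigcup_le; first exact: strict_weight_nnmeas.
  - by move=> i; apply: measurableI => //; exact: measurable_hcube.
  - by move=> i j ij; apply/subsetPset; apply: setSI; apply/subsetPset; exact: ndF.
  - move=> i; rewrite wmeasure_hcube_fin// lee_fin.
    rewrite (hmassD a l hf (mF i) mB); last exact: bigcup_sup.
    by have /negP := H i; rewrite -ltNge; lra.
rewrite -setI_bigcupl wmeasure_hcube_fin// lee_fin; lra.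
Qed.

End measurable_sets_of_Rn.

Section dyadic_subcubes.
Context {R : realType} {n : nat}.
Local Notation Rn := 'rV[R]_n.
Local Notation mu := (@lebesgue_rV R n).
Implicit Types (a x y : Rn) (l r c : R) (u f g : Rn -> R) (A B D : set Rn).
Implicit Types s : {ffun 'I_n -> bool}.

Definition subcube_corner a l s : Rn := \row_i (a ord0 i + (s i)%:R * (l / 2)).

Lemma subcube_cornerE a l s i : subcube_corner a l s ord0 i = a ord0 i + (s i)%:R * (l / 2).
Proof. by rewrite mxE. Qed.

Definition quadrant a l x : {ffun 'I_n -> bool} :=
  [ffun i => a ord0 i + l / 2 <= x ord0 i].

Lemma hcube_subcubeP a l s x : 0 < l ->
  hcube (subcube_corner a l s) (l / 2) x <-> hcube a l x /\ s = quadrant a l x.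
Proof.
move=> l0; split.
  move=> H; split => [i|].
    by have := H i; rewrite subcube_cornerE; case: (s i); rewrite /= ?mulr1n ?mulr0n; lra.
  apply/ffunP => i; rewrite ffunE; have := H i; rewrite subcube_cornerE.
  case: (s i); rewrite /= ?mulr1n ?mulr0n ?mul1r ?mul0r ?addr0; first by move/andP => [-> _].
  by move=> /andP[_]; rewrite ltNge => /negbTE ->.
move=> [H ->] i; rewrite subcube_cornerE ffunE.
by have := H i; case: (lerP (a ord0 i + l / 2)) => /=; lra.
Qed.

Lemma hcube_subcube_sub a l s : 0 < l -> hcube (subcube_corner a l s) (l / 2) `<=` hcube a l.
Proof. by move=> l0 x /(hcube_subcubeP a s x l0)[]. Qed.

Lemma hmass_children f a l D : strict_weight f -> 0 < l -> measurable D ->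
  hmass f a l D = \sum_s hmass f (subcube_corner a l s) (l / 2) D.
Proof.
move=> hf l0 mD; have nn := strict_weight_nnmeas hf.
apply: EFin_inj; rewrite -wmeasure_hcube_fin// -sumEFin.
under eq_bigr do rewrite -wmeasure_hcube_fin//.
have -> : D `&` hcube a l = \big[setU/set0]_s (D `&` hcube (subcube_corner a l s) (l / 2)).
  rewrite -bigcup_seq; apply/seteqP; split => x.
    move=> [Dx Qx]; exists (quadrant a l x); first by rewrite /= mem_index_enum.
    by split => //; apply/hcube_subcubeP.
  by move=> [s _ [Dx /(hcube_subcube_sub l0) Qx]].
rewrite /wmeasure ge0_integral_bigsetU//=.
- by move=> s; apply: measurableI => //; exact: measurable_hcube.
- exact: index_enum_uniq.
- move=> s t _ _ [x [[_ /(hcube_subcubeP _ _ _ l0)[_ ->]] [_ /(hcube_subcubeP _ _ _ l0)[_ ->]]]].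
  by [].
- exact: nnmeas_EFin.
- by move=> x _; rewrite lee_fin; exact: nn.2.
Qed.

(** Only the trace of [D] on the cube matters. A union of subcubes of one generation is
    also a union of subcubes of any later one, so that two sets can be brought to a common
    generation. *)
Fixpoint dyadic_union (M : nat) a l D : Prop :=
  if M is M'.+1 then forall s, dyadic_union M' (subcube_corner a l s) (l / 2) D
  else hcube a l `<=` D \/ hcube a l `<=` ~` D.

Lemma dyadic_unionS M a l D : 0 < l -> dyadic_union M a l D -> dyadic_union M.+1 a l D.
Proof.
elim: M a l => [|M IH] a l l0 H s; last by apply: IH; [lra|exact: H].
have sub := @hcube_subcube_sub a l s l0.
by case: H => H; [left|right]; exact: subset_trans sub H.
Qed.

Lemma dyadic_union_le M N a l D : 0 < l -> (M <= N)%N -> dyadic_union M a l D -> dyadic_union N a l D.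
Proof.
move=> l0 /subnK <-; elim: (N - M)%N => [//|k IH] H.
by rewrite addSn; apply: dyadic_unionS => //; exact: IH.
Qed.

Lemma dyadic_unionC M a l D : dyadic_union M a l D -> dyadic_union M a l (~` D).
Proof.
elim: M a l => [|M IH] a l H; last by move=> s; apply: IH; exact: H.
by case: H => H; [right; rewrite setCK|left].
Qed.

Lemma dyadic_unionU M a l D E : dyadic_union M a l D -> dyadic_union M a l E -> dyadic_union M a l (D `|` E).
Proof.
elim: M a l => [|M IH] a l; last by move=> H K s; apply: IH; [exact: H|exact: K].
move=> [H _|H [K|K]].
- by left => x /H; left.
- by left => x /K; right.
- by right => x Qx [/(H x Qx)|/(K x Qx)].
Qed.

Lemma dyadic_union_ray M a l i (j : int) : 0 < l ->
  dyadic_union M a l [set x : Rn | x ord0 i < a ord0 i + j%:~R * (l / 2 ^+ M)].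
Proof.
elim: M a l j => [|M IH] a l j l0 /=.
  rewrite expr0 divr1; have [j0|j0] := lerP j 0.
    right => x /(_ i) /andP[xi _] /=; apply/negP; rewrite -leNgt.
    by apply: le_trans xi; rewrite gerDl mulr_le0_ge0 ?lerz0 ?(ltW l0).
  left => x /(_ i) /andP[_ xi] /=; apply: lt_le_trans xi _.
  by rewrite lerD2l ler_peMl ?(ltW l0)// ler1z.
move=> s; have l20 : 0 < l / 2 by lra.
have := IH (subcube_corner a l s) (l / 2) (j - (s i)%:R * 2 ^+ M) l20.
rewrite subcube_cornerE rmorphB rmorphM rmorphXn /= natz.
rewrite (_ : _ + _ * _ + _ = a ord0 i + j%:~R * (l / 2 ^+ M.+1))//.
by rewrite exprS; case: (s i) => /=; field; rewrite expf_neq0.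
Qed.

(** The error is measured by an arbitrary weight [g], so that a single approximating set
    can serve every weight dominated by [g]. *)
Definition approx g a l A := measurable A /\ forall e, 0 < e ->
  exists M D, [/\ measurable D, dyadic_union M a l D,
    hmass g a l (A `\` D) <= e & hmass g a l (D `\` A) <= e].

Lemma approxC g a l A : approx g a l A -> approx g a l (~` A).
Proof.
move=> [mA HA]; split; first exact: measurableC.
move=> e e0; have [M [D [mD gD h1 h2]]] := HA e e0.
exists M, (~` D); split; [exact: measurableC|exact: dyadic_unionC| |].
- by rewrite setDE setCK setIC -setDE.
- by rewrite setDE setCK setIC -setDE.
Qed.

Lemma approxU g a l A B : strict_weight g -> 0 < l ->
  approx g a l A -> approx g a l B -> approx g a l (A `|` B).
Proof.
move=> hg l0 [mA HA] [mB HB]; split; first exact: measurableU.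
move=> e e0; have e20 : 0 < e / 2 by lra.
have [M [D [mD gD h1 h2]]] := HA _ e20.
have [N [E [mE gE k1 k2]]] := HB _ e20.
exists (maxn M N), (D `|` E); split; first exact: measurableU.
- by apply: dyadic_unionU; [apply: dyadic_union_le gD|apply: dyadic_union_le gE];
    rewrite ?leq_maxl ?leq_maxr.
- apply: (@le_trans _ _ (hmass g a l ((A `\` D) `|` (B `\` E)))).
    apply: hmass_subset => //; do ? [apply: measurableU|apply: measurableD] => //.
    move=> x [[[Ax|Bx] /not_orP[nD nE]] _]; by [left|right].
  by apply: le_trans (hmassU a l hg (measurableD mA mD) (measurableD mB mE)) _; lra.
- apply: (@le_trans _ _ (hmass g a l ((D `\` A) `|` (E `\` B)))).
    apply: hmass_subset => //; do ? [apply: measurableU|apply: measurableD] => //.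
    move=> x [[[Ax|Bx] /not_orP[nD nE]] _]; by [left|right].
  by apply: le_trans (hmassU a l hg (measurableD mD mA) (measurableD mE mB)) _; lra.
Qed.

(** The approximating sets may overshoot the individual [F i] as long as they stay close to
    the union: this covers both the countable unions of approximable sets and the
    half-spaces, which are approximated by larger ones. *)
Lemma approx_limit g a l (F : (set Rn)^nat) : strict_weight g -> 0 < l ->
  nondecreasing_seq F -> (forall i, measurable (F i)) ->
  (forall i e, 0 < e -> exists M D, [/\ measurable D, dyadic_union M a l D,
    hmass g a l (F i `\` D) <= e & hmass g a l (D `\` \bigcup_i F i) <= e]) ->
  approx g a l (\bigcup_i F i).
Proof.
move=> hg l0 ndF mF H.
have mB : measurable (\bigcup_i F i) by exact: bigcup_measurable.
split => // e e0; have e20 : 0 < e / 2 by lra.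
have [i Fi] := hmass_bigcup a l hg mF ndF e20.
have [M [D [mD gD h1 h2]]] := H i _ e20.
exists M, D; split => //; last lra.
have mFi := mF i.
apply: (@le_trans _ _ (hmass g a l (((\bigcup_i F i) `\` F i) `|` (F i `\` D)))).
  apply: hmass_subset => //; do ? [apply: measurableU|apply: measurableD] => //.
  by move=> x [[Bx nD] _]; have [Fx|nFx] := pselect (F i x); [right|left].
apply: le_trans (hmassU a l hg (measurableD mB mFi) (measurableD mFi mD)) _.
lra.
Qed.

(** Approximable sets form a sigma-algebra; they contain the half-spaces delimited by a
    coordinate because these are increasing unions of half-spaces with room for a dyadic
    hyperplane in between. *)
Lemma approx_measurable g a l A : strict_weight g -> 0 < l -> measurable A -> approx g a l A.
Proof.
move=> hg l0; have h0 : hmass g a l set0 = 0.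
  by rewrite /hmass set0I /mass /wmeasure integral_set0.
apply: (rV_measurable_ind (P := approx g a l)).
  have a0 : approx g a l set0.
    split => // e e0; exists 0%N, set0; split => //=; rewrite ?setDv ?h0 ?(ltW e0)//.
    by right; rewrite setC0.
  split => // [B /approxC|F HF]; first by rewrite setTD.
  have aU N : approx g a l (\big[setU/set0]_(i < N) F i).
    by elim/big_ind : _ => // B B' hB hB'; exact: approxU hg l0 hB hB'.
  rewrite -bigcup_bigsetU_bigcup; apply: approx_limit => //.
  - by move=> i j ij; apply/subsetPset/subset_bigsetU.
  - by move=> i; have [] := aU i.+1.
  - move=> i e e0; have [_ /(_ e e0)[M [D [mD gD h1 h2]]]] := aU i.+1.
    exists M, D; split => //; apply: le_trans h2; apply: hmass_subset => //.
    + apply: measurableD => //; apply: bigcup_measurable => k _.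
      by have [] := aU k.+1.
    + by apply: measurableD => //; have [] := aU i.+1.
    + by move=> x [[Dx nB] _]; split => // Bx; apply: nB; exists i.
move=> i c; pose F (M : nat) := [set x : Rn | x ord0 i < c - l / 2 ^+ M].
have mray d : measurable [set x : Rn | x ord0 i < d].
  rewrite (_ : [set _ | _] = (fun x : Rn => x ord0 i) @^-1` `]-oo, d[%classic).
    by rewrite -[X in measurable X]setTI; exact: measurable_coor.
  by apply/seteqP; split => x /=; rewrite in_itv.
have p0 M : 0 < l / 2 ^+ M by rewrite divr_gt0// exprn_gt0.
have FE : [set x : Rn | x ord0 i < c] = \bigcup_M F M.
  apply/seteqP; split => x /=; last by move=> [M _]; rewrite /F /=; have := p0 M; lra.
  move=> xc; have [M HM] : exists M, l / (c - x ord0 i) < 2 ^+ M.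
    exists (Num.bound (l / (c - x ord0 i))).
    apply: lt_le_trans (archi_boundP _) _; first by rewrite divr_ge0 ?subr_ge0// ltW.
    by rewrite -natrX ler_nat ltnW// ltn_expl.
  exists M => //; rewrite /F /=.
  move: HM; rewrite ltr_pdivrMr ?subr_gt0// -ltr_pdivrMl ?exprn_gt0// [_ * l]mulrC.
  lra.
rewrite FE; apply: approx_limit => //.
- apply/nondecreasing_seqP => M; apply/subsetPset => x /=; rewrite /F /=.
  have := p0 M.+1; rewrite exprS invfM mulrCA; lra.
- by move=> M; exact: mray.
- move=> M e e0; pose j := Num.floor ((c - a ord0 i) / (l / 2 ^+ M)).
  exists M, [set x : Rn | x ord0 i < a ord0 i + j%:~R * (l / 2 ^+ M)].
  have := floor_itv ((c - a ord0 i) / (l / 2 ^+ M)); rewrite -/j intrD.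
  rewrite ler_pdivlMr// ltr_pdivrMr// mulrDl mul1r => /andP[j1 j2].
  split; [exact: mray|exact: dyadic_union_ray| |].
  + rewrite (_ : _ `\` _ = set0) ?h0 ?ltW// -subset0 => x [/= ].
    by rewrite /F /=; move=> xi; apply; lra.
  + rewrite (_ : _ `\` _ = set0) ?h0 ?ltW// -subset0 => x [/= xi].
    by rewrite -FE; apply => /=; lra.
Qed.

End dyadic_subcubes.

(** * Power-type absolute continuity of A1 weights *)

Section self_improvement.
Context {R : realType} {n : nat}.
Local Notation Rn := 'rV[R]_n.
Local Notation mu := (@lebesgue_rV R n).
Implicit Types (a x y : Rn) (l r c t e : R) (u V f g : Rn -> R) (A B D : set Rn).

Definition unit_weight : Rn -> R := fun=> 1.

Lemma strict_weight_one : strict_weight unit_weight.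
Proof.
split; [exact: measurable_cst|by []|move=> a l].
rewrite wmeasure_cst; last exact: measurable_cube.
rewrite mul1e; apply: le_lt_trans (ltry ((Num.max l 0) ^+ n)).
rewrite -(@mu_cube R n a); last by rewrite le_max lexx orbT.
apply: le_measure; rewrite ?inE; try exact: measurable_cube.
move=> x /cubeP H; apply/cubeP => i; have /andP[-> /le_trans] := H i; apply.
by rewrite lerD2l le_max lexx.
Qed.

Lemma strict_weightD u V : strict_weight u -> strict_weight V -> strict_weight (fun x => u x + V x).
Proof.
move=> hu hV; have nu := strict_weight_nnmeas hu; have nV := strict_weight_nnmeas hV.
case: hu hV => mu_ u0 fu [mV V0 fV]; split.
- exact: measurable_funD.
- by move=> x; rewrite addr_gt0.
- move=> a l; rewrite wmeasureD//; last exact: measurable_cube.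
  by rewrite lte_add_pinfty.
Qed.

Lemma hmass_cube f a l A : strict_weight f -> 0 < l -> measurable A -> A `<=` cube a l ->
  mass f A = hmass f a l A.
Proof.
move=> hf l0 mA sub; have nn := strict_weight_nnmeas hf.
have mQ := @measurable_hcube R n a l.
have mAQ : measurable (A `&` hcube a l) by exact: measurableI.
have mAD : measurable (A `\` hcube a l) by exact: measurableD.
congr fine; rewrite -[in LHS](setUIDK A (hcube a l)) /wmeasure ge0_integral_setU//.
- rewrite [X in (_ + X)%E](_ : _ = 0%E) ?adde0//.
  apply: wmeasure_null => //.
  apply: (subset_measure0 (B := cube a l `\` hcube a l)) => //.
  + by apply: measurableD => //; exact: measurable_cube.
  + by apply: setSD.
  + by apply: mu_cubeD; exact: ltW.
- exact: nnmeas_EFin.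
- by move=> x _; rewrite lee_fin; exact: nn.2.
- by apply/disj_set2P; rewrite -subset0 => x [[_ Qx] [_ nQ]].
Qed.

Lemma hmassT_cube f a l : strict_weight f -> 0 < l -> hmass f a l setT = mass f (cube a l).
Proof.
move=> hf l0; rewrite (@hmass_cube f a l _ hf l0 (measurable_cube a l) (fun _ h => h)).
rewrite /hmass setTI; congr (mass f _); rewrite setIC; apply/esym/setIidl.
exact: hcube_sub.
Qed.

Lemma hmass_unit a l : 0 < l -> hmass unit_weight a l setT = l ^+ n.
Proof.
move=> l0; rewrite hmassT_cube//; last exact: strict_weight_one.
rewrite /mass wmeasure_cst; last exact: measurable_cube.
by rewrite mul1e mu_cube// ltW.
Qed.

Lemma bellman_exponent_gt0 (C : R) : 1 <= C -> 0 < (2 * C * (2 ^+ n) ^+ 2)^-1.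
Proof.
move=> C1; rewrite invr_gt0 !mulr_gt0 ?exprn_gt0//; exact: lt_le_trans ltr01 C1.
Qed.

Lemma bellman_exponent_le1 (C : R) : 1 <= C -> (2 * C * (2 ^+ n) ^+ 2)^-1 <= 1.
Proof.
move=> C1; rewrite -[leRHS]invr1 lef_pV2 ?posrE//; last first.
  by rewrite -invr_gt0; exact: bellman_exponent_gt0.
have XX : 1 <= (2 ^+ n) ^+ 2 :> R by rewrite !exprn_ege1// ler1n.
by have := mulr_ege1 C1 XX; lra.
Qed.

Section bellman.
Variables (u : Rn -> R) (C : R).
Hypotheses (hu : strict_weight u) (hC : A1_const C u) (C1 : 1 <= C).

Let X : R := 2 ^+ n.
Let eta : R := (2 * C * X ^+ 2)^-1.

Let X1 : 1 <= X. Proof. by rewrite exprn_ege1// ler1n. Qed.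

Let eta_gt0 : 0 < eta. Proof. exact: bellman_exponent_gt0. Qed.

Let eta_le1 : eta <= 1. Proof. exact: bellman_exponent_le1. Qed.

(** The Bellman function [2 C A f^eta - C f^(1+eta)] of the average [A] of the weight
    over a cube and of a lower bound [f] for the weight on it decreases in the mean when the
    cube is bisected, provided that the lower bound on each child is raised to what the A1
    condition gives there. On a cube contained in [D], either the average of the weight is at
    most [t] and the first term on the right suffices, or the lower bound is at least a
    multiple of [t] and the second one does. *)
Lemma bellman (M : nat) a l (f : R) D t : 0 < l -> 0 < f -> 0 < t ->
  {ae mu, forall x, hcube a l x -> f <= u x} ->
  hmass u a l setT <= C * f * l ^+ n ->
  measurable D -> dyadic_union M a l D ->
  hmass u a l D <= t * hmass unit_weight a l D + t `^ (- eta) *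
    (2 * C * hmass u a l setT * f `^ eta - C * f `^ (1 + eta) * l ^+ n).
Proof.
have C0 : 0 < C := lt_le_trans ltr01 C1.
move=> + + t0; elim: M a l f => [|M IH] a l f l0 f0 fu uQ mD gD.
  have P0 : 0 < l ^+ n by rewrite exprn_gt0.
  have fQ : f * l ^+ n <= hmass u a l setT.
    rewrite -lee_fin -wmeasure_hcube_fin// setTI EFinM -(mu_hcube a (ltW l0)).
    rewrite -wmeasure_cst; last exact: measurable_hcube.
    apply: le_wmeasure_ae => //; first by apply: nnmeas_cst; exact: ltW.
      exact: strict_weight_nnmeas.
    exact: measurable_hcube.
  have f1e : f `^ (1 + eta) = f * f `^ eta by rewrite powR_add// powRr1// ltW.
  have fe0 := powR_gt0 eta f0; have te0 := powR_gt0 (- eta) t0.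
  have br : C * hmass u a l setT * f `^ eta <=
      2 * C * hmass u a l setT * f `^ eta - C * f `^ (1 + eta) * l ^+ n.
    rewrite f1e lerBrDr -[X in X + _]mulrA -[X in _ + X]mulrA -mulrDr.
    rewrite [leRHS](_ : _ = C * (2 * hmass u a l setT * f `^ eta)); last by ring.
    rewrite ler_pM2l ?(lt_le_trans ltr01)//.
    by have := ler_wpM2r (ltW fe0) fQ; lra.
  have H0 := hmass_ge0 a l setT hu.
  case: gD => gD; last first.
    have -> : hmass u a l D = 0.
      rewrite /hmass (_ : _ `&` _ = set0) ?/mass ?/wmeasure ?integral_set0//.
      by rewrite -subset0 => x [Dx /gD].
    rewrite addr_ge0// ?mulr_ge0 ?(ltW t0)//; first exact: hmass_ge0 strict_weight_one.
      exact: ltW.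
    by apply: le_trans br; rewrite !mulr_ge0 ?(ltW fe0) ?(ltW C0).
  have DE g : hmass g a l D = hmass g a l setT.
    by rewrite /hmass setTI (setIidr gD).
  rewrite !DE hmass_unit//; set U := hmass u a l setT in br uQ fQ H0 *.
  apply: (@le_trans _ _ (t * l ^+ n + t `^ (- eta) * (C * U * f `^ eta))); last first.
    by rewrite lerD2l ler_pM2l.
  (* the cube lies in [D]: compare the average of [u] over it with [t] *)
  have [Ut|tU] := lerP U (t * l ^+ n).
    by apply: (le_trans Ut); rewrite lerDl !mulr_ge0 ?(ltW te0) ?(ltW fe0) ?(ltW C0).
  have tCf : t <= C * f.
    by rewrite -(ler_pM2r P0); apply: le_trans uQ; exact: ltW.
  have : 1 <= t `^ (- eta) * (C * f `^ eta).
    rewrite -(powR_mul_inv eta t0) mulrC ler_pM2l//.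
    apply: (@le_trans _ _ ((C * f) `^ eta)).
      by apply: ge0_ler_powR; rewrite ?nnegrE ?(ltW eta_gt0)//; lra.
    rewrite powRM ?(ltW f0) ?(le_trans ler01)// ler_pM2r//.
    rewrite -[leRHS]powRr1 ?(le_trans ler01)//; exact: ler_powR.
  move/(ler_wpM2l H0); rewrite mulr1 => H; apply: le_trans H _.
  rewrite [leLHS](_ : _ = t `^ (- eta) * (C * U * f `^ eta)); last by ring.
  by rewrite lerDr mulr_ge0 ?ltW.
have l20 : 0 < l / 2 by lra.
have P0 : 0 < (l / 2) ^+ n by rewrite exprn_gt0.
pose Us s := hmass u (subcube_corner a l s) (l / 2) setT.
(* the lower bound for [u] on a child: inherited from the parent, or given by A1 *)
pose fs s := Num.max f (Us s / (C * (l / 2) ^+ n)).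
have step s : hmass u (subcube_corner a l s) (l / 2) D <=
    t * hmass unit_weight (subcube_corner a l s) (l / 2) D + t `^ (- eta) *
    (2 * C * Us s * fs s `^ eta - C * fs s `^ (1 + eta) * (l / 2) ^+ n).
  apply: IH => //.
  - by rewrite lt_max f0.
  - apply: filterS2 fu hC => x Hx Hy Qx; rewrite ge_max Hx/=; last first.
      exact: hcube_subcube_sub Qx.
    have := Hy _ _ l20 (hcube_sub Qx).
    rewrite massE// lee_fin -hmassT_cube// => H.
    by rewrite ler_pdivrMr ?mulr_gt0// [leRHS]mulrC.
  - rewrite -/(Us s) -ler_pdivrMr// mulrC -ler_pdivrMl// mulrA.
    by rewrite -invfM mulrC /fs le_max lexx orbT.
have UE := hmass_children a hu l0 measurableT.
have oneE := hmass_children a strict_weight_one l0 measurableT.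
rewrite (hmass_children a hu l0 mD) (hmass_children a strict_weight_one l0 mD).
apply: (le_trans (ler_sum _ (fun s _ => step s))).
rewrite big_split /= -!mulr_sumr lerD2l ler_pM2l ?powR_gt0//.
rewrite UE -(hmass_unit a l0) oneE.
under [X in _ - _ * X]eq_bigr do rewrite hmass_unit//.
rewrite -!mulrA !mulr_sumr mulr_suml !mulr_sumr -sumrB; apply: ler_sum => s _.
have UsC : Us s <= C * fs s * (l / 2) ^+ n.
  rewrite -ler_pdivrMr// mulrC -ler_pdivrMl// mulrA.
  by rewrite -invfM mulrC /fs le_max lexx orbT.
have ffs : f <= fs s by rewrite le_max lexx.
have fsX : fs s <= X * f.
  rewrite ge_max ler_peMl ?(ltW f0)//= ler_pdivrMr ?mulr_gt0//.
  apply: (@le_trans _ _ (hmass u a l setT)).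
    rewrite UE (bigD1 s)//= lerDl sumr_ge0// => s' _; exact: hmass_ge0.
  apply: (le_trans uQ); rewrite /X exprMn exprVn.
  rewrite (_ : 2 ^+ n * _ * _ = C * f * l ^+ n)//; field.
  by rewrite expf_neq0.
have := bellman_scalar f0 ffs fsX X1 eta_gt0 eta_le1.
have -> : X ^+ 2 * eta = (2 * C)^-1.
  by rewrite /eta; field; rewrite gt_eqF//= expf_neq0.
rewrite ler_pdivlMl ?mulr_gt0// => B.
have Us0 : 0 <= Us s by exact: hmass_ge0.
have mono : 0 <= fs s `^ eta - f `^ eta.
  by rewrite subr_ge0 ge0_ler_powR ?nnegrE ?(ltW eta_gt0) ?(ltW f0) ?(le_trans (ltW f0)).
rewrite -/(Us s).
have h1 : 2 * C * Us s * (fs s `^ eta - f `^ eta) <=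
    2 * C * (C * fs s * (l / 2) ^+ n) * (fs s `^ eta - f `^ eta).
  by apply: ler_wpM2r => //; rewrite ler_pM2l ?mulr_gt0.
have h2 := ler_wpM2l (ltW (mulr_gt0 C0 P0)) B.
lra.
Qed.

End bellman.

(** The induction starts from the lower bound [avg u / C], and general sets are reached by
    dyadic approximation. The statement keeps the threshold [t] free: taking for [t] a
    negative power of the relative measure of [A] turns the last factor into a positive power
    of that measure. *)
Lemma A1_abs_cont u C : strict_weight u -> A1_const C u -> 1 <= C ->
  exists e, [/\ 0 < e, e <= 1 & forall a l A t, 0 < l -> 0 < t ->
    measurable A -> A `<=` cube a l ->
    mass u A <= mass u (cube a l) * (t * (mass unit_weight A / l ^+ n) + 2 * C * t `^ (- e))].
Proof.
move=> hu hC C1; exists (2 * C * (2 ^+ n) ^+ 2)^-1; split.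
- exact: bellman_exponent_gt0.
- exact: bellman_exponent_le1.
set e := (_ * _)^-1 => a l A t l0 t0 mA sub.
have e0 : 0 < e by exact: bellman_exponent_gt0.
have C0 : 0 < C := lt_le_trans ltr01 C1.
have P0 : 0 < l ^+ n by rewrite exprn_gt0.
rewrite (hmass_cube hu l0 mA sub) (hmass_cube strict_weight_one l0 mA sub).
have U0 : 0 < mass u (cube a l) by exact: mass_gt0.
rewrite -hmassT_cube// in U0 *; set U := hmass u a l setT in U0 *.
set av := U / l ^+ n; have av0 : 0 < av by rewrite divr_gt0.
have f0 : 0 < U / (C * l ^+ n) by rewrite divr_gt0 ?mulr_gt0.
have fU : U <= C * (U / (C * l ^+ n)) * l ^+ n.
  by rewrite le_eqVlt (_ : _ * _ = U) ?eqxx//; field; rewrite !gt_eqF.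
have favg : U / (C * l ^+ n) <= av.
  by rewrite /av ler_pM2l// lef_pV2 ?posrE ?mulr_gt0// ler_peMl ?(ltW P0).
have t'0 : 0 < t * av by rewrite mulr_gt0.
have fu : {ae mu, forall x, hcube a l x -> U / (C * l ^+ n) <= u x}.
  apply: filterS hC => y Hy Qy; have := Hy _ _ l0 (hcube_sub Qy).
  rewrite massE// lee_fin -hmassT_cube// -/U => H.
  by rewrite ler_pdivrMr ?mulr_gt0// [leRHS]mulrC.
(* approximation in the mass of [1 + u] is simultaneous for Lebesgue measure and for [u] *)
pose g x := unit_weight x + u x.
have hg : strict_weight g by apply: strict_weightD => //; exact: strict_weight_one.
have mono w B : strict_weight w -> (forall x, w x <= g x) -> measurable B ->
    hmass w a l B <= hmass g a l B.
  move=> hw wg mB; rewrite -lee_fin -!wmeasure_hcube_fin//.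
  apply: le_wmeasure => //; try exact: strict_weight_nnmeas.
  by apply: measurableI => //; exact: measurable_hcube.
have ug x : u x <= g x by rewrite /g /unit_weight lerDr.
have og x : unit_weight x <= g x by rewrite /g lerDl; have [_ /(_ x)/ltW] := hu.
suff : hmass u a l A <= t * av * hmass unit_weight a l A + (t * av) `^ (- e) *
    (2 * C * U * av `^ e).
  move/le_trans; apply; rewrite powRM ?(ltW t0) ?(ltW av0)//.
  rewrite [X in _ + X](_ : _ = 2 * C * U * t `^ (- e) * (av `^ e * av `^ (- e))); last by ring.
  rewrite powR_mul_inv// mulr1 /av le_eqVlt; apply/orP; left; apply/eqP.
  by field; rewrite gt_eqF.
apply/ler_addgt0Pr => d d0.
have [mA' /(_ (d / (t * av + 1)) _)[|M [D [mD gD h1 h2]]]] :=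
  approx_measurable a hg l0 mA; first by rewrite divr_gt0// ltr_wpDr// ltW.
set d' := d / _ in h1 h2.
have d'E : (t * av + 1) * d' = d.
  by rewrite /d' mulrC divfK// gt_eqF// ltr_wpDr// ltW.
have mAD := measurableD mA mD; have mDA := measurableD mD mA.
have k1 : hmass u a l A <= hmass u a l D + d'.
  apply: (@le_trans _ _ (hmass u a l (D `|` (A `\` D)))).
    apply: hmass_subset => //; first exact: measurableU.
    by move=> x [Ax _]; have [Dx|nD] := pselect (D x); [left|right].
  apply: (le_trans (hmassU a l hu mD mAD)); rewrite lerD2l.
  exact: le_trans (mono _ _ hu ug mAD) h1.
have k2 : hmass unit_weight a l D <= hmass unit_weight a l A + d'.
  apply: (@le_trans _ _ (hmass unit_weight a l (A `|` (D `\` A)))).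
    apply: hmass_subset; [exact: strict_weight_one|by []|exact: measurableU|].
    by move=> x [Ax _]; have [Dx|nD] := pselect (A x); [left|right].
  apply: (le_trans (hmassU a l strict_weight_one mA mDA)); rewrite lerD2l.
  exact: le_trans (mono _ _ strict_weight_one og mDA) h2.
have k3 := bellman hu hC C1 l0 f0 t'0 fu fU mD gD.
rewrite -/e -/U in k3.
have k4 : (t * av) `^ (- e) * (2 * C * U * (U / (C * l ^+ n)) `^ e -
    C * (U / (C * l ^+ n)) `^ (1 + e) * l ^+ n) <=
    (t * av) `^ (- e) * (2 * C * U * av `^ e).
  rewrite ler_pM2l ?powR_gt0//; apply: (@le_trans _ _ (2 * C * U * (U / (C * l ^+ n)) `^ e)).
    by rewrite gerBl !mulr_ge0 ?powR_ge0 ?(ltW C0) ?(ltW P0).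
  rewrite ler_pM2l ?mulr_gt0//; apply: ge0_ler_powR => //; rewrite ?nnegrE ?(ltW e0) ?(ltW f0) ?(ltW av0)//.
have k5 := ler_wpM2l (ltW t'0) k2.
lra.
Qed.

Lemma wmeasure_setD f A B : nnmeas f -> measurable A -> measurable B -> A `<=` B ->
  wmeasure f B = (wmeasure f A + wmeasure f (B `\` A))%E.
Proof.
move=> hf mA mB AB; rewrite -{1}(setDUK AB) /wmeasure ge0_integral_setU//.
- exact: measurableD.
- exact: nnmeas_EFin.
- by move=> x _; rewrite lee_fin; exact: hf.2.
- by apply/disj_set2P; rewrite setDIK.
Qed.

Lemma measurable_sublevel f c : measurable_fun setT f ->
  measurable [set x | f x <= c].
Proof.
move=> mf; rewrite (_ : [set _ | _] = f @^-1` `]-oo, c]%classic).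
  by rewrite -[X in measurable X]setTI; exact: mf.
by apply/seteqP; split => x /=; rewrite in_itv.
Qed.

Lemma measurable_superlevel f c : measurable_fun setT f ->
  measurable [set x | c < f x].
Proof.
move=> mf; rewrite (_ : [set _ | _] = f @^-1` `]c, +oo[%classic).
  by rewrite -[X in measurable X]setTI; exact: mf.
by apply/seteqP; split => x /=; rewrite in_itv/= andbT.
Qed.

(** Layer-cake over the level sets [V > 2 ^ j avg V]. By Chebyshev's inequality they occupy a
    proportion at most [2 ^ - j] of the cube, so that by [A1_abs_cont] their share of [u] is
    at most a multiple of a power of [2 ^ - j], which beats [2 ^ (j e)] for small [e]. *)
Lemma A1_power u V C : strict_weight u -> A1_const C u -> 1 <= C -> strict_weight V ->
  exists2 e0, 0 < e0 & forall e, 0 < e -> e <= e0 -> exists2 K, 0 < K &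
  forall a l, 0 < l -> (wmeasure (fun x => u x * V x `^ e)%R (cube a l) <=
    (K * mass u (cube a l) * (mass V (cube a l) / l ^+ n) `^ e)%:E)%E.
Proof.
move=> hu hC C1 hV; have [d [d0 d1 AC]] := A1_abs_cont hu hC C1.
have C0 : 0 < C := lt_le_trans ltr01 C1.
exists (d / 4); first by rewrite divr_gt0.
move=> e e0 ed; pose rho : R := 2 `^ (- (d / 4)).
have rho0 : 0 < rho by rewrite powR_gt0.
have rho1 : rho < 1.
  rewrite /rho /powR gt_eqF// expR_lt1 mulNr oppr_lt0 mulr_gt0 ?divr_gt0//.
  by rewrite ln_gt0// ltr1n.
exists (1 + 2 * (1 + 2 * C) / (1 - rho)).
  by rewrite addr_gt0// divr_gt0 ?subr_gt0// mulr_gt0// addr_gt0// mulr_gt0.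
move=> a l l0; set Q := cube a l; set U := mass u Q; set av := mass V Q / l ^+ n.
have P0 : 0 < l ^+ n by rewrite exprn_gt0.
have U0 : 0 < U by exact: mass_gt0.
have V0 : 0 < mass V Q by exact: mass_gt0.
have av0 : 0 < av by rewrite divr_gt0.
have nu := strict_weight_nnmeas hu; have nV := strict_weight_nnmeas hV.
have nuV : nnmeas (fun x => u x * V x `^ e).
  by apply: nnmeasM => //; exact: nnmeas_powR.
have mQ : measurable Q by exact: measurable_cube.
pose lev (j : nat) : set Rn := Q `&` [set x | V x <= 2 `^ j%:R * av].
pose D (j : nat) : set Rn := Q `&` [set x | 2 `^ j%:R * av < V x].
have [mfV Vpos _] := hV.
have mlev j : measurable (lev j).
  by apply: measurableI => //; exact: measurable_sublevel.
have mD j : measurable (D j).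
  by apply: measurableI => //; exact: measurable_superlevel.
have fin w A : strict_weight w -> measurable A -> A `<=` Q -> wmeasure w A = (mass w A)%:E.
  move=> hw mA AQ; rewrite fineK// ge0_fin_numE ?wmeasure_ge0//; try exact: strict_weight_nnmeas.
  have [_ _ /(_ a l)] := hw; apply: le_lt_trans.
  by apply: wmeasure_subset => //; exact: strict_weight_nnmeas.
have DQ j : D j `<=` Q by move=> x [].
have cheb j : mass unit_weight (D j) / l ^+ n <= 2 `^ (- j%:R).
  have : (2 `^ j%:R * av) * mass unit_weight (D j) <= mass V Q.
    rewrite -lee_fin EFinM -!fin//; try exact: strict_weight_one.
    rewrite -wmeasureZ//; last 2 first.
    - by rewrite mulr_ge0 ?powR_ge0 ?(ltW av0).
    - exact: strict_weight_nnmeas strict_weight_one.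
    apply: (@le_trans _ _ (wmeasure V (D j))); last exact: wmeasure_subset.
    apply: le_wmeasure => //.
      apply: nnmeasZ; first by rewrite mulr_ge0 ?powR_ge0 ?(ltW av0).
      exact: strict_weight_nnmeas strict_weight_one.
    by move=> x [_ /= /ltW]; rewrite /unit_weight mulr1.
  rewrite powRN ler_pdivrMr// -ler_pdivrMl ?invr_gt0 ?powR_gt0// invrK => H.
  rewrite -(ler_pM2r av0) mulrAC; apply: (le_trans H).
  by rewrite /av mulrC divfK// gt_eqF.
have uD j : mass u (D j) <= U * ((1 + 2 * C) * 2 `^ (- (j%:R * (d / 2)))).
  have t0 : 0 < 2 `^ (j%:R / 2) :> R by rewrite powR_gt0.
  apply: le_trans (AC a l (D j) _ l0 t0 (mD j) (DQ j)) _.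
  rewrite ler_pM2l// [leRHS]mulrDl mul1r; apply: lerD.
    apply: (@le_trans _ _ (2 `^ (j%:R / 2) * 2 `^ (- j%:R))).
      by rewrite ler_pM2l.
    rewrite -powR_add// ler_powR ?ler1n//.
    by have : 0 <= j%:R :> R by []; nra.
  rewrite -powRrM ler_pM2l ?mulr_gt0// ler_powR ?ler1n//; lra.
have main J : (wmeasure (fun x => u x * V x `^ e)%R (lev J) <=
   (av `^ e * (U + \sum_(j < J) 2 * (1 + 2 * C) * U * rho ^+ j))%:E)%E.
  elim: J => [|J IH].
    rewrite big_ord0 addr0 EFinM -fin// -wmeasureZ ?powR_ge0//.
    apply: (@le_trans _ _ (wmeasure (fun x => av `^ e * u x)%R (lev 0%N))).
      apply: le_wmeasure => //; first by apply: nnmeasZ => //; exact: powR_ge0.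
      move=> x [_ /=]; rewrite powRr0 mul1r => Vav.
      rewrite mulrC ler_pM2r//; last by have [_ /(_ x)] := hu.
      by apply: ge0_ler_powR; rewrite ?nnegrE ?(ltW e0) ?(ltW av0)// ltW.
    by apply: wmeasure_subset => //; [apply: nnmeasZ => //; exact: powR_ge0|move=> x []].
  have sub : lev J `<=` lev J.+1.
    move=> x [Qx /= H]; split => //=; apply: (le_trans H).
    by rewrite ler_pM2r// ler_powR ?ler1n// ler_nat.
  rewrite big_ord_recr [X in (_ <= (_ * X)%:E)%E]addrA mulrDr EFinD.
  rewrite (wmeasure_setD nuV (mlev J) (mlev J.+1) sub).
  apply: leeD => //.
  apply: (@le_trans _ _ (wmeasure (fun x => (2 `^ J.+1%:R * av) `^ e * u x)%R (D J))).
    apply: (@le_trans _ _ (wmeasure (fun x => (2 `^ J.+1%:R * av) `^ e * u x)%R (lev J.+1 `\` lev J))).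
      apply: le_wmeasure => //; first by apply: nnmeasZ => //; exact: powR_ge0.
        exact: measurableD.
      move=> x [[_ /= Vav] _]; rewrite mulrC ler_pM2r//; last by have [_ /(_ x)] := hu.
      apply: ge0_ler_powR => //; rewrite ?nnegrE; try exact: ltW.
      by rewrite mulr_ge0 ?powR_ge0 ?(ltW av0).
    apply: wmeasure_subset => //; first by apply: nnmeasZ => //; exact: powR_ge0.
      exact: measurableD.
    move=> x [[Qx /= _] nl]; split => //=; rewrite ltNge; apply/negP => H.
    by apply: nl; split.
  rewrite wmeasureZ ?powR_ge0// fin// -EFinM lee_fin.
  rewrite powRM ?powR_ge0 ?(ltW av0)//.
  rewrite [leLHS](_ : _ = av `^ e * ((2 `^ J.+1%:R) `^ e * mass u (D J))); last by ring.
  rewrite ler_pM2l ?powR_gt0//.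
  apply: (le_trans (ler_wpM2l (powR_ge0 _ _) (uD J))).
  rewrite [leLHS](_ : _ = (1 + 2 * C) * U * ((2 `^ J.+1%:R) `^ e * 2 `^ (- (J%:R * (d / 2))))); last by ring.
  rewrite [leRHS](_ : _ = (1 + 2 * C) * U * (2 * rho ^+ J)); last by ring.
  rewrite ler_pM2l ?mulr_gt0 ?addr_gt0 ?mulr_gt0//.
  rewrite -powRrM -powR_add// /rho -powR_mulrn ?powR_ge0// -powRrM.
  rewrite [leRHS](_ : _ = 2 `^ (1 + - (d / 4) * J%:R)); last first.
    by rewrite powR_add// powRr1.
  rewrite ler_powR ?ler1n//.
  have J0 : 0 <= J%:R :> R by [].
  rewrite -natr1; nra.
have QE : Q = \bigcup_j lev j.
  apply/seteqP; split => x; last by move=> [j _ []].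
  move=> Qx; exists (Num.bound (V x / av)) => //; split => //=.
  rewrite -ler_pdivrMr//; apply: ltW; apply: lt_le_trans (archi_boundP _) _.
    by rewrite divr_ge0 ?(ltW av0)// ltW.
  by rewrite powR_mulrn// -natrX ler_nat ltnW// ltn_expl.
rewrite [X in wmeasure _ X]QE; apply: wmeasure_bigcup_le => //.
  apply/nondecreasing_seqP => j; apply/subsetPset => x [Qx /= H]; split => //=.
  by apply: (le_trans H); rewrite ler_pM2r// ler_powR ?ler1n// ler_nat.
move=> J; apply: le_trans (main J) _; rewrite lee_fin [leRHS]mulrC.
rewrite ler_pM2l ?powR_gt0// -mulr_sumr.
have geo : \sum_(j < J) rho ^+ j <= (1 - rho)^-1.
  have := subrX1 rho J; set S := \sum_(j < J) _ => SE.
  have S0 : 0 <= rho ^+ J by rewrite exprn_ge0// ltW.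
  rewrite -[leRHS]mul1r ler_pdivlMr ?subr_gt0//.
  by have := SE; lra.
rewrite [leRHS](_ : _ = U + 2 * (1 + 2 * C) * U * (1 - rho)^-1); last by ring.
by rewrite lerD2l ler_wpM2l// !mulr_ge0// ?(ltW U0)// addr_ge0// mulr_ge0// ltW.
Qed.

End self_improvement.

(** * The testing condition *)

Section testing_condition.
Context {R : realType} {n : nat}.
Local Notation Rn := 'rV[R]_n.
Local Notation mu := (@lebesgue_rV R n).
Implicit Types (a x y : Rn) (l r c t e : R) (u V f g : Rn -> R) (A B D E : set Rn).

Lemma expR_lnE (x : R) : 0 < x -> exists z : R, x = expR z.
Proof. by move=> x0; exists (ln x); rewrite lnK// posrE. Qed.

Lemma expR_powR (x a : R) : expR x `^ a = expR (a * x).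
Proof. by rewrite /powR gt_eqF ?expR_gt0// expRK. Qed.

Lemma nneseries_le_bound (f : nat -> \bar R) (B : \bar R) :
  (forall j, 0 <= f j)%E -> (forall J, \sum_(j < J) f j <= B)%E ->
  (\sum_(j <oo) f j <= B)%E.
Proof.
move=> f0 H; apply: lime_le; first by apply: is_cvg_nneseries => j _ _; exact: f0.
by apply: nearW => J; rewrite big_mkord; exact: H.
Qed.

(** The position of the scale where [X] passes through 1 is irrelevant, hence the bound is
    uniform in whatever [X] is normalized by. *)
Lemma nneseries_lacunary (k e K : R) (X : R -> R) (t : nat -> \bar R) :
  0 < k -> 0 < e -> 0 <= K -> (forall r, 0 < r -> 0 < X r) ->
  (forall r, 0 < r -> (1 + k) * X r <= X (2 * r)) ->
  (forall j, 0 <= t j)%E ->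
  (forall j, t j <= (K * Num.min (X (dyadic j) `^ e) (X (dyadic j) `^ e)^-1)%:E)%E ->
  (\sum_(j <oo) t j <=
    (K * (4 * (1 + k) `^ e / ((1 + k) `^ e - 1)))%:E)%E.
Proof.
move=> k0 e0 K0 X0 Xk t0 tX; apply: nneseries_le_bound => // J.
apply: (@le_trans _ _ (\sum_(j < J)
    (K * Num.min (X (dyadic j) `^ e) (X (dyadic j) `^ e)^-1)%:E)%E).
  by apply: lee_sum => j _; exact: tX.
rewrite sumEFin lee_fin -mulr_sumr ler_wpM2l//.
have k'0 : 0 < (1 + k) `^ e - 1.
  rewrite subr_gt0 /powR gt_eqF ?ltr_wpDr ?(ltW k0)//.
  by rewrite expR_gt1 mulr_gt0// ln_gt0//; lra.
have := @sum_lacunary R (fun r => X r `^ e) ((1 + k) `^ e - 1) k'0.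
rewrite [1 + _]addrC subrK; apply.
- by move=> r r0; rewrite powR_gt0 ?X0.
- move=> r r0; rewrite -powRM ?(ltW (X0 _ _))//; last lra.
  apply: ge0_ler_powR; rewrite ?nnegrE; [exact: ltW| | |exact: Xk].
    by rewrite mulr_ge0 ?(ltW (X0 _ _))//; lra.
  by apply/ltW/X0; rewrite mulr_gt0.
Qed.

(** The left-hand side is the transpose of the kernel of [potential], applied to the density
    [u V ^ (1 - gam - kap)] on [E] and evaluated at [y]; up to doubling of [u], the transpose
    only moves the centre of the balls from one variable to the other. *)
Definition testing u V (gam kap : R) := exists2 K, 0 < K &
  forall E, measurable E -> (wmeasure (fun x => u x * V x)%R E < +oo)%E ->
  {ae mu, forall y,
    (\sum_(j <oo) (((2 * dyadic j) ^+ n) `^ (- gam) * mass u (sball y (dyadic j)) `^ (- kap))%:E *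
      wmeasure (fun x => u x * V x `^ (1 - (gam + kap)))%R (E `&` sball y (dyadic j)) <=
     (K * (u y `^ gam * mass (fun x => u x * V x) E `^ (1 - (gam + kap))))%:E)%E}.

Lemma powR_homo (x y e : R) : 0 <= e -> 0 <= x -> x <= y -> x `^ e <= y `^ e.
Proof.
by move=> e0 x0 xy; apply: ge0_ler_powR; rewrite ?nnegrE// (le_trans x0).
Qed.

(** [l] is the level of [V] at which both terms agree; optimizing it after integration gives
    Hoelder's inequality without any discussion of integrability. *)
Lemma young_split (V l s e : R) : 0 < V -> 0 < l -> 0 < s -> 0 < e -> s + e = 1 ->
  V `^ e <= l `^ (- s) * V + l `^ e.
Proof.
move=> V0 l0 s0 e0 se; have [Vl|lV] := lerP V l.
  apply: (@le_trans _ _ (l `^ e)); last by rewrite lerDr mulr_ge0 ?powR_ge0 ?ltW.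
  by apply: powR_homo => //; exact: ltW.
apply: (@le_trans _ _ (l `^ (- s) * V)); last by rewrite lerDl powR_ge0.
rewrite (_ : e = - s + 1); last by lra.
rewrite powR_add// powRr1 ?(ltW V0)// ler_pM2r// !powRN lef_pV2 ?posrE ?powR_gt0// ?(lt_trans l0)//.
by apply: powR_homo; exact: ltW.
Qed.

Lemma young_split_neg (V l s e d : R) : 0 < V -> 0 < l -> 0 < s -> 0 < e -> 0 < d ->
  s + e = 1 -> V `^ e <= l `^ (- s) * V + l `^ (e + d) * V `^ (- d).
Proof.
move=> V0 l0 s0 e0 d0 se; have [Vl|lV] := lerP V l.
  apply: (@le_trans _ _ (l `^ (e + d) * V `^ (- d))); last first.
    by rewrite lerDr mulr_ge0 ?powR_ge0 ?ltW.
  rewrite (_ : V `^ e = V `^ (e + d) * V `^ (- d)); last by rewrite -powR_add// addrK.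
  rewrite ler_pM2r ?powR_gt0//.
  by apply: powR_homo => //; [rewrite addr_ge0 ?ltW|exact: ltW].
apply: (@le_trans _ _ (l `^ (- s) * V)); last by rewrite lerDl mulr_ge0 ?powR_ge0.
rewrite (_ : e = - s + 1); last by lra.
rewrite powR_add// powRr1 ?(ltW V0)// ler_pM2r// !powRN lef_pV2 ?posrE ?powR_gt0// ?(lt_trans l0)//.
by apply: powR_homo; exact: ltW.
Qed.

(** All variables but [J] and [K] are logarithms: for a ball [B] centred at [y], [p] stands
    for [|B|], [ub] and [vb] for the masses of [u] and [V] on [B], [uy] for [u y], [m] for
    [(uV)(E)] and [c] for the A1 constant, while [J] is the integral of [u V ^ e] over the
    part of [E] in [B]. The quantity [ub - p - uy] is bounded above only; when it is not very
    negative the first bound on [J] gives the decay in [vb + uy - m], and otherwise the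
    second one does. *)
Lemma key_scalar_A1 (p ub vb uy m c gam kap J K : R) :
  0 < gam -> 0 < kap -> gam + kap < 1 -> 0 <= c -> 0 <= K ->
  ub <= c + p + uy ->
  J <= expR (c + (gam + kap) * (p - vb) + m) ->
  J <= 2 * expR ((gam + kap) * ub + (1 - (gam + kap)) * m) ->
  J <= K * expR (ub + (1 - (gam + kap)) * (vb - p)) ->
  expR (- gam * p - kap * ub) * J <= (2 + K) * expR c *
   expR (gam * uy + (1 - (gam + kap)) * m) *
   Num.min (expR ((1 - (gam + kap)) * (vb + uy - m))) (expR (- gam * (vb + uy - m))).
Proof.
move=> g0 k0 gk1 c0 K0 ubc J1 J2 J3; set e := 1 - (gam + kap).
have e0 : 0 < e by rewrite /e; lra.
set X := vb + uy - m; set T := gam * uy + e * m.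
have E0 (z : R) := expR_gt0 z; have E0' (z : R) := ltW (expR_gt0 z).
have c1 : 1 <= expR c by rewrite -expR0 ler_expR.
have le3 : expR (- gam * p - kap * ub) * J <= (2 + K) * expR c * expR T * expR (e * X).
  apply: le_trans (ler_wpM2l (E0' _) J3) _; rewrite mulrCA -expRD -!mulrA -!expRD.
  apply: ler_pM => //; first lra.
  rewrite ler_expR /T /X -/e.
  have : (1 - kap) * (ub - p - uy) <= (1 - kap) * c by apply: ler_wpM2l; lra.
  have : kap * c >= 0 by rewrite mulr_ge0// ltW.
  by rewrite /e; lra.
have le12 : expR (- gam * p - kap * ub) * J <= (2 + K) * expR c * expR T * expR (- gam * X).
  have [bX|bX] := lerP (ub - p - uy) (- X).
    apply: le_trans (ler_wpM2l (E0' _) J2) _; rewrite mulrCA -expRD -!mulrA -!expRD.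
    apply: ler_pM => //; first lra.
    rewrite ler_expR; have := ler_wpM2l (ltW g0) bX.
    by rewrite -/e /T; lra.
  apply: le_trans (ler_wpM2l (E0' _) J1) _; rewrite -expRD -!mulrA -!expRD.
  rewrite -[leLHS]mul1r; apply: ler_pM => //; first lra.
  rewrite ler_expR; have := ler_wpM2l (ltW k0) (ltW bX).
  by rewrite /T /X /e; lra.
by rewrite /Num.min; case: ifP.
Qed.

(** In the notation of [key_scalar_A1], with [x] the logarithm of the ratio of the masses of
    [u V] on [B] and on [E]. *)
Lemma key_scalar_Ainfty (p ub x uy m c gam kap d J K : R) :
  0 < gam -> 0 < kap -> gam + kap < 1 -> 0 < d -> 0 <= c -> 0 <= K ->
  ub <= c + p + uy ->
  J <= 2 * expR ((gam + kap) * ub + (1 - (gam + kap)) * (x + m)) ->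
  J <= (1 + K) * expR ((gam + kap) * ub + (1 - (gam + kap)) * m -
                       (gam + kap) * (d / (1 + d)) * x) ->
  expR (- gam * p - kap * ub) * J <= (2 + K) * expR c *
   expR (gam * uy + (1 - (gam + kap)) * m) *
   Num.min (expR ((1 - (gam + kap)) * x)) (expR (- ((gam + kap) * (d / (1 + d))) * x)).
Proof.
move: (d / (1 + d)) => th g0 k0 gk1 d0 c0 K0 ubc J1 J2.
set e := 1 - (gam + kap).
have e0 : 0 < e by rewrite /e; lra.
have E0 (z : R) := expR_gt0 z; have E0' (z : R) := ltW (expR_gt0 z).
have gub := ler_wpM2l (ltW g0) ubc.
have gc : gam * c <= c by rewrite ler_piMl//; lra.
have le1 : expR (- gam * p - kap * ub) * J <= (2 + K) * expR c *
    expR (gam * uy + e * m) * expR (e * x).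
  apply: le_trans (ler_wpM2l (E0' _) J1) _; rewrite mulrCA -expRD -!mulrA -!expRD.
  apply: ler_pM => //; first lra.
  by rewrite ler_expR -/e; lra.
have le2 : expR (- gam * p - kap * ub) * J <= (2 + K) * expR c *
    expR (gam * uy + e * m) * expR (- ((gam + kap) * th) * x).
  apply: le_trans (ler_wpM2l (E0' _) J2) _; rewrite mulrCA -expRD -!mulrA -!expRD.
  apply: ler_pM => //; [lra|lra|].
  by rewrite ler_expR -/e; lra.
by rewrite /Num.min; case: ifP.
Qed.

Lemma min_expR_le (a b x : R) : 0 < a -> 0 < b ->
  Num.min (expR (a * x)) (expR (- b * x)) <=
  Num.min (expR x `^ Num.min a b) (expR x `^ Num.min a b)^-1.
Proof.
move=> a0 b0; set e := Num.min a b; rewrite expR_powR -expRN.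
have ea : e <= a by rewrite ge_min lexx.
have eb : e <= b by rewrite ge_min lexx orbT.
have e0 : 0 < e by rewrite lt_min a0.
rewrite le_min !ge_min !ler_expR; have [x0|x0] := lerP 0 x.
  have bx : - b * x <= - (e * x) by rewrite -mulNr ler_wpM2r// lerN2.
  have ex : 0 <= e * x by rewrite mulr_ge0// ltW.
  by rewrite bx orbT andbT; apply/orP; right; lra.
have bx : a * x <= e * x by rewrite ler_wnM2r// ltW.
have ex : e * x <= 0 by rewrite mulr_ge0_le0// ltW.
by rewrite bx /=; apply/orP; left; lra.
Qed.

End testing_condition.

Section testing_condition_proofs.
Context {R : realType} {n : nat}.
Local Notation Rn := 'rV[R]_n.
Local Notation mu := (@lebesgue_rV R n).
Implicit Types (a x y : Rn) (l r c t e : R) (u V f g : Rn -> R) (A B D E : set Rn).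

Lemma nnmeas_strict_powR u V e : strict_weight u -> strict_weight V -> nnmeas (fun x => u x * V x `^ e).
Proof.
by move=> hu hV; apply: nnmeasM; [|apply: nnmeas_powR]; exact: strict_weight_nnmeas.
Qed.

Lemma nnmeas_strictM u V : strict_weight u -> strict_weight V -> nnmeas (fun x => u x * V x).
Proof. by move=> hu hV; apply: nnmeasM; exact: strict_weight_nnmeas. Qed.

Lemma wmeasure_young u V A (s e ub m : R) : strict_weight u -> strict_weight V -> measurable A ->
  0 < s -> 0 < e -> s + e = 1 ->
  (wmeasure u A <= (expR ub)%:E)%E ->
  (wmeasure (fun x => u x * V x)%R A <= (expR m)%:E)%E ->
  (wmeasure (fun x => u x * V x `^ e)%R A <= (2 * expR (s * ub + e * m))%:E)%E.
Proof.
move=> hu hV mA s0 e0 se uA uVA.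
have nu := strict_weight_nnmeas hu; have nuV := nnmeas_strictM hu hV.
set l := expR (m - ub); have l0 : 0 < l by exact: expR_gt0.
apply: (@le_trans _ _ (wmeasure (fun x =>
    l `^ (- s) * (u x * V x) + l `^ e * u x)%R A)).
  apply: le_wmeasure => //; first exact: nnmeas_strict_powR.
    by apply: nnmeasD; apply: nnmeasZ => //; exact: powR_ge0.
  move=> x _; have [_ /(_ x) ux _] := hu; have [_ /(_ x) Vx _] := hV.
  by have := ler_wpM2l (ltW ux) (young_split Vx l0 s0 e0 se); lra.
rewrite wmeasureD//; do ? [by apply: nnmeasZ => //; exact: powR_ge0].
rewrite !wmeasureZ ?powR_ge0// mulr2n mulrDl !mul1r EFinD; apply: leeD.
  apply: le_trans (lee_wpmul2l _ uVA) _; first by rewrite lee_fin powR_ge0.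
  rewrite -EFinM lee_fin expR_powR -expRD ler_expR; nra.
apply: le_trans (lee_wpmul2l _ uA) _; first by rewrite lee_fin powR_ge0.
rewrite -EFinM lee_fin expR_powR -expRD ler_expR; nra.
Qed.

Lemma wmeasure_strictM_eq0 u V A : strict_weight u -> strict_weight V -> measurable A ->
  wmeasure (fun x => u x * V x) A = 0%E -> mu A = 0%E.
Proof.
move=> hu hV mA H; apply/eqP; rewrite eq_le measure_ge0 andbT leNgt; apply/negP => A0.
have := @wmeasure_gt0 R n (fun x => u x * V x) A.
rewrite H ltxx; move=> /(_ _ _ mA A0) H'; suff : false by []; apply: H'.
  by have [] := nnmeas_strictM hu hV.
by move=> x; have [_ /(_ x) ? _] := hu; have [_ /(_ x) ? _] := hV; rewrite mulr_gt0.
Qed.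

Lemma A1_const_le (C C' : R) u : strict_weight u -> A1_const C u -> C <= C' -> A1_const C' u.
Proof.
move=> [_ u0 _] hC CC'; apply: filterS hC => y Hy a l l0 ay.
apply: le_trans (Hy a l l0 ay) _; rewrite lee_fin ler_pM2r//.
by rewrite ler_pM2r// exprn_gt0.
Qed.

(** Each term may be bounded by a multiple of the target that decays geometrically on both
    sides of the scale where [X] passes through 1, whatever the normalization of [X], which
    may depend on [E] and on [y]. *)
Lemma testing_of_terms u V (gam kap k e K : R) :
  strict_weight u -> strict_weight V -> 0 < gam -> 0 < kap -> gam + kap < 1 ->
  0 < k -> 0 < e -> 0 < K ->
  (forall E, measurable E -> (wmeasure (fun x => u x * V x)%R E < +oo)%E ->
   0 < mass (fun x => u x * V x) E ->
   {ae mu, forall y, exists X : R -> R, [/\ forall r, 0 < r -> 0 < X r,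
    forall r, 0 < r -> (1 + k) * X r <= X (2 * r) &
    forall r, 0 < r ->
    ((((2 * r) ^+ n) `^ (- gam) * mass u (sball y r) `^ (- kap))%:E *
     wmeasure (fun x => u x * V x `^ (1 - (gam + kap)))%R (E `&` sball y r) <=
     (K * (u y `^ gam * mass (fun x => u x * V x) E `^ (1 - (gam + kap))) *
      Num.min (X r `^ e) (X r `^ e)^-1)%:E)%E]}) ->
  testing u V gam kap.
Proof.
move=> hu hV g0 kap0 gk1 k0 e0 K0 H.
have nuV := nnmeas_strictM hu hV.
have k'0 : 0 < (1 + k) `^ e - 1.
  rewrite subr_gt0 /powR gt_eqF ?ltr_wpDr ?(ltW k0)//.
  by rewrite expR_gt1 mulr_gt0// ln_gt0//; lra.
exists (K * (4 * (1 + k) `^ e / ((1 + k) `^ e - 1))).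
  by rewrite mulr_gt0// divr_gt0// mulr_gt0// powR_gt0//; lra.
move=> E mE fE; set M := mass _ E.
have ME : wmeasure (fun x => u x * V x) E = M%:E.
  by rewrite fineK// ge0_fin_numE// wmeasure_ge0.
have mEB y r : measurable (E `&` sball y r).
  by apply: measurableI => //; exact: measurable_sball.
have M0 : 0 <= M by exact: mass_ge0.
move: M0; rewrite le_eqVlt => /orP[/eqP M0|M0].
  have E0 : mu E = 0%E.
    by apply: wmeasure_strictM_eq0 hu hV mE _; rewrite ME -M0.
  apply: nearW => y; rewrite eseries0.
    by rewrite lee_fin mulr_ge0 ?mulr_ge0 ?powR_ge0 ?invr_ge0 ?(ltW K0) ?(ltW k'0).
  move=> j _ _; rewrite [X in (_ * X)%E]wmeasure_null ?mule0//.
    exact: nnmeas_strict_powR.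
  by apply: subset_measure0 E0 => //; exact: subIsetl.
apply: filterS (H E mE fE M0) => y [X [X0 Xk HX]].
rewrite -/M in HX; set T := u y `^ gam * _ in HX *.
rewrite [leRHS](_ : _ = (K * T * (4 * (1 + k) `^ e / ((1 + k) `^ e - 1)))%:E); last first.
  by congr (_%:E); ring.
apply: nneseries_lacunary k0 e0 _ X0 Xk _ _.
- by rewrite mulr_ge0 ?(ltW K0)// mulr_ge0 ?powR_ge0.
- move=> j; rewrite mule_ge0 ?lee_fin ?mulr_ge0 ?powR_ge0//.
  by apply: wmeasure_ge0; exact: nnmeas_strict_powR.
- by move=> j; apply: HX; exact: dyadic_gt0.
Qed.

(** Take [X] to be the [V]-mass of the ball times [u y], divided by the [u V]-mass of [E]. On
    small balls [E] is ignored and [A1_power] applies. On large balls either the lower bound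
    for [V] from its A1 condition is used, or Young's inequality. *)
Lemma testing_A1 (hn : (0 < n)%N) u V C gam :
  strict_weight u -> A1_const C u -> strict_weight V -> A1_const C V -> 1 <= C -> 0 < gam -> gam < 1 ->
  exists kap, [/\ 0 < kap, gam + kap < 1 & testing u V gam kap].
Proof.
move=> hu hCu hV hCV C1 g0 g1.
have [e0 e00 He] := A1_power hu hCu C1 hV.
pose e := Num.min e0 ((1 - gam) / 2).
have ep : 0 < e by rewrite lt_min e00 divr_gt0// subr_gt0.
have ee0 : e <= e0 by rewrite ge_min lexx.
have eg : e <= (1 - gam) / 2 by rewrite ge_min lexx orbT.
have [K K0 HK] := He e ep ee0.
pose kap := 1 - gam - e; exists kap.
have kap0 : 0 < kap by rewrite /kap; lra.
have gk1 : gam + kap < 1 by rewrite /kap; lra.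
split => //; have eE : 1 - (gam + kap) = e by rewrite /kap; lra.
have sE : gam + kap + e = 1 by rewrite /kap; lra.
have s0 : 0 < gam + kap by lra.
have C0 : 0 < C := lt_le_trans ltr01 C1.
pose c := ln C; have c0 : 0 <= c by exact: ln_ge0.
have CE : C = expR c by rewrite lnK// posrE.
apply: (@testing_of_terms u V gam kap (C * 8 ^+ n)^-1 (Num.min e gam) ((2 + K) * expR c)) => //.
- by rewrite invr_gt0 mulr_gt0// exprn_gt0.
- by rewrite lt_min ep.
- by rewrite mulr_gt0 ?expR_gt0//; lra.
move=> E mE fE; set M := mass _ E => M0.
have nuV := nnmeas_strictM hu hV.
have ME : wmeasure (fun x => u x * V x) E = M%:E.
  by rewrite fineK// ge0_fin_numE// wmeasure_ge0.
have [m mEq] := expR_lnE M0.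
apply: filterS hCu => y Hy.
have [_ u0 _] := hu; have [_ V0 _] := hV.
have [uy uyE] := expR_lnE (u0 y).
exists (fun r => mass V (sball y r) * u y / M); split.
- by move=> r r0; rewrite divr_gt0// mulr_gt0// mass_gt0// mulr_gt0.
- move=> r r0; rewrite !mulrA ler_pM2r ?invr_gt0// ler_pM2r//.
  exact: A1_reverse_doubling.
move=> r r0; have r20 : 0 < 2 * r by rewrite mulr_gt0.
have P0 : 0 < (2 * r) ^+ n by rewrite exprn_gt0.
have U0 : 0 < mass u (sball y r) by exact: mass_gt0.
have Vb0 : 0 < mass V (sball y r) by exact: mass_gt0.
have [p pE] := expR_lnE P0; have [ub ubE] := expR_lnE U0; have [vb vbE] := expR_lnE Vb0.
have mB := @measurable_sball R n y r.
have mEB : measurable (E `&` sball y r) by exact: measurableI.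
have nJ := nnmeas_strict_powR (1 - (gam + kap)) hu hV.
have ubc : ub <= c + p + uy.
  have := Hy _ _ r20 (sball_center y (ltW r0)).
  by rewrite massE// lee_fin -/(sball y r) ubE CE pE uyE -!expRD ler_expR.
(* small balls: the set [E] is dropped *)
have J3 : (wmeasure (fun x => u x * V x `^ (1 - (gam + kap)))%R (E `&` sball y r) <=
    (K * expR (ub + (1 - (gam + kap)) * (vb - p)))%:E)%E.
  apply: le_trans (wmeasure_subset nJ mEB mB (@subIsetr _ _ _)) _.
  have := HK _ _ r20; rewrite -/(sball y r) eE => /(_ (y - const_mx r)) H.
  apply: le_trans H _; rewrite lee_fin -/(sball y r) ubE vbE pE -expRN -expRD expR_powR.
  by rewrite -mulrA -expRD.
(* large balls: Young's inequality with the whole mass of [E] *)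
have J2 : (wmeasure (fun x => u x * V x `^ (1 - (gam + kap)))%R (E `&` sball y r) <=
    (2 * expR ((gam + kap) * ub + (1 - (gam + kap)) * m))%:E)%E.
  apply: wmeasure_young => //; [by rewrite eE|by rewrite eE| |].
  - rewrite -ubE -massE//.
    exact: wmeasure_subset (strict_weight_nnmeas hu) mEB mB (@subIsetr _ _ _).
  - by rewrite -mEq -ME; apply: wmeasure_subset => //; exact: subIsetl.
(* large balls: [V] is bounded below on the ball by a multiple of its average *)
have J1 : (wmeasure (fun x => u x * V x `^ (1 - (gam + kap)))%R (E `&` sball y r) <=
    (expR (c + (gam + kap) * (p - vb) + m))%:E)%E.
  set w := expR (c + (gam + kap) * (p - vb)).
  apply: (@le_trans _ _ (wmeasure (fun x => w * (u x * V x))%R (E `&` sball y r))).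
    apply: le_wmeasure_ae => //; first by apply: nnmeasZ => //; exact: expR_ge0.
    apply: filterS hCV => x Hx [_ Bx].
    have := Hx _ _ r20 Bx; rewrite massE// lee_fin -/(sball y r) => VbV.
    rewrite mulrCA ler_pM2l// eE.
    rewrite (_ : e = - (gam + kap) + 1); last by lra.
    rewrite powR_add// powRr1 ?(ltW (V0 x))// ler_pM2r//.
    have [vx vxE] := expR_lnE (V0 x).
    move: VbV; rewrite vxE expR_powR vbE CE pE -!expRD !ler_expR => VbV.
    have := ler_wpM2l (ltW s0) VbV; have : (gam + kap) * c <= c by rewrite ler_piMl// ltW.
    lra.
  rewrite wmeasureZ ?expR_ge0// expRD EFinM -/w; apply: lee_wpmul2l.
    by rewrite lee_fin expR_ge0.
  by rewrite -mEq -ME; apply: wmeasure_subset => //; exact: subIsetl.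
have fJ : wmeasure (fun x => u x * V x `^ (1 - (gam + kap)))%R (E `&` sball y r)
    \is a fin_num.
  by rewrite ge0_fin_numE ?wmeasure_ge0//; apply: le_lt_trans J3 _; exact: ltry.
rewrite -(fineK fJ) in J1 J2 J3 *; rewrite -EFinM !lee_fin in J1 J2 J3 *.
have := key_scalar_A1 g0 kap0 gk1 c0 (ltW K0) ubc J1 J2 J3.
rewrite ubE vbE pE uyE mEq !expR_powR -!expRD -expRN -!expRD -mulNr eE.
move/le_trans; apply; apply: ler_wpM2l.
  by rewrite !mulr_ge0 ?expR_ge0//; lra.
exact: min_expR_le.
Qed.

(** The form in which the A-infinity condition is used: with respect to the measure [u dx],
    it is the A_r condition for [V], with [d = 1 / (r - 1)]. *)
Definition negative_power_bound u V (d K : R) := [/\ 0 < d, 0 < K,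
  strict_weight (fun x => u x * V x) &
  forall a l, 0 < l -> (wmeasure (fun x => u x * V x `^ (- d))%R (cube a l) <=
   (K * mass u (cube a l) `^ (1 + d) * mass (fun x => u x * V x) (cube a l) `^ (- d))%:E)%E].

(** As for A_r weights: a subset that carries a fixed share of [u] carries a fixed share of
    [u V]. With [lam] a small multiple of the average of [V], the part of the smaller cube
    where [V <= lam] has little [u]-mass, by the bound on the negative power. *)
Lemma negative_power_share u V (d K k : R) a l a' l' : strict_weight u -> strict_weight V ->
  negative_power_bound u V d K -> 0 < k -> 0 < l -> 0 < l' ->
  cube a l `<=` cube a' l' ->
  k * mass u (cube a' l') <= mass u (cube a l) ->
  (k / 2 * (k / (2 * K)) `^ d^-1) * mass (fun x => u x * V x) (cube a' l') <=
  mass (fun x => u x * V x) (cube a l).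
Proof.
move=> hu hV [d0 K0 huV neg] k0 l0 l'0 sub hk.
set W := fun x => u x * V x in huV neg *.
have nu := strict_weight_nnmeas hu; have nW := strict_weight_nnmeas huV.
have U'0 : 0 < mass u (cube a' l') by exact: mass_gt0.
have W'0 : 0 < mass W (cube a' l') by exact: mass_gt0.
set t := (k / (2 * K)) `^ d^-1.
have kK0 : 0 < k / (2 * K) by rewrite divr_gt0// mulr_gt0.
have t0 : 0 < t by rewrite powR_gt0.
set lam := t * mass W (cube a' l') / mass u (cube a' l').
have lam0 : 0 < lam by rewrite divr_gt0// mulr_gt0.
have mc b r : measurable (cube b r : set Rn) by exact: measurable_cube.
have nneg := nnmeas_strict_powR (- d) hu hV.
have : (wmeasure u (cube a l) <= (lam^-1)%:E * wmeasure W (cube a l) +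
   (lam `^ d)%:E * wmeasure (fun x => u x * V x `^ (- d))%R (cube a' l'))%E.
  apply: (@le_trans _ _ (wmeasure (fun x => lam^-1 * W x +
      lam `^ d * (u x * V x `^ (- d)))%R (cube a l))).
    apply: le_wmeasure => //.
      by apply: nnmeasD; apply: nnmeasZ => //; rewrite ?powR_ge0// invr_ge0 ltW.
    move=> x _; have [_ /(_ x) ux _] := hu; have [_ /(_ x) Vx _] := hV.
    rewrite /W; have -> : lam^-1 * (u x * V x) + lam `^ d * (u x * V x `^ (- d)) =
      u x * (V x / lam + lam `^ d * V x `^ (- d)) by ring.
    rewrite -[leLHS]mulr1 ler_pM2l//; have [Vl|lV] := lerP (V x) lam.
      apply: (@le_trans _ _ (lam `^ d * V x `^ (- d))); last first.
        by rewrite lerDr divr_ge0 ?ltW.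
      rewrite -(powR_mul_inv d Vx) ler_pM2r ?powR_gt0//.
      by apply: powR_homo => //; exact: ltW.
    apply: (@le_trans _ _ (V x / lam)); last by rewrite lerDl mulr_ge0 ?powR_ge0.
    by rewrite ler_pdivlMr// mul1r ltW.
  rewrite wmeasureD//; do ? [by apply: nnmeasZ => //; rewrite ?powR_ge0// invr_ge0 ltW].
  rewrite !wmeasureZ ?powR_ge0 ?invr_ge0 ?(ltW lam0)//; apply: leeD => //.
  apply: lee_wpmul2l; first by rewrite lee_fin powR_ge0.
  exact: wmeasure_subset.
move=> H; have {H} := le_trans H (leeD2l _ (lee_wpmul2l _ (neg a' l' l'0))).
rewrite lee_fin powR_ge0 => /(_ isT).
rewrite !massE// -EFinM -EFinM -EFinD lee_fin.
have -> : lam `^ d * (K * mass u (cube a' l') `^ (1 + d) * mass W (cube a' l') `^ (- d)) =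
    k / 2 * mass u (cube a' l').
  have td : t `^ d = k / (2 * K).
    by rewrite /t -powRrM mulVf ?gt_eqF// powRr1 ?ltW.
  have [U UE] := expR_lnE U'0; have [Wv WE] := expR_lnE W'0.
  rewrite /lam -mulrA powRM ?(ltW t0)//; last by rewrite divr_ge0 ?ltW.
  rewrite td UE WE -expRN -expRD !expR_powR.
  rewrite (_ : _ * (_ * _ * _) = k / 2 * (expR (d * (Wv - U)) * expR ((1 + d) * U) * expR (- d * Wv))).
    by rewrite -!expRD; congr (_ * expR _); ring.
  by field; rewrite gt_eqF.
move=> H; have H' : k / 2 * mass u (cube a' l') <= lam^-1 * mass W (cube a l) by lra.
rewrite ler_pdivlMl// in H'; apply: le_trans H'.
rewrite /lam le_eqVlt; apply/orP; left; apply/eqP; field.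
by rewrite gt_eqF.
Qed.

(** Here [X] is the ratio of the [u V]-masses of the ball and of [E], which grows
    geometrically with the radius by [negative_power_share]. The integrals are estimated with
    Young's inequality; on large balls its second term involves the negative power of [V], so
    as to gain a power of [X]. *)
Lemma testing_Ainfty (hn : (0 < n)%N) u V C d K gam : strict_weight u -> A1_const C u -> strict_weight V ->
  negative_power_bound u V d K -> 1 <= C -> 0 < gam -> gam < 1 ->
  exists kap, [/\ 0 < kap, gam + kap < 1 & testing u V gam kap].
Proof.
move=> hu hCu hV npb C1 g0 g1; have [d0 K0 huV neg] := npb.
pose kap := (1 - gam) / 2; exists kap.
have kap0 : 0 < kap by rewrite divr_gt0// subr_gt0.
have gk1 : gam + kap < 1 by rewrite /kap; lra.
split => //; have s0 : 0 < gam + kap by lra.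
pose e := 1 - (gam + kap); have e0 : 0 < e by rewrite /e; lra.
have se : gam + kap + e = 1 by rewrite /e; lra.
have C0 : 0 < C := lt_le_trans ltr01 C1.
pose c := ln C; have c0 : 0 <= c by exact: ln_ge0.
have CE : C = expR c by rewrite lnK// posrE.
pose k := (C * 8 ^+ n)^-1; have k0 : 0 < k by rewrite invr_gt0 mulr_gt0// exprn_gt0.
pose k' := k / 2 * (k / (2 * K)) `^ d^-1.
have k'0 : 0 < k' by rewrite mulr_gt0 ?divr_gt0 ?powR_gt0 ?divr_gt0 ?mulr_gt0.
have b0 : 0 < (gam + kap) * (d / (1 + d)).
  by rewrite mulr_gt0// divr_gt0// addr_gt0.
apply: (@testing_of_terms u V gam kap k' (Num.min e ((gam + kap) * (d / (1 + d))))
  ((2 + K) * expR c)) => //.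
- by rewrite lt_min e0.
- by rewrite mulr_gt0 ?expR_gt0//; lra.
move=> E mE fE; set W := fun x => u x * V x; set M := mass _ E => M0.
have nuV := nnmeas_strictM hu hV.
have ME : wmeasure W E = M%:E by rewrite fineK// ge0_fin_numE// wmeasure_ge0.
have [m mEq] := expR_lnE M0.
apply: (filterS _ hCu) => y Hy.
have [_ u0 _] := hu; have [_ V0 _] := hV.
have [uy uyE] := expR_lnE (u0 y).
exists (fun r => mass W (sball y r) / M); split.
- by move=> r r0; rewrite divr_gt0// mass_gt0// mulr_gt0.
- move=> r r0; rewrite mulrA ler_pM2r ?invr_gt0//.
  apply: (reverse_doubling hn huV r0 (ltW k'0)).
  apply: (negative_power_share hu hV npb k0); rewrite ?mulr_gt0 ?divr_gt0//.
    exact: corner_sub.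
  exact: (A1_corner y hu hCu C1 r0).
move=> r r0; have r20 : 0 < 2 * r by rewrite mulr_gt0.
have P0 : 0 < (2 * r) ^+ n by rewrite exprn_gt0.
have U0 : 0 < mass u (sball y r) by exact: mass_gt0.
have W0 : 0 < mass W (sball y r) / M by rewrite divr_gt0// mass_gt0// mulr_gt0.
have [p pE] := expR_lnE P0; have [ub ubE] := expR_lnE U0; have [x xE] := expR_lnE W0.
have WE : mass W (sball y r) = expR (x + m).
  by rewrite expRD -xE -mEq divfK// gt_eqF.
have mB := @measurable_sball R n y r.
have mEB : measurable (E `&` sball y r) by exact: measurableI.
have nJ := nnmeas_strict_powR (1 - (gam + kap)) hu hV.
have nN := nnmeas_strict_powR (- d) hu hV.
have ubc : ub <= c + p + uy.
  have := Hy _ _ r20 (sball_center y (ltW r0)).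
  by rewrite massE// lee_fin -/(sball y r) ubE CE pE uyE -!expRD ler_expR.
have J1 : (wmeasure (fun x => u x * V x `^ (1 - (gam + kap)))%R (E `&` sball y r) <=
    (2 * expR ((gam + kap) * ub + (1 - (gam + kap)) * (x + m)))%:E)%E.
  apply: wmeasure_young => //.
  - rewrite -ubE -massE//.
    exact: wmeasure_subset (strict_weight_nnmeas hu) mEB mB (@subIsetr _ _ _).
  - rewrite -WE -massE//.
    exact: wmeasure_subset nuV mEB mB (@subIsetr _ _ _).
have [th [thE thD]] : exists th, th * (1 + d) = d /\ d / (1 + d) = th.
  by exists (d / (1 + d)); rewrite divfK// gt_eqF// addr_gt0.
have J2 : (wmeasure (fun x => u x * V x `^ (1 - (gam + kap)))%R (E `&` sball y r) <=
    ((1 + K) * expR ((gam + kap) * ub + (1 - (gam + kap)) * m - (gam + kap) * th * x))%:E)%E.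
  (* this level balances the two terms of [young_split_neg] after integration *)
  set l := expR (th * x + m - ub); have l0 : 0 < l by exact: expR_gt0.
  apply: (@le_trans _ _ (wmeasure (fun x => l `^ (- (gam + kap)) * W x +
      l `^ (e + d) * (u x * V x `^ (- d)))%R (E `&` sball y r))).
    apply: le_wmeasure => //.
      by apply: nnmeasD; apply: nnmeasZ => //; exact: powR_ge0.
    move=> z _.
    by have := ler_wpM2l (ltW (u0 z)) (young_split_neg (V0 z) l0 s0 e0 d0 se);
      rewrite -/e /W; lra.
  rewrite wmeasureD//; do ? [by apply: nnmeasZ => //; exact: powR_ge0].
  rewrite !wmeasureZ ?powR_ge0// [(1 + K) * _]mulrDl mul1r EFinD; apply: leeD.
    apply: (@le_trans _ _ ((l `^ (- (gam + kap)))%:E * (expR m)%:E)%E).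
      apply: lee_wpmul2l; first by rewrite lee_fin powR_ge0.
      rewrite -mEq -ME; apply: (wmeasure_subset nuV mEB mE); exact: subIsetl.
    rewrite -EFinM lee_fin expR_powR -expRD ler_expR; lra.
  apply: (@le_trans _ _ ((l `^ (e + d))%:E *
      (K * expR ub `^ (1 + d) * expR (x + m) `^ (- d))%:E)%E).
    apply: lee_wpmul2l; first by rewrite lee_fin powR_ge0.
    rewrite -ubE -WE; apply: le_trans (neg (y - const_mx r) _ r20).
    exact: (wmeasure_subset nN mEB mB (@subIsetr _ _ _)).
  rewrite -EFinM lee_fin !expR_powR.
  rewrite mulrCA -!expRD -!mulrA -!expRD ler_pM2l// ler_expR.
  have xE' : x * (th * (1 + d)) = x * d by rewrite thE.
  by rewrite /e; lra.
rewrite -thD in J2; have fJ : wmeasure (fun x => u x * V x `^ (1 - (gam + kap)))%R (E `&` sball y r)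
    \is a fin_num.
  by rewrite ge0_fin_numE ?wmeasure_ge0//; apply: le_lt_trans J1 _; exact: ltry.
rewrite -(fineK fJ) in J1 J2 *; rewrite -EFinM !lee_fin in J1 J2 *.
have := key_scalar_Ainfty g0 kap0 gk1 d0 c0 (ltW K0) ubc J1 J2.
rewrite ubE xE pE uyE mEq !expR_powR -!expRD -mulNr.
move/le_trans; apply; apply: ler_wpM2l.
  by rewrite !mulr_ge0 ?expR_ge0//; lra.
rewrite -expR_powR; exact: min_expR_le.
Qed.

End testing_condition_proofs.

(** * The A-infinity condition as a negative power inequality *)

Section Ainfty_negative_power.
Context {R : realType} {n : nat}.
Local Notation Rn := 'rV[R]_n.
Local Notation mu := (@lebesgue_rV R n).
Implicit Types (a x y : Rn) (l c t e : R) (u w V : Rn -> R).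

(** On each cube the A1 weight [u] is bounded below, so local integrability passes from
    [u V] to [V]. *)
Lemma strict_weight_of_A1_product u V C : strict_weight u -> A1_const C u -> 0 < C ->
  measurable_fun setT V -> (forall x, 0 < V x) ->
  strict_weight (fun x => u x * V x) -> strict_weight V.
Proof.
move=> hu hC C0 mV V0 huV; split => // a l.
set l' := Num.max l 1; have l'0 : 0 < l' by rewrite lt_max ltr01 orbT.
have nV : nnmeas V by split => // x; exact: ltW.
have sub : cube a l `<=` cube a l'.
  move=> x /cubeP H; apply/cubeP => i; have /andP[-> /le_trans] := H i; apply.
  by rewrite lerD2l le_max lexx.
apply: (@le_lt_trans _ _ (wmeasure V (cube a l'))).
  by apply: wmeasure_subset => //; exact: measurable_cube.
have P0 : 0 < l' ^+ n by rewrite exprn_gt0.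
have U0 : 0 < mass u (cube a l') by exact: mass_gt0.
set k := C * l' ^+ n / mass u (cube a l').
have k0 : 0 <= k by rewrite divr_ge0 ?ltW// mulr_gt0.
apply: (@le_lt_trans _ _ (wmeasure (fun x => k * (u x * V x)) (cube a l'))).
  apply: le_wmeasure_ae => //; first by apply: nnmeasZ => //; exact: strict_weight_nnmeas.
    exact: measurable_cube.
  apply: filterS hC => x Hx Qx; have := Hx _ _ l'0 Qx; rewrite massE// lee_fin => H.
  rewrite mulrA -[leLHS]mul1r ler_pM2r// /k mulrAC ler_pdivlMr// mul1r//.
rewrite wmeasureZ//; [|exact: strict_weight_nnmeas|exact: measurable_cube].
have [_ _ fin] := huV; rewrite lte_mul_pinfty// ?lee_fin//.
Qed.

(** An A_r condition is the assertion itself, up to normalization. In the A1 case [1 / V] is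
    bounded on each cube by the reciprocal of the average, which is the assertion for
    [d = 1]. Since division by an infinite mass gives zero, the finiteness of the masses has
    to be extracted from the conditions. *)
Lemma Ainfty_negative_power_bound w0 V0 w V C : Ainfty_wrt w0 V0 ->
  measurable_fun setT w0 -> measurable_fun setT V0 -> measurable_fun setT V ->
  {ae mu, forall x, w0 x = w x} -> {ae mu, forall x, V0 x = V x} ->
  (forall x, 0 < V x) -> strict_weight w -> A1_const C w -> 0 < C ->
  strict_weight V /\ exists d K, negative_power_bound w V d K.
Proof.
move=> hA mw0 mV0 mV ww VV Vpos hw hCw C0.
have nw := strict_weight_nnmeas hw; have nV : nnmeas V by split => // x; exact: ltW.
have [mw wpos _] := hw.
have nwV : nnmeas (fun x => w x * V x) by exact: nnmeasM.
have mc a l : measurable (cube a l : set Rn) by exact: measurable_cube.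
have E1 a l : wmeasure w0 (cube a l) = wmeasure w (cube a l).
  exact: eq_wmeasure_ae.
have E2 a l : wmeasure (V0 \* w0)%R (cube a l) =
    wmeasure (fun x => w x * V x) (cube a l).
  apply: eq_wmeasure_ae => //; [exact: measurable_funM|by have [] := nwV|].
  by apply: filterS2 ww VV => x /= -> ->; rewrite mulrC.
have wV0 a l : 0 < l -> (0 < wmeasure (fun x => w x * V x)%R (cube a l))%E.
  move=> l0; apply: wmeasure_gt0 => //; first by have [] := nwV.
    by move=> x; rewrite mulr_gt0.
  by rewrite mu_cube ?ltW// lte_fin exprn_gt0.
have fin_tame : (forall a l, 0 < l ->
    (wmeasure (fun x => w x * V x)%R (cube a l) < +oo)%E) ->
    strict_weight (fun x => w x * V x).
  move=> fin; split; [by have [] := nwV|by move=> x; rewrite mulr_gt0|move=> a l].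
  apply: le_lt_trans (fin a (Num.max l 1) _); last by rewrite lt_max ltr01 orbT.
  apply: wmeasure_subset => // x /cubeP H; apply/cubeP => i.
  have /andP[-> /le_trans] := H i; apply.
  by rewrite lerD2l le_max lexx.
suff [d [K npb]] : exists d K, negative_power_bound w V d K.
  split; last by exists d, K.
  by apply: (strict_weight_of_A1_product hw hCw C0 mV Vpos); have [] := npb.
case: hA => [[B B0 HB]|[r r1 [B B0 HB]]].
  have H a l : 0 < l -> {ae mu, forall y, cube a l y ->
      (wmeasure (fun x => w x * V x)%R (cube a l) <=
       (B * mass w (cube a l) * V y)%:E)%E}.
    move=> l0; have U0 : 0 < mass w (cube a l) by exact: mass_gt0.
    have := HB a l l0; rewrite E1 E2 (massE a l hw) inver gt_eqF// => HQ.
    apply: filterS2 (cube_ess_inf_ae V0 a l) VV => y Hy Vy /Hy; rewrite Vy => {}Hy.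
    rewrite mulrAC EFinM -lee_pdivrMr//; apply: (le_trans HQ).
    by rewrite EFinM; apply: lee_wpmul2l => //; rewrite lee_fin ltW.
  have fin a l : 0 < l -> (wmeasure (fun x => w x * V x)%R (cube a l) < +oo)%E.
    move=> l0; have Q0 : (0 < mu (cube a l))%E.
      by rewrite mu_cube ?ltW// lte_fin exprn_gt0.
    by have [y _ /le_lt_trans] := ae_exists (mc a l) Q0 (H a l l0); apply; exact: ltry.
  have twV := fin_tame fin.
  exists 1, B; split => // a l l0.
  have U0 : 0 < mass w (cube a l) by exact: mass_gt0.
  have W0 : 0 < mass (fun x => w x * V x) (cube a l) by exact: mass_gt0.
  set U := mass w _ in U0 *; set W := mass _ _ in W0 *.
  apply: (@le_trans _ _ (wmeasure (fun x => (B * U / W) * w x)%R (cube a l))).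
    apply: le_wmeasure_ae => //.
    - by apply: nnmeasM => //; exact: nnmeas_powR.
    - by apply: nnmeasZ => //; rewrite divr_ge0 ?(ltW W0)// mulr_ge0 ?ltW.
    - apply: filterS (H a l l0) => y Hy /Hy; rewrite (massE a l twV) lee_fin -/U -/W => {}Hy.
      rewrite /= mulrC ler_pM2r// (powR_inv1 (ltW (Vpos y))) -[leLHS]mul1r.
      by rewrite ler_pdivrMr// mulrAC ler_pdivlMr// mul1r.
  rewrite wmeasureZ//; last by rewrite divr_ge0 ?(ltW W0)// mulr_ge0 ?ltW.
  rewrite massE// -/U -EFinM lee_fin powR_inv1 ?(ltW W0)//.
  rewrite powR_add// !powRr1 ?(ltW U0)// le_eqVlt; apply/orP; left; apply/eqP.
  by ring.
set d := (r - 1)^-1; have r0 : 0 < r - 1 by rewrite subr_gt0.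
have d0 : 0 < d by rewrite invr_gt0.
have nY : nnmeas (fun x => w x * V x `^ (- d)) by apply: nnmeasM => //; exact: nnmeas_powR.
have E3 a l : wmeasure (fun x => V0 x `^ (- (r - 1)^-1) * w0 x)%R (cube a l) =
    wmeasure (fun x => w x * V x `^ (- d)) (cube a l).
  apply: eq_wmeasure_ae (proj1 nY) (mc a l) _.
    apply: measurable_funM => //.
    exact: (measurableT_comp (measurable_powR _) mV0).
  by apply: filterS2 ww VV => x /= -> ->; rewrite mulrC.
have main a l : 0 < l -> [/\ (wmeasure (fun x => w x * V x)%R (cube a l) < +oo)%E,
    (wmeasure (fun x => w x * V x `^ (- d))%R (cube a l) < +oo)%E &
    mass (fun x => w x * V x `^ (- d)) (cube a l) <=
     B `^ d * mass w (cube a l) `^ (1 + d) *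
       mass (fun x => w x * V x) (cube a l) `^ (- d)].
  move=> l0; have U0 : 0 < mass w (cube a l) by exact: mass_gt0.
  have := HB a l l0; rewrite E1 E2 E3 (massE a l hw) inver gt_eqF//.
  have X0 := wV0 a l l0.
  have Y0 : (0 < wmeasure (fun x => w x * V x `^ (- d))%R (cube a l))%E.
    apply: wmeasure_gt0 => //; first by have [] := nY.
      by move=> x; rewrite mulr_gt0// powR_gt0.
    by rewrite mu_cube ?ltW// lte_fin exprn_gt0.
  rewrite /mass; set U := fine (wmeasure w _); rewrite -/(mass w _) in U0 *.
  have Ui : (0 < (mass w (cube a l))^-1%:E)%E by rewrite lte_fin invr_gt0.
  case: (wmeasure _ _) X0 => [X| |] // X0; last first.
    rewrite gt0_mulye// => H; exfalso; move: H; apply/negP; rewrite -ltNge.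
    rewrite gt0_mulye ?ltry// poweR_gt0// mule_gt0//.
  case: (wmeasure _ _) Y0 => [Y| |] // Y0; last first.
    rewrite gt0_mulye// poweRyr ?gt_eqF// => H; exfalso; move: H; apply/negP; rewrite -ltNge.
    by rewrite gt0_muley ?ltry// mule_gt0.
  rewrite -!EFinM lee_fin => H.
  split; [exact: ltry|exact: ltry|rewrite /=].
  rewrite !lte_fin in X0 Y0.
  have [x xE] := expR_lnE X0; have [y yE] := expR_lnE Y0.
  have [uu uE] := expR_lnE U0; have [bb bE] := expR_lnE B0.
  move: H; rewrite /U -/(mass w _) uE xE yE bE -!expRN -!expRD !expR_powR -!expRD !ler_expR => H.
  have := ler_wpM2l (ltW d0) H; have : d * (r - 1) = 1 by rewrite mulVf// gt_eqF.
  move=> drE; rewrite mulrDr mulrA drE mul1r; lra.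
have twV : strict_weight (fun x => w x * V x).
  by apply: fin_tame => a l l0; have [] := main a l l0.
exists d, (B `^ d); split => //; first by rewrite powR_gt0.
move=> a l l0; have [_ finY] := main a l l0; rewrite /mass -lee_fin fineK//.
by rewrite ge0_fin_numE// wmeasure_ge0.
Qed.

End Ainfty_negative_power.

(** * Weak-type inequality for the potential *)

Section weak_type.
Context {R : realType} {n : nat}.
Local Notation Rn := 'rV[R]_n.
Local Notation mu := (@lebesgue_rV R n).
Implicit Types (a x y : Rn) (l r c t e : R) (u w V f g H : Rn -> R) (A B D E : set Rn).

Lemma wmeasure_indicM f A : nnmeas f -> measurable A ->
  wmeasure (fun x => \1_A x * f x) setT = wmeasure f A.
Proof.
move=> hf mA; rewrite /wmeasure [RHS]integral_mkcond; apply: eq_integral => x _.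
by rewrite patchE indicE; case: (x \in A); rewrite ?mul1r ?mul0r.
Qed.

Lemma nnmeas_indic A : measurable A -> nnmeas (\1_A : Rn -> R).
Proof. by move=> mA; split => [|x]; [exact: measurable_indic|rewrite indicE]. Qed.

(** For the joint measurability needed to exchange integrals over balls. *)
Lemma measurable_near_diagonal r : measurable [set p : Rn * Rn | sball p.1 r p.2].
Proof.
rewrite (_ : [set _ | _] = \big[setI/setT]_(i < n)
    ((fun p : Rn * Rn => `|p.1 ord0 i - p.2 ord0 i|) @^-1` `]-oo, r]%classic)).
  apply: bigsetI_measurable => i _; rewrite -[X in measurable X]setTI.
  apply: (measurableT_comp (@normr_measurable R setT)) => //.
  by apply: measurable_funB; apply: (measurableT_comp (measurable_coor i)).
rewrite -bigcap_seq; apply/seteqP; split => p /=.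
  by move/sballP => h i _ /=; rewrite in_itv /=; exact: h.
move=> h; apply/sballP => i; have := h i (mem_index_enum _).
by rewrite /= in_itv.
Qed.

Let near_kernel (f : Rn -> R) r (p : Rn * Rn) : \bar R :=
  (\1_[set p : Rn * Rn | sball p.1 r p.2] p * f p.2)%:E.

Let measurable_near_kernel f r : nnmeas f -> measurable_fun setT (near_kernel f r).
Proof.
move=> [mf _]; apply/measurable_EFinP; apply: measurable_funM.
  by apply: measurable_indic; exact: measurable_near_diagonal.
exact: (measurableT_comp mf).
Qed.

Let near_kernel_ge0 f r p : nnmeas f -> (0 <= near_kernel f r p)%E.
Proof. by move=> [_ f0]; rewrite lee_fin mulr_ge0. Qed.

Let integral_near_kernel f r x : nnmeas f ->
  (\int[mu]_y near_kernel f r (x, y))%E = wmeasure f (sball x r).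
Proof.
move=> hf; rewrite -(wmeasure_indicM hf); last exact: measurable_sball.
by apply: eq_integral => y _; congr (_%:E); congr (_ * _).
Qed.

Lemma measurable_wmeasure_sball f r : nnmeas f ->
  measurable_fun setT (fun x => wmeasure f (sball x r)).
Proof.
move=> hf; have := @measurable_fun_fubini_tonelli_F _ _ Rn Rn R mu _
  (measurable_near_kernel r hf) (fun p => near_kernel_ge0 r p hf).
apply: eq_measurable_fun => x _; rewrite /fubini_F; exact: integral_near_kernel.
Qed.

Lemma measurable_mass_sball f r : nnmeas f -> measurable_fun setT (fun x => mass f (sball x r)).
Proof.
move=> hf; apply: (measurableT_comp (@fine_measurable R setT measurableT)).
exact: measurable_wmeasure_sball.
Qed.

(** Tonelli's theorem, since [y] is in the ball around [x] if and only if [x] is in the ball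
    of the same radius around [y]. *)
Lemma wmeasure_sball_exchange f g r : nnmeas f -> nnmeas g ->
  (\int[mu]_x ((f x)%:E * wmeasure g (sball x r)) =
   \int[mu]_y ((g y)%:E * wmeasure f (sball y r)))%E.
Proof.
move=> hf hg; have [mf f0] := hf; have [mg g0] := hg.
pose F (p : Rn * Rn) : \bar R := ((f p.1)%:E * near_kernel g r p)%E.
have mF : measurable_fun setT F.
  apply: emeasurable_funM; last exact: measurable_near_kernel.
  by apply/measurable_EFinP; exact: (measurableT_comp mf).
have F0 p : (0 <= F p)%E.
  by apply: mule_ge0; [rewrite lee_fin|exact: near_kernel_ge0].
transitivity (\int[mu]_x \int[mu]_y F (x, y))%E.
  apply: eq_integral => x _; rewrite -integral_near_kernel// -ge0_integralZl_EFin//.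
  - by move=> y _; exact: near_kernel_ge0.
  - exact: (measurableT_comp (measurable_near_kernel r hg) (measurable_pair1 x)).
rewrite (fubini_tonelli F mF F0).
apply: eq_integral => y _; rewrite -integral_near_kernel// -ge0_integralZl_EFin//; last 2 first.
- by move=> x _; exact: near_kernel_ge0.
- exact: (measurableT_comp (measurable_near_kernel r hf) (measurable_pair1 y)).
apply: eq_integral => x _; rewrite /F /near_kernel /= -!EFinM; congr (_%:E).
rewrite !indicE mulrCA [RHS]mulrCA [f x * g y]mulrC; congr (_ * _).
congr ((nat_of_bool _)%:R); apply/idP/idP; rewrite !inE /=; exact: sball_sym.
Qed.

Definition coef u (gam kap : R) (j : nat) x : R :=
  ((2 * dyadic j) ^+ n) `^ (- gam) * mass u (sball x (dyadic j)) `^ (- kap).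

Definition potential u (gam kap : R) H x : \bar R :=
  (\sum_(j <oo) (coef u gam kap j x)%:E * wmeasure H (sball x (dyadic j)))%E.

Lemma nnmeas_coef u gam kap j : nnmeas u -> nnmeas (coef u gam kap j).
Proof.
move=> hu; split; last by move=> x; rewrite mulr_ge0 ?powR_ge0.
apply: measurable_funM; first exact: measurable_cst.
exact: (measurableT_comp (measurable_powR _) (measurable_mass_sball _ hu)).
Qed.

(** A1 weights are doubling, and the two balls of radius [dyadic j] lie in a common ball of
    twice the radius. *)
Lemma coef_compare u C gam kap j x y : strict_weight u -> A1_const C u -> 1 <= C -> 0 < kap ->
  sball y (dyadic j) x -> coef u gam kap j x <= (C * 2 ^+ n) `^ kap * coef u gam kap j y.
Proof.
move=> hu hC C1 k0 yx; have C0 : 0 < C := lt_le_trans ltr01 C1.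
have r0 := @dyadic_gt0 R j; have r20 : 0 < 2 * dyadic j :> R by rewrite mulr_gt0.
have sub : sball x (dyadic j) `<=` sball x (2 * dyadic j).
  by apply: subset_sball; have := r0; lra.
have := A1_share_sball hu hC (ltW C0) r0 r20 sub.
rewrite exprMn => H'; have H : mass u (sball x (2 * dyadic j)) <=
    C * 2 ^+ n * mass u (sball x (dyadic j)).
  rewrite -(ler_pM2r (exprn_gt0 n r0)); apply: le_trans H' _.
  by rewrite le_eqVlt; apply/orP; left; apply/eqP; ring.
move=> {H'}.
have sub2 : sball y (dyadic j) `<=` sball x (2 * dyadic j).
  rewrite (_ : 2 * dyadic j = dyadic j + dyadic j); last by ring.
  exact: sball_sub.
have yU : mass u (sball y (dyadic j)) <= mass u (sball x (dyadic j)) * (C * 2 ^+ n).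
  apply: (@le_trans _ _ (mass u (sball x (2 * dyadic j)))).
    rewrite -lee_fin -!massE//.
    apply: (wmeasure_subset (strict_weight_nnmeas hu) _ _ sub2); exact: measurable_sball.
  by apply: le_trans H _; rewrite mulrC.
have Ux : 0 < mass u (sball x (dyadic j)) by exact: mass_gt0.
have Uy : 0 < mass u (sball y (dyadic j)) by exact: mass_gt0.
rewrite /coef mulrCA ler_wpM2l ?powR_ge0// !powRN.
rewrite ler_pdivlMr ?powR_gt0// ler_pdivrMl ?powR_gt0//.
rewrite -powRM ?(ltW Ux)//; last by rewrite mulr_ge0 ?(ltW C0) ?exprn_ge0.
by apply: powR_homo => //; exact: ltW.
Qed.

(** The function [u V ^ (1 - gam - kap)] restricted to [E] pairs with the potential;
    exchanging the order of integration turns the potential into the sums bounded by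
    the testing condition. This is the duality that makes a weak-type bound into a
    uniform bound over point masses. *)
Lemma testing_weak_type u V C gam kap : strict_weight u -> A1_const C u -> 1 <= C -> strict_weight V ->
  0 < gam -> 0 < kap -> gam + kap < 1 -> testing u V gam kap ->
  exists2 K, 0 < K & forall H E (s N : R), nnmeas H -> measurable E ->
   (wmeasure (fun x => u x * V x)%R E < +oo)%E -> 0 < s -> 0 <= N ->
   (wmeasure (fun x => H x * u x `^ gam)%R setT <= N%:E)%E ->
   {ae mu, forall x, E x ->
     ((s * V x `^ (gam + kap))%:E <= potential u gam kap H x)%E} ->
   s * mass (fun x => u x * V x) E `^ (gam + kap) <= K * N.
Proof.
move=> hu hC C1 hV g0 k0 gk1 [K0 K00 HK].
have C0 : 0 < C := lt_le_trans ltr01 C1.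
set C' := (C * 2 ^+ n) `^ kap.
have C'0 : 0 < C' by rewrite powR_gt0// mulr_gt0// exprn_gt0.
exists (C' * K0); first by rewrite mulr_gt0.
move=> H E s N hH mE fE s0 N0 HN HE.
set W := fun x => u x * V x in fE *; set M := mass W E.
pose e := 1 - (gam + kap).
have nu := strict_weight_nnmeas hu; have nW := nnmeas_strictM hu hV.
have ME : wmeasure W E = M%:E by rewrite fineK// ge0_fin_numE// wmeasure_ge0.
have M0 : 0 <= M by exact: mass_ge0.
move: M0; rewrite le_eqVlt => /orP[/eqP M0|M0].
  rewrite -M0 powR0; last by rewrite gt_eqF// addr_gt0.
  by rewrite mulr0 !mulr_ge0 ?(ltW C'0) ?(ltW K00).
pose ph x := \1_E x * (u x * V x `^ e).
have nuV := nnmeas_strict_powR e hu hV.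
have nph : nnmeas ph by apply: nnmeasM => //; exact: nnmeas_indic.
have npc j : nnmeas (fun x => ph x * coef u gam kap j x).
  by apply: nnmeasM => //; exact: nnmeas_coef.
have phE y r : wmeasure ph (sball y r) =
    wmeasure (fun x => u x * V x `^ e) (E `&` sball y r).
  rewrite /wmeasure [RHS]integral_mkcond [LHS]integral_mkcond.
  apply: eq_integral => x _; rewrite !patchE in_setI /ph indicE.
  by case: (x \in E); case: (x \in sball y r); rewrite ?mul1r ?mul0r.
have mpot : measurable_fun setT (potential u gam kap H).
  apply: ge0_emeasurable_sum => [j x _ _|j _].
    by rewrite mule_ge0 ?lee_fin ?wmeasure_ge0//; have [_] := nnmeas_coef gam kap j nu.
  apply: emeasurable_funM; last exact: measurable_wmeasure_sball.
  by apply/measurable_EFinP; have [] := nnmeas_coef gam kap j nu.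
have pot0 x : (0 <= potential u gam kap H x)%E.
  apply: nneseries_ge0 => j _ _; rewrite mule_ge0 ?wmeasure_ge0// lee_fin.
  by have [_] := nnmeas_coef gam kap j nu.
have step1 : ((s * M)%:E <= \int[mu]_x ((ph x)%:E * potential u gam kap H x))%E.
  rewrite EFinM -ME -(wmeasure_indicM nW mE) -wmeasureZ ?(ltW s0)//; last first.
    by apply: nnmeasM => //; exact: nnmeas_indic.
  apply: ae_ge0_le_integral => //.
  - move=> x _; rewrite lee_fin mulr_ge0 ?(ltW s0)// mulr_ge0//; exact: (proj2 nW).
  - apply: nnmeas_EFin; apply: nnmeasZ; first exact: ltW.
    by apply: nnmeasM => //; exact: nnmeas_indic.
  - by move=> x _; rewrite mule_ge0// lee_fin; exact: (proj2 nph).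
  - by apply: emeasurable_funM => //; exact: nnmeas_EFin.
  apply: filterS HE => x Hx _; rewrite /ph indicE.
  have [Ex|nEx] := boolP (x \in E); last by rewrite !mul0r mulr0 mul0e.
  rewrite !mul1r; apply: le_trans (lee_wpmul2l _ (Hx (set_mem Ex))); last first.
    by rewrite lee_fin; exact: (proj2 nuV).
  have [_ /(_ x) Vx _] := hV.
  rewrite -EFinM lee_fin /W le_eqVlt; apply/orP; left; apply/eqP.
  rewrite (_ : u x * V x `^ e * _ = s * (u x * (V x `^ e * V x `^ (gam + kap)))); last by ring.
  by rewrite -powR_add// /e subrK powRr1// ltW.
have step2 : (\int[mu]_x ((ph x)%:E * potential u gam kap H x) =
   \int[mu]_y (\sum_(j <oo) ((H y)%:E *
     wmeasure (fun x => ph x * coef u gam kap j x)%R (sball y (dyadic j)))))%E.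
  rewrite integral_nneseries//; last 2 first.
  - move=> j; apply: emeasurable_funM; first exact: nnmeas_EFin.
    exact: measurable_wmeasure_sball.
  - by move=> j y _; rewrite mule_ge0 ?wmeasure_ge0// lee_fin; exact: (proj2 hH).
  under [RHS]eq_eseriesr do rewrite -(wmeasure_sball_exchange _ (npc _) hH).
  rewrite -integral_nneseries//; last 2 first.
  - move=> j; apply: emeasurable_funM; first exact: nnmeas_EFin.
    exact: measurable_wmeasure_sball.
  - by move=> j y _; rewrite mule_ge0 ?wmeasure_ge0// lee_fin; exact: (proj2 (npc j)).
  apply: eq_integral => x _; rewrite /potential -nneseriesZl; last first.
    move=> j _; rewrite mule_ge0 ?wmeasure_ge0// lee_fin.
    by have [_] := nnmeas_coef gam kap j nu.
  by apply: eq_eseriesr => j _; rewrite muleA EFinM.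
have step3 : (\int[mu]_y (\sum_(j <oo) ((H y)%:E *
     wmeasure (fun x => ph x * coef u gam kap j x)%R (sball y (dyadic j)))) <=
   wmeasure (fun y => C' * K0 * M `^ e * (H y * u y `^ gam))%R setT)%E.
  apply: ae_ge0_le_integral => //.
  - move=> y _; apply: nneseries_ge0 => j _ _.
    by rewrite mule_ge0 ?wmeasure_ge0// lee_fin; exact: (proj2 hH).
  - apply: ge0_emeasurable_sum => [j x _ _|j _].
      by rewrite mule_ge0 ?wmeasure_ge0// lee_fin; exact: (proj2 hH).
    by apply: emeasurable_funM; [exact: nnmeas_EFin|exact: measurable_wmeasure_sball].
  - move=> y _; rewrite lee_fin !mulr_ge0 ?powR_ge0 ?(ltW C'0) ?(ltW K00)//.
    exact: (proj2 hH).
  - apply: nnmeas_EFin; apply: nnmeasZ.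
      by rewrite !mulr_ge0 ?powR_ge0 ?(ltW C'0) ?(ltW K00).
    by apply: nnmeasM => //; exact: nnmeas_powR.
  apply: filterS (HK E mE fE) => y Hy _.
  rewrite nneseriesZl; last by move=> j _; exact: wmeasure_ge0.
  rewrite (_ : (C' * K0 * M `^ e * (H y * u y `^ gam))%:E =
    ((H y)%:E * (C'%:E * (K0 * (u y `^ gam * M `^ e))%:E))%E); last first.
    by rewrite -!EFinM; congr (_%:E); ring.
  apply: lee_wpmul2l; first by rewrite lee_fin; exact: (proj2 hH).
  apply: le_trans (lee_wpmul2l _ Hy); last by rewrite lee_fin ltW.
  rewrite -nneseriesZl; last first.
    move=> j _; apply: mule_ge0; last by apply: wmeasure_ge0; exact: nuV.
    by rewrite lee_fin; exact: (proj2 (nnmeas_coef gam kap j nu) y).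
  apply: lee_nneseries => [j _ _|j _]; first exact: wmeasure_ge0.
  have c0 : 0 <= C' * coef u gam kap j y.
    by apply: mulr_ge0; [exact: ltW|exact: (proj2 (nnmeas_coef gam kap j nu) y)].
  have mB := @measurable_sball R n y (dyadic j).
  rewrite -phE muleA -EFinM -/(coef u gam kap j y) -(wmeasureZ c0 nph mB).
  apply: (le_wmeasure (npc j) (nnmeasZ c0 nph) mB) => x yx.
  rewrite [leRHS]mulrC; apply: ler_wpM2l; first exact: (proj2 nph).
  exact: (coef_compare _ hu hC).
have : s * M <= C' * K0 * M `^ e * N.
  rewrite -lee_fin; apply: (le_trans step1); rewrite step2; apply: (le_trans step3).
  rewrite wmeasureZ//; last 2 first.
  - by rewrite !mulr_ge0 ?powR_ge0 ?(ltW C'0) ?(ltW K00).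
  - by apply: nnmeasM => //; exact: nnmeas_powR.
  rewrite [leRHS]EFinM; apply: lee_wpmul2l => //.
  by rewrite lee_fin !mulr_ge0 ?powR_ge0 ?(ltW C'0) ?(ltW K00).
move=> fin; rewrite -(ler_pM2r (powR_gt0 e M0)).
rewrite -mulrA -powR_add// /e addrC subrK powRr1 ?(ltW M0)//.
by apply: le_trans fin _; rewrite /e mulrAC.
Qed.

End weak_type.

(** * Pointwise bound for the fractional integral *)

Section pointwise_bound.
Context {R : realType} {n : nat}.
Local Notation Rn := 'rV[R]_n.
Local Notation mu := (@lebesgue_rV R n).
Implicit Types (a x y : Rn) (l r c t e : R) (u w z V f g H : Rn -> R).

(** A substitute for Hoelder's inequality: the exponents add up to at most one, so
    the integrand is at most [1 + H / A + z / avg z] after normalization. *)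
Lemma local_bound H z x r (A p b : R) : nnmeas H -> strict_weight z -> 0 < r -> 0 < A ->
  0 <= p -> 0 <= b -> p + b <= 1 ->
  (wmeasure H (sball x r) <= (A * (2 * r) ^+ n)%:E)%E ->
  (wmeasure (fun y => H y `^ p * z y `^ b)%R (sball x r) <=
   (3 * (2 * r) ^+ n * (A `^ p * (mass z (sball x r) / (2 * r) ^+ n) `^ b))%:E)%E.
Proof.
move=> hH hz r0 A0 p0 b0 pb HA.
have mB := @measurable_sball R n x r.
have P0 : 0 < (2 * r) ^+ n by rewrite exprn_gt0// mulr_gt0.
set P := (2 * r) ^+ n in P0 HA *.
have Z0 : 0 < mass z (sball x r) by apply: mass_gt0 => //; rewrite mulr_gt0.
set av := mass z (sball x r) / P; have av0 : 0 < av by rewrite divr_gt0.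
have nz := strict_weight_nnmeas hz.
set k := A `^ p * av `^ b; have k0 : 0 <= k by rewrite mulr_ge0 ?powR_ge0.
have n1 : nnmeas (fun y => A^-1 * H y) by apply: nnmeasZ => //; rewrite invr_ge0 ltW.
have n2 : nnmeas (fun y => av^-1 * z y) by apply: nnmeasZ => //; rewrite invr_ge0 ltW.
have n3 : nnmeas (fun y => 1 + A^-1 * H y + av^-1 * z y).
  by apply: nnmeasD => //; apply: nnmeasD => //; exact: nnmeas_cst.
have n4 : nnmeas (fun y => 1 + A^-1 * H y) by apply: nnmeasD => //; exact: nnmeas_cst.
apply: (@le_trans _ _ (wmeasure (fun y => k * (1 + A^-1 * H y + av^-1 * z y))%R (sball x r))).
  apply: le_wmeasure => //; first by apply: nnmeasM; exact: nnmeas_powR.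
    exact: nnmeasZ.
  move=> y _; have [_ /(_ y) Hy] := hH; have [_ /(_ y) zy _] := hz.
  have i1 : 0 <= A^-1 * H y by exact: (proj2 n1).
  have i2 : 0 <= av^-1 * z y by exact: (proj2 n2).
  have := powR_mul_le i1 i2 p0 b0 pb; move/(ler_wpM2l k0); apply: le_trans.
  rewrite le_eqVlt; apply/orP; left; apply/eqP.
  rewrite {1}(_ : H y = A * (A^-1 * H y)); last by rewrite mulrA mulfV ?gt_eqF// mul1r.
  rewrite {1}(_ : z y = av * (av^-1 * z y)); last by rewrite mulrA mulfV ?gt_eqF// mul1r.
  by rewrite (powRM _ (ltW A0) i1) (powRM _ (ltW av0) i2) /k; ring.
rewrite wmeasureZ// (wmeasureD n4 n2 mB) (wmeasureD (nnmeas_cst ler01) n1 mB).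
rewrite wmeasure_cst// !wmeasureZ ?invr_ge0 ?(ltW A0) ?(ltW av0)// mul1e mu_sball ?(ltW r0)//.
rewrite -/P (massE _ _ hz) -/(sball x r).
have -> : 3 * P * k = k * (P + A^-1 * (A * P) + av^-1 * mass z (sball x r)).
  by rewrite [A^-1 * _]mulrA mulVf ?gt_eqF// /av invf_div divfK ?gt_eqF//; ring.
rewrite [leRHS]EFinM; apply: lee_wpmul2l; first by rewrite lee_fin.
rewrite !EFinD; apply: leeD; last by rewrite -EFinM.
by rewrite [(A^-1 * _)%:E]EFinM; apply: leeD => //; apply: lee_wpmul2l => //;
  rewrite lee_fin invr_ge0 ltW.
Qed.

(** Large scales are controlled by the total mass [N], small ones by the potential;
    the geometric growth of [u (sball x r)] makes the sum over dyadic radii comparable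
    to the value at the scale where both bounds agree. *)
Lemma hedberg (hn : (0 < n)%N) u z C p b gam kap :
  strict_weight u -> A1_const C u -> strict_weight z -> A1_const C z ->
  1 <= C -> 1 <= p -> 0 <= b -> p^-1 + b <= 1 -> 0 < gam -> gam < 1 -> 0 < kap ->
  exists2 K, 0 < K & forall H (N : R), nnmeas H -> 0 < N ->
   (wmeasure (fun x => H x * u x `^ gam)%R setT <= N%:E)%E ->
   {ae mu, forall x, forall I : R, 0 < I -> (potential u gam kap H x <= I%:E)%E ->
     (\sum_(j <oo) (dyadic j `^ (n%:R * ((1 - gam) / p) - n%:R))%:E *
        wmeasure (fun y => H y `^ p^-1 * z y `^ b)%R (sball x (dyadic j)) <=
     (K * z x `^ b * (N `^ kap * I `^ gam) `^ (p * (gam + kap))^-1)%:E)%E}.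
Proof.
move=> hu hCu hz hCz C1 p1 b0 pb g0 g1 k0.
have C0 : 0 < C := lt_le_trans ltr01 C1.
have p0 : 0 < p := lt_le_trans ltr01 p1.
have sig0 : 0 < gam + kap by rewrite addr_gt0.
set q := (p * (gam + kap))^-1.
pose ga := gam / p; pose ka := kap / p.
have ga0 : 0 < ga by rewrite divr_gt0.
have ka0 : 0 < ka by rewrite divr_gt0.
pose e := Num.min ka ga; have e0 : 0 < e by rewrite lt_min ka0.
pose k := (C * 8 ^+ n)^-1; have kk0 : 0 < k by rewrite invr_gt0 mulr_gt0// exprn_gt0.
pose K1 := 3 * C * C `^ b * 2 `^ n%:R.
have K10 : 0 < K1 by rewrite !mulr_gt0 ?powR_gt0.
pose K2 := 4 * (1 + k) `^ e / ((1 + k) `^ e - 1).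
have K20 : 0 < K2.
  have : 0 < (1 + k) `^ e - 1.
    rewrite subr_gt0 /powR gt_eqF ?ltr_wpDr ?(ltW kk0)//.
    by rewrite expR_gt1 mulr_gt0// ln_gt0//; lra.
  by move=> ?; rewrite divr_gt0// mulr_gt0// powR_gt0//; lra.
exists (K1 * K2); first by rewrite mulr_gt0.
move=> H N hH N0 HN; have [c CE] := expR_lnE C0.
have c0 : 0 <= c by rewrite -ler_expR expR0 -CE.
apply: filterS hCz => x Hx I I0 HI.
have [_ z0 _] := hz; have [_ u0 _] := hu.
have nu := strict_weight_nnmeas hu.
have [nn nE] := expR_lnE N0; have [ii iE] := expR_lnE I0.
have nHz : nnmeas (fun y => H y `^ p^-1 * z y `^ b).
  by apply: nnmeasM; apply: nnmeas_powR => //; exact: strict_weight_nnmeas.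
have nHu : nnmeas (fun x => H x * u x `^ gam).
  by apply: nnmeasM => //; exact: nnmeas_powR.
(* the [u]-mass at the scale where the two bounds [b1] and [b2] below agree *)
pose W := expR ((nn - ii) / (gam + kap)).
have LE : (N `^ kap * I `^ gam) `^ q = expR (q * (kap * nn + gam * ii)).
  by rewrite nE iE !expR_powR -expRD expR_powR.
set L := q * _ in LE.
have KL0 : 0 <= K1 * z x `^ b * expR L.
  apply: mulr_ge0; last exact: expR_ge0.
  by apply: mulr_ge0; [exact: ltW|exact: powR_ge0].
rewrite LE (_ : K1 * K2 * z x `^ b * expR L = (K1 * z x `^ b * expR L) * K2); last by ring.
apply: (nneseries_lacunary (X := fun r => mass u (sball x r) / W)) kk0 e0 _ _ _ _ _.
- exact: KL0.
- by move=> r r0; rewrite divr_gt0 ?expR_gt0// mass_gt0// mulr_gt0.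
- move=> r r0; rewrite mulrA ler_pM2r ?invr_gt0 ?expR_gt0//.
  exact: A1_reverse_doubling.
- by move=> j; rewrite mule_ge0 ?wmeasure_ge0// lee_fin powR_ge0.
move=> j; set r := dyadic j; have r0 : 0 < r by exact: dyadic_gt0.
have r20 : 0 < 2 * r by rewrite mulr_gt0.
have P0 : 0 < (2 * r) ^+ n by rewrite exprn_gt0.
have U0 : 0 < mass u (sball x r) by exact: mass_gt0.
have [rr rE] := expR_lnE r20; have [mm mE] := expR_lnE U0.
have PE : (2 * r) ^+ n = expR (n%:R * rr) by rewrite rE -expRM_natl.
set pp := n%:R * rr in PE.
have mB := @measurable_sball R n x r.
(* by the lower bound for [u] on the ball, from its A1 condition *)
have b1 : (wmeasure H (sball x r) <= (expR (gam * (c + pp - mm) + nn))%:E)%E.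
  apply: (@le_trans _ _ (wmeasure (fun y => expR (gam * (c + pp - mm)) *
      (H y * u y `^ gam))%R (sball x r))).
    apply: le_wmeasure_ae => //; first by apply: nnmeasZ => //; exact: expR_ge0.
    apply: filterS hCu => y Hy By; have := Hy _ _ r20 By.
    rewrite massE// lee_fin -/(sball x r) => Uy.
    rewrite mulrCA -[leLHS]mulr1; apply: ler_wpM2l; first exact: (proj2 hH).
    have [uy uE] := expR_lnE (u0 y).
    move: Uy; rewrite mE CE PE uE expR_powR -!expRD ler_expR => Uy.
    rewrite -[leLHS]expR0 ler_expR.
    by have := ler_wpM2l (ltW g0) Uy; lra.
  rewrite wmeasureZ ?expR_ge0// expRD EFinM; apply: lee_wpmul2l.
    by rewrite lee_fin expR_ge0.
  by rewrite -nE; apply: le_trans HN; exact: wmeasure_subset.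
(* by keeping one term of the potential *)
have b2 : (wmeasure H (sball x r) <= (expR (gam * pp + kap * mm + ii))%:E)%E.
  have term_ge0 i : (0 <= (coef u gam kap i x)%:E * wmeasure H (sball x (dyadic i)))%E.
    apply: mule_ge0; last exact: wmeasure_ge0.
    by rewrite lee_fin; exact: (proj2 (nnmeas_coef gam kap i nu) x).
  have cf0 : 0 < coef u gam kap j x by rewrite mulr_gt0 ?powR_gt0.
  have : ((coef u gam kap j x)%:E * wmeasure H (sball x r) <= I%:E)%E.
    apply: le_trans HI; rewrite /potential (nneseriesD1 (n := j))//.
      by rewrite leeDl//; apply: nneseries_ge0 => i _ _; exact: term_ge0.
  rewrite -lee_pdivlMl// -EFinM => h; apply: le_trans h _.
  rewrite lee_fin /coef -/r mE PE iE !expR_powR -expRD -expRN -expRD ler_expR.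
  lra.
have term (B : R) : (wmeasure H (sball x r) <= (expR (c + B + pp))%:E)%E ->
    ((r `^ (n%:R * ((1 - gam) / p) - n%:R))%:E *
      wmeasure (fun y => (H y `^ p^-1 * z y `^ b)%R) (sball x r) <=
     (K1 * z x `^ b * expR (p^-1 * (B + (1 - gam) * pp)))%:E)%E.
  move=> hB.
  have h : (wmeasure (fun y => (H y `^ p^-1 * z y `^ b)%R) (sball x r) <=
      (3 * (2 * r) ^+ n * (expR (c + B) `^ p^-1 * (C * z x) `^ b))%:E)%E.
    apply: (le_trans (@local_bound H z x r (expR (c + B)) p^-1 b hH hz r0
      (expR_gt0 _) _ b0 pb _)).
    - by rewrite invr_ge0 ltW.
    - by rewrite PE -expRD.
    rewrite lee_fin; apply: ler_wpM2l; first by rewrite mulr_ge0 ?(ltW P0).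
    apply: ler_wpM2l; first exact: powR_ge0.
    have Z0 : 0 < mass z (sball x r) by exact: mass_gt0.
    apply: powR_homo => //; first by rewrite divr_ge0 ?ltW.
    have := Hx _ _ r20 (sball_center x (ltW r0)).
    by rewrite massE// lee_fin -/(sball x r) ler_pdivrMr// mulrAC.
  apply: le_trans (lee_wpmul2l _ h) _; first by rewrite lee_fin powR_ge0.
  rewrite -EFinM lee_fin.
  have zb0 : 0 <= z x `^ b by exact: powR_ge0.
  have al0 : 0 <= (1 - gam) / p by rewrite divr_ge0 ?subr_ge0 ?ltW.
  rewrite (powRM _ (ltW C0) (ltW (z0 x))) PE.
  have rp : r `^ (n%:R * ((1 - gam) / p) - n%:R) <=
      2 `^ n%:R * expR ((n%:R * ((1 - gam) / p) - n%:R) * rr).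
    rewrite -expR_powR -rE {1}(_ : r = 2^-1 * (2 * r)); last by field.
    rewrite [leLHS]powRM ?(ltW r20)// ler_pM2r ?powR_gt0//.
    rewrite -powR_inv1// -powRrM ler_powR ?ler1n//.
    have : 0 <= n%:R * ((1 - gam) / p) by rewrite mulr_ge0.
    lra.
  apply: le_trans (ler_wpM2r _ rp) _.
    by rewrite !mulr_ge0 ?powR_ge0 ?expR_ge0.
  have cp : expR (c + B) `^ p^-1 <= C * expR (p^-1 * B).
    rewrite expR_powR CE -expRD ler_expR mulrDr lerD2r ler_piMl// invf_le1//.
  rewrite /K1.
  apply: (@le_trans _ _ (2 `^ n%:R * expR ((n%:R * ((1 - gam) / p) - n%:R) * rr) *
      (3 * expR pp * (C * expR (p^-1 * B) * (C `^ b * z x `^ b))))).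
    apply: ler_wpM2l; first by rewrite mulr_ge0 ?powR_ge0 ?expR_ge0.
    apply: ler_wpM2l; first by rewrite mulr_ge0 ?expR_ge0.
    by apply: ler_wpM2r => //; rewrite mulr_ge0 ?powR_ge0.
  rewrite [leLHS](_ : _ = 3 * C * C `^ b * 2 `^ n%:R * z x `^ b *
    (expR ((n%:R * ((1 - gam) / p) - n%:R) * rr) * expR pp * expR (p^-1 * B))); last by ring.
  rewrite -!expRD; apply: ler_wpM2l; last by rewrite ler_expR /pp; lra.
  by rewrite !mulr_ge0 ?powR_ge0 ?(ltW C0).
pose xx := mm - (nn - ii) / (gam + kap).
have XE : mass u (sball x r) / W = expR xx by rewrite mE /W -expRN -expRD.
rewrite XE.
set t := (_ * _)%E in term *.
have t1 : (t <= (K1 * z x `^ b * expR L * expR (- ga * xx))%:E)%E.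
  apply: le_trans (term (gam * pp - gam * mm + nn - pp) _) _.
    apply: (le_trans b1); rewrite lee_fin ler_expR.
    have : gam * c <= c by rewrite ler_piMl// ltW.
    lra.
  rewrite lee_fin -[leRHS]mulrA -expRD le_eqVlt; apply/orP; left; apply/eqP.
  congr (_ * expR _); rewrite /L /q /xx /ga; field.
  by rewrite !gt_eqF.
have t2 : (t <= (K1 * z x `^ b * expR L * expR (ka * xx))%:E)%E.
  apply: le_trans (term (gam * pp + kap * mm + ii - pp) _) _.
    by apply: (le_trans b2); rewrite lee_fin ler_expR; lra.
  rewrite lee_fin -[leRHS]mulrA -expRD le_eqVlt; apply/orP; left; apply/eqP.
  congr (_ * expR _); rewrite /L /q /xx /ka; field.
  by rewrite !gt_eqF.
apply: (@le_trans _ _ (K1 * z x `^ b * expR L *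
    Num.min (expR (ka * xx)) (expR (- ga * xx)))%:E).
  by rewrite /Num.min; case: ifP.
by rewrite lee_fin; apply: ler_wpM2l; [exact: KL0|exact: min_expR_le].
Qed.

End pointwise_bound.

(** * Mixed weak-type inequality for the fractional integral *)

Section mixed_weak_type.
Context {R : realType} {n : nat}.
Local Notation Rn := 'rV[R]_n.
Local Notation mu := (@lebesgue_rV R n).
Implicit Types (a x y : Rn) (l r c e : R) (u w z V f g H : Rn -> R) (E : set Rn).

(** Dyadic form of the Riesz potential of order [n (1 - gam) / p]: the average of [f] over
    the ball of radius [r] comes, up to a constant, with the factor [r] to that power. *)
Definition riesz_series (gam p : R) f x : \bar R :=
  (\sum_(j <oo) (dyadic j `^ (n%:R * ((1 - gam) / p) - n%:R))%:E *
     wmeasure f (sball x (dyadic j)))%E.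

Section abstract_weights.
Variables (u V z : Rn -> R) (C p b gam kap : R).
Hypotheses (hn : (0 < n)%N) (hu : strict_weight u) (hCu : A1_const C u) (hV : strict_weight V)
  (hz : strict_weight z) (hCz : A1_const C z) (C1 : 1 <= C) (p1 : 1 <= p) (b0 : 0 <= b)
  (pb : p^-1 + b <= 1) (g0 : 0 < gam) (g1 : gam < 1) (k0 : 0 < kap)
  (gk1 : gam + kap < 1) (htest : testing u V gam kap).

(** On [E] the pointwise bound of [hedberg] forces the potential to be at least [s * V ^
    (gam + kap)] for a suitable [s]; the factor [z ^ b] cancels. The hypothesis of
    [testing_weak_type] is then satisfied, and the powers of [t] and [N] come from [s]. *)
Lemma mixed_weak_type_fin : exists2 K, 0 < K & forall H E (t N : R),
  nnmeas H -> measurable E -> (wmeasure (fun x => u x * V x)%R E < +oo)%E ->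
  0 < t -> 0 < N -> (wmeasure (fun x => H x * u x `^ gam)%R setT <= N%:E)%E ->
  {ae mu, forall x, E x -> ((t * (V x `^ (gam / p) * z x `^ b))%:E <
     riesz_series gam p (fun y => H y `^ p^-1 * z y `^ b)%R x)%E} ->
  mass (fun x => u x * V x) E <= K * t `^ (- (p / gam)) * N `^ gam^-1.
Proof.
have [K1 K10 hed] := hedberg hn hu hCu hz hCz C1 p1 b0 pb g0 g1 k0.
have [K2 K20 wt] := testing_weak_type hu hCu C1 hV g0 k0 gk1 htest.
have sig0 : 0 < gam + kap by rewrite addr_gt0.
have p0 : 0 < p := lt_le_trans ltr01 p1.
exists (K2 `^ (gam + kap)^-1 * K1 `^ (p / gam)).
  by rewrite mulr_gt0 ?powR_gt0.
move=> H E t N hH mE fE t0 N0 HN HE.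
have [a1 K1E] := expR_lnE K10; have [a2 K2E] := expR_lnE K20.
have [tt tE] := expR_lnE t0; have [nn nE] := expR_lnE N0.
(* the logarithm of [s], solved from the equality of the two bounds *)
pose ls := p * (gam + kap) / gam * (tt - a1 - kap / (p * (gam + kap)) * nn).
have weak : expR ls * mass (fun x => u x * V x) E `^ (gam + kap) <= K2 * N.
  apply: (wt H E) => //; [exact: expR_gt0|exact: ltW|].
  apply: filterS2 HE (hed H N hH N0 HN) => x HEx hedx Ex.
  rewrite leNgt; apply/negP => pot; have := HEx Ex; apply/negP; rewrite -leNgt.
  have [_ /(_ x) V0 _] := hV; have [_ /(_ x) z0 _] := hz.
  have [vv vE] := expR_lnE V0.
  have I0 : 0 < expR ls * V x `^ (gam + kap) by rewrite mulr_gt0 ?expR_gt0 ?powR_gt0.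
  apply: le_trans (hedx _ I0 (ltW pot)) _.
  rewrite lee_fin.
  rewrite (_ : K1 * z x `^ b * _ = K1 * (N `^ kap *
    (expR ls * V x `^ (gam + kap)) `^ gam) `^ (p * (gam + kap))^-1 * z x `^ b); last by ring.
  rewrite [leRHS]mulrA ler_pM2r ?powR_gt0//.
  rewrite nE vE K1E tE !expR_powR -!expRD !expR_powR -!expRD !expR_powR -!expRD.
  rewrite ler_expR.
  rewrite le_eqVlt; apply/orP; left; apply/eqP; rewrite /ls; field.
  by rewrite !gt_eqF.
have M0 : 0 <= mass (fun x => u x * V x) E by apply: mass_ge0; exact: nnmeas_strictM.
move: M0; rewrite le_eqVlt => /orP[/eqP <-|M0].
  by rewrite !mulr_ge0 ?powR_ge0.
have [m mE'] := expR_lnE M0.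
move: weak; rewrite mE' K2E nE K1E tE !expR_powR -!expRD !ler_expR => weak.
have is0 : 0 < (gam + kap)^-1 by rewrite invr_gt0.
have := ler_wpM2l (ltW is0) weak; rewrite mulrDr mulKf ?gt_eqF// => mle.
apply: (@le_trans _ _ ((gam + kap)^-1 * (a2 + nn) - (gam + kap)^-1 * ls)).
  lra.
rewrite le_eqVlt; apply/orP; left; apply/eqP; rewrite /ls; field.
by rewrite !gt_eqF.
Qed.

Let truncation E (i : nat) := E `&` [set x | V x <= i%:R] `&` sball 0 i%:R.

Lemma wmeasure_strictM_bounded E (i : nat) : measurable E ->
  (wmeasure (fun x => u x * V x)%R (truncation E i) < +oo)%E.
Proof.
move=> mE; have nuV := nnmeas_strictM hu hV.
have mS : measurable (E `&` [set x | V x <= i%:R]).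
  by apply: measurableI => //; apply: measurable_sublevel; case: hV.
have mB := @measurable_sball R n 0 i%:R.
have mT : measurable (truncation E i) by exact: measurableI.
have niu : nnmeas (fun x => i%:R * u x) by apply: nnmeasZ => //; exact: strict_weight_nnmeas.
apply: (@le_lt_trans _ _ (wmeasure (fun x => i%:R * u x)%R (sball 0 i%:R))).
  apply: le_trans (wmeasure_subset niu mT mB (@subIsetr _ _ _)).
  apply: le_wmeasure => // x [[_ /= Vi] _].
  by rewrite mulrC ler_pM2r//; case: hu => _ /(_ x).
rewrite (wmeasureZ (ler0n _ i) (strict_weight_nnmeas hu) mB).
by case: hu => _ _ fin; apply: lte_mul_pinfty => //; exact: fin.
Qed.

(** The finiteness of the mass of [E] is removed by exhausting [E] with bounded sets on which
    [V] is bounded, and the right-hand side may be zero or infinite. *)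
Lemma mixed_weak_type : exists2 K, 0 < K & forall H E (t : R),
  nnmeas H -> measurable E -> 0 < t ->
  {ae mu, forall x, E x -> ((t * (V x `^ (gam / p) * z x `^ b))%:E <
     riesz_series gam p (fun y => H y `^ p^-1 * z y `^ b)%R x)%E} ->
  (wmeasure (fun x => u x * V x)%R E <= (K * t `^ (- (p / gam)))%:E *
     wmeasure (fun x => H x * u x `^ gam)%R setT `^ gam^-1)%E.
Proof.
have [K K0 HK] := mixed_weak_type_fin; exists K => // H E t hH mE t0 HE.
have nuV := nnmeas_strictM hu hV.
have ig0 : 0 < gam^-1 by rewrite invr_gt0.
have c0 : 0 < K * t `^ (- (p / gam)) by rewrite mulr_gt0// powR_gt0.
have nHu : nnmeas (fun x => H x * u x `^ gam).
  by apply: nnmeasM => //; apply: nnmeas_powR; exact: strict_weight_nnmeas.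
pose F := truncation E.
have mF i : measurable (F i).
  apply: measurableI; last exact: measurable_sball.
  by apply: measurableI => //; apply: measurable_sublevel; case: hV.
have FE i : {ae mu, forall x, F i x -> ((t * (V x `^ (gam / p) * z x `^ b))%:E <
     riesz_series gam p (fun y => H y `^ p^-1 * z y `^ b)%R x)%E}.
  by apply: filterS HE => x Hx [[Ex _] _]; exact: Hx.
have main i (N : R) : 0 < N -> (wmeasure (fun x => H x * u x `^ gam)%R setT <= N%:E)%E ->
    (wmeasure (fun x => u x * V x)%R (F i) <= (K * t `^ (- (p / gam)) * N `^ gam^-1)%:E)%E.
  move=> N0 HN; have fin := wmeasure_strictM_bounded i mE.
  rewrite -[leLHS]fineK ?ge0_fin_numE ?wmeasure_ge0// lee_fin.
  exact: HK (FE i).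
have EF : E = \bigcup_i F i.
  apply/seteqP; split => x; last by move=> [i _ [[]]].
  move=> Ex; pose B := V x + \sum_(j < n) `|x ord0 j|.
  have Vx0 : 0 <= V x by case: hV => _ /(_ x)/ltW.
  have B0 : 0 <= B by rewrite addr_ge0// sumr_ge0.
  have := archi_boundP B0; set i := Num.bound B => /ltW Bi.
  exists i => //; split; first split => //=.
    by apply: le_trans Bi; rewrite lerDl sumr_ge0.
  apply/sballP => j; rewrite mxE sub0r normrN; apply: le_trans Bi.
  rewrite /B (bigD1 j)//= addrCA lerDl addr_ge0// sumr_ge0//.
rewrite [X in wmeasure _ X]EF; apply: wmeasure_bigcup_le => //.
  move=> i j ij; apply/subsetPset => x [[Ex /= Vi] Bi]; split; first split => //=.
    by apply: (le_trans Vi); rewrite ler_nat.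
  by apply: subset_sball Bi; rewrite ler_nat.
move=> i; have W0 := wmeasure_ge0 setT nHu.
have [Woo|Wfin] := eqVneq (wmeasure (fun x => H x * u x `^ gam)%R setT) +oo%E.
  by rewrite Woo poweRyr ?gt_eqF// gt0_muley ?leey// lte_fin.
have := W0; rewrite le_eqVlt => /orP[/eqP Wz|Wpos].
  rewrite -Wz poweR0r ?gt_eqF// mule0; apply/lee_addgt0Pr => d d0; rewrite add0e.
  pose N := (d / (K * t `^ (- (p / gam)))) `^ gam.
  have dc0 : 0 < d / (K * t `^ (- (p / gam))) by rewrite divr_gt0.
  have N0 : 0 < N by rewrite powR_gt0.
  apply: le_trans (main i N N0 _) _; first by rewrite -Wz lee_fin ltW.
  rewrite lee_fin /N -powRrM mulfV ?gt_eqF// powRr1 ?(ltW dc0)//.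
  by rewrite mulrC divfK// gt_eqF.
have Wf : wmeasure (fun x => H x * u x `^ gam)%R setT \is a fin_num.
  by rewrite ge0_fin_numE// lt_neqAle Wfin leey.
rewrite -(fineK Wf) poweR_EFin -EFinM; apply: main; last by rewrite fineK.
by rewrite fine_gt0// Wpos ltey.
Qed.

End abstract_weights.
End mixed_weak_type.

(** * The commutator as an integral operator *)

Section commutators.
Context {R : realType} {n : nat}.
Local Notation Rn := 'rV[R]_n.
Local Notation mu := (@lebesgue_rV R n).
Local Notation operator := ({mfun Rn >-> R} -> {mfun Rn >-> R}).
Implicit Types (x y : Rn) (f g b : {mfun Rn >-> R}).

Lemma mfun_mulE f g x : (f * g) x = f x * g x. Proof. by []. Qed.

Lemma coord_le_enorm x i : `|x ord0 i| <= enorm x.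
Proof.
rewrite /enorm -sqrtr_sqr ler_wsqrtr// (bigD1 i)//= lerDl sumr_ge0// => j _.
exact: sqr_ge0.
Qed.

Lemma enorm_le_bound x (M : R) : (forall i, `|x ord0 i| <= M) ->
  enorm x <= Num.sqrt (\sum_(i < n) M ^+ 2).
Proof.
move=> H; rewrite /enorm ler_wsqrtr// ler_sum// => i _.
by rewrite -real_normK ?num_real// lerXn2r ?nnegrE// (le_trans _ (H i)).
Qed.

Lemma enorm_gt0 x : x != 0 -> 0 < enorm x.
Proof.
move=> x0; have [i xi] : exists i, x ord0 i != 0.
  apply/existsP; rewrite -negb_forall; apply: contra x0 => /forallP H.
  by apply/eqP/rowP => i; rewrite mxE; exact/eqP/H.
by apply: lt_le_trans (coord_le_enorm x i); rewrite normr_gt0.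
Qed.

(** The infimum that defines the norm is attained, because the inequality for a given pair of
    points is a closed condition on the constant. *)
Lemma lipschitz_Lambda_norm delta b : Lambda delta b -> 0 < delta ->
  lipschitz_bound delta b (Lambda_norm delta b).
Proof.
move=> [_ [C C0 HC]] d0 x y.
have [e0|e0] := eqVneq (enorm (x - y) `^ delta) 0.
  by have := HC x y; rewrite e0 !mulr0.
have ep : 0 < enorm (x - y) `^ delta by rewrite lt_neqAle eq_sym e0 powR_ge0.
rewrite -ler_pdivrMr//; apply: lb_le_inf; first by exists C.
by move=> D [D0 HD]; rewrite ler_pdivrMr//; exact: HD.
Qed.

Lemma Lambda_norm_ge0 delta b : Lambda delta b -> 0 <= Lambda_norm delta b.
Proof.
move=> [_ [C C0 HC]]; apply: lb_le_inf; first by exists C.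
by move=> D [/ltW].
Qed.

Lemma compact_sub_sball (A : set Rn) : compact A -> exists M : R, A `<=` sball 0 M.
Proof.
move=> /compact_bounded[M [_ HM]]; exists (M + 1) => x Ax.
apply/sballP => i; rewrite mxE sub0r normrN.
apply: le_trans (HM (M + 1) _ x Ax); last by rewrite ltrDl.
rewrite [leRHS]mx_normrE.
exact: (le_bigmax _ (fun ij : 'I_1 * 'I_n => `|x ij.1 ij.2|) (ord0, i)).
Qed.

(** This class contains [f * v] and is stable under multiplication by [b], hence contains
    all functions to which the operator is applied when the commutators are unfolded. *)
Definition admissible g := mu.-integrable setT (EFin \o g) /\ compact_support g.

Lemma compact_support_sub f g : compact_support f ->
  (forall x, f x = 0 -> g x = 0) -> compact_support g.
Proof.
move=> cf fg; apply: (subclosed_compact (@closed_closure _ _) cf).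
by apply: closure_subset => x /=; apply: contra_neq; exact: fg.
Qed.

Lemma bounded_Lambda delta b (M : R) : Lambda delta b -> 0 < delta ->
  exists B, forall x, sball 0 M x -> `|b x| <= B.
Proof.
move=> hb d0; have [_ [C C0 HC]] := hb.
exists (`|b 0| + C * Num.sqrt (\sum_(i < n) M ^+ 2) `^ delta) => x /sballP xM.
have xM' i : `|x ord0 i| <= M by have := xM i; rewrite mxE sub0r normrN.
rewrite -(subrK (b 0) (b x)) addrC (le_trans (ler_normD _ _))// lerD2l.
apply: (le_trans (HC x 0)); rewrite subr0 ler_wpM2l ?(ltW C0)//.
by apply: powR_homo; [exact: ltW|exact: sqrtr_ge0|exact: enorm_le_bound].
Qed.

Lemma admissible_mulb delta b g : Lambda delta b -> 0 < delta -> admissible g -> admissible (b * g).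
Proof.
move=> hb d0 [ig cg]; split; last first.
  by apply: (compact_support_sub cg) => x gx0; rewrite mfun_mulE gx0 mulr0.
have [M gM] := compact_sub_sball cg.
have [B bB] := bounded_Lambda M hb d0.
apply: (le_integrable measurableT (g := fun x => (B%:E * (EFin \o g) x)%E)).
- by apply/measurable_EFinP.
- move=> x _; change (`|(b x * g x)%:E| <= `|(B * g x)%:E|)%E.
  rewrite !abse_EFin lee_fin !normrM.
  have [->|gx0] := eqVneq (g x) 0; first by rewrite normr0 !mulr0.
  rewrite ler_wpM2r// (le_trans (bB x _)) ?ler_norm//.
  by apply: gM; apply: subset_closure.
- exact: integrableZl.
Qed.

Section representation.
Variables (K : Rn -> R) (T : operator) (delta : R) (b : {mfun Rn >-> R}).
Hypotheses (hK : standard_kernel K) (hrep : everywhere_represented K T)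
  (d0 : 0 < delta) (hb : Lambda delta b).

Lemma measurable_kernel : measurable_fun setT K.
Proof.
have [mK _] := hK; have E : [set: Rn] = [set~ 0] `|` [set 0].
  by rewrite setUC setUv.
have m1 : measurable ([set 0] : set Rn).
  rewrite (_ : [set 0] = cube (0 : Rn) 0); first exact: measurable_cube.
  apply/seteqP; split => x /=; first by move=> ->; apply/cubeP => i; rewrite !mxE addr0 lexx.
  move/cubeP => H; apply/rowP => i; apply/eqP; rewrite eq_le mxE.
  by have := H i; rewrite mxE addr0 andbC.
rewrite E; apply/measurable_funU => //; first exact: measurableC.
by split => //; exact: measurable_fun_set1.
Qed.

Lemma measurable_translated_kernel x : measurable_fun setT (fun y => K (x - y)).
Proof.
apply: (measurableT_comp measurable_kernel).
apply: measurable_fun_rV => i; under eq_fun do rewrite !mxE.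
by apply: measurable_funB => //; exact: measurable_coor.
Qed.

Let ker j x g y := (b x - b y) ^+ j * K (x - y) * g y.

Lemma measurable_commutator_kernel j x g : measurable_fun setT (ker j x g).
Proof.
apply: measurable_funM => //; apply: measurable_funM.
  by apply: measurable_funX; apply: measurable_funB.
exact: measurable_translated_kernel.
Qed.

(** The identity is the expected one, but its inductive proof has to carry the
    absolute convergence of the integrals, which is what makes the difference of two
    of them meaningful. *)
Lemma iter_commutator_formula j g : admissible g -> {ae mu, forall x,
  mu.-integrable setT (EFin \o ker j x g) /\
  (iter_commutator j b T g x)%:E = (\int[mu]_y (ker j x g y)%:E)%E}.
Proof.
elim: j g => [|j IH] g hg.
  have [ig cg] := hg; apply: filterS (hrep ig cg) => x; rewrite /kernel_formula => Tx.
  have E : (\int[mu]_y (ker 0 x g y)%:E = \int[mu]_y (K (x - y) * g y)%:E)%E.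
    by apply: eq_integral => y _; rewrite /ker expr0 mul1r.
  split; last by rewrite E.
  apply/integrableP; split.
    by apply/measurable_EFinP; exact: measurable_commutator_kernel.
  rewrite (integral_fin_num_abs _ measurableT); last exact: measurable_commutator_kernel.
  by rewrite E -Tx.
apply: filterS2 (IH g hg) (IH (b * g) (admissible_mulb hb d0 hg)) => x [i1 e1] [i2 e2].
have kE y : ker j.+1 x g y = b x * ker j x g y - ker j x (b * g) y.
  by rewrite /ker mfun_mulE exprS; ring.
have i3 : mu.-integrable setT (EFin \o (fun y => b x * ker j x g y)).
  by have := integrableZl measurableT (b x) i1; apply: eq_integrable.
have FE : EFin \o ker j.+1 x g =
    ((EFin \o (fun y => b x * ker j x g y)%R) \- (EFin \o ker j x (b * g)%R))%E.
  by apply/funext => y /=; rewrite kE EFinB.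
split; first by rewrite FE; exact: integrableB.
transitivity (\int[mu]_y ((b x * ker j x g y)%:E - (ker j x (b * g) y)%:E))%E; last first.
  by apply: eq_integral => y _; rewrite kE EFinB.
rewrite integralB_EFin// -e2.
under eq_integral do rewrite EFinM.
rewrite integralZl// -e1 -EFinM -EFinB; congr (_%:E).
Qed.

Lemma iter_commutator_le j g : admissible g -> {ae mu, forall x,
  (`|iter_commutator j b T g x|%:E <= \int[mu]_y `|(ker j x g y)%:E|)%E}.
Proof.
move=> hg; apply: filterS (iter_commutator_formula j hg) => x [i1 e1].
rewrite -abse_EFin e1; apply: le_abse_integral => //.
by apply/measurable_EFinP; exact: measurable_commutator_kernel.
Qed.

End representation.
End commutators.

(** * Both cases reduced to the mixed inequality *)

Section assembly.
Context {R : realType} {n : nat}.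
Local Notation Rn := 'rV[R]_n.
Local Notation mu := (@lebesgue_rV R n).
Implicit Types (x y : Rn) (f u v : Rn -> R).

(** For [y != x] let [r] be the dyadic radius with [|x - y| <= r < 2 |x - y|]. Then [y] is in
    the ball of radius [r], and this single term of the series already bounds the kernel at
    [y]; the diagonal is a null set. *)
Lemma integral_kernel_le (hn : (0 < n)%N) (al c : R) (k : Rn -> R) (h : Rn -> R) x :
  0 <= al -> 0 <= c -> measurable_fun setT k -> nnmeas h ->
  (forall y, x != y ->
     `|k y| <= c * (enorm (x - y) `^ al / enorm (x - y) ^+ n) * h y) ->
  al <= n%:R ->
  (\int[mu]_y `|(k y)%:E| <= (c * 2 `^ n%:R)%:E *
    \sum_(j <oo) (dyadic j `^ (al - n%:R))%:E * wmeasure h (sball x (dyadic j)))%E.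
Proof.
move=> al0 c0 mk hh kh aln.
pose t (j : nat) y := dyadic j `^ (al - n%:R) * (\1_(sball x (dyadic j)) y * h y).
have nt j : nnmeas (t j).
  apply: nnmeasZ; first exact: powR_ge0.
  by apply: nnmeasM => //; apply: nnmeas_indic; exact: measurable_sball.
have c20 : 0 <= c * 2 `^ n%:R by rewrite mulr_ge0 ?powR_ge0.
have -> : (\sum_(j <oo) (dyadic j `^ (al - n%:R))%:E * wmeasure h (sball x (dyadic j)) =
    \int[mu]_y (\sum_(j <oo) (t j y)%:E))%E.
  rewrite integral_nneseries//; last 2 first.
  - by move=> j; apply: nnmeas_EFin.
  - by move=> j y _; rewrite lee_fin; exact: (proj2 (nt j)).
  apply: eq_eseriesr => j _.
  rewrite -[RHS]/(wmeasure (t j) setT) wmeasureZ ?powR_ge0//; last first.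
    by apply: nnmeasM => //; apply: nnmeas_indic; exact: measurable_sball.
  by rewrite wmeasure_indicM//; exact: measurable_sball.
have mS : measurable_fun setT (fun y => \sum_(j <oo) (t j y)%:E)%E.
  apply: ge0_emeasurable_sum => [j y _ _|j _]; last exact: nnmeas_EFin.
  by rewrite lee_fin; exact: (proj2 (nt j)).
have S0 y : (0 <= \sum_(j <oo) (t j y)%:E)%E.
  by apply: nneseries_ge0 => j _ _; rewrite lee_fin; exact: (proj2 (nt j)).
rewrite -ge0_integralZl_EFin//.
apply: ae_ge0_le_integral => //.
- by apply: measurableT_comp => //; exact/measurable_EFinP.
- by move=> y _; rewrite mule_ge0.
- by apply: emeasurable_funM => //; exact: measurable_cst.
exists (cube x 0); split.
- exact: measurable_cube.
- by rewrite [LHS](mu_cube x (lexx 0)) expr0n gtn_eqF.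
move=> y /= /not_implyP[_ ny]; apply/cubeP => i.
have [<-|xy] := eqVneq x y; first by rewrite addr0 lexx.
exfalso; apply: ny.
have e0 : 0 < enorm (x - y) by apply: enorm_gt0; rewrite subr_eq0.
have [j /andP[ej je]] := dyadic_find e0.
have yB : y \in sball x (dyadic j).
  rewrite inE; apply/sballP => l; apply: le_trans ej.
  by have := coord_le_enorm (x - y) l; rewrite !mxE.
apply: (@le_trans _ _ ((c * 2 `^ n%:R)%:E * (t j y)%:E)%E); last first.
  apply: lee_wpmul2l; first by rewrite lee_fin.
  rewrite (nneseriesD1 (n := j))//; last by move=> i' _; rewrite lee_fin; exact: (proj2 (nt i')).
  rewrite leeDl//; apply: nneseries_ge0 => i' _ _; rewrite lee_fin.
  exact: (proj2 (nt i')).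
change (`|k y|%:E <= (c * 2 `^ n%:R)%:E * (t j y)%:E)%E.
rewrite -EFinM lee_fin /t indicE yB mul1r.
apply: (le_trans (kh y xy)); rewrite [leRHS]mulrA; apply: ler_wpM2r; first exact: (proj2 hh).
rewrite -mulrA; apply: ler_wpM2l => //.
have r0 := @dyadic_gt0 R j.
have [a aE] := expR_lnE e0; have [r rE] := expR_lnE r0.
have [l2 l2E] := expR_lnE (ltr0n R 2).
move: je; rewrite rE aE l2E -expRD ltr_expR => je.
rewrite -expRM_natl -expRN !expR_powR -!expRD ler_expR.
have l20 : 0 <= l2 by rewrite -ler_expR expR0 -l2E ler1n.
have : (n%:R - al) * r <= (n%:R - al) * (l2 + a).
  by apply: ler_wpM2l; [rewrite subr_ge0|exact: ltW].
have : 0 <= al * l2 by rewrite mulr_ge0.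
lra.
Qed.

Definition positive_version (u : Rn -> R) x : R := if 0 < u x then u x else 1.

Local Notation pos := positive_version.

Lemma positive_version_gt0 u x : 0 < pos u x.
Proof. by rewrite /pos; case: ifP. Qed.

Lemma positive_version_ae u : {ae mu, forall x, 0 < u x} -> {ae mu, forall x, u x = pos u x}.
Proof. by apply: filterS => x; rewrite /pos => ->. Qed.

Lemma measurable_positive_version u : measurable_fun setT u -> measurable_fun setT (pos u).
Proof.
move=> mu_; apply: measurable_fun_ifT => //.
by apply: measurable_fun_ltr.
Qed.

Lemma over_conjugateE (q p : R) : 1 <= p -> over_conjugate q p = q * (1 - p^-1).
Proof.
move=> p1; have p0 : 0 < p := lt_le_trans ltr01 p1.
have pn0 : p%:E != 0%E by rewrite eqe gt_eqF.
have := hoelder_conjugate_eq1 (ltNyr p) pn0.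
rewrite /over_conjugate inver gt_eqF//.
case: (hoelder_conjugate p%:E)^-1%E => [c| |]//.
by rewrite -EFinD -EFinM => -[<-] /=; rewrite addrAC subrr add0r.
Qed.

Section cases.
Variables (u v : {mfun Rn >-> R}) (p q : R).
Hypotheses (hn : (0 < n)%N) (p1 : 1 <= p) (pq : p < q) (hu : weight u) (hv : weight v).

Let U := pos u.
Let v' := pos v.
Let gam := p / q.

(** The weights enter the estimate for the commutator only through this inequality. *)
Definition mixed_bound := exists2 K, 0 < K & forall (f : Rn -> R) E (t : R),
  nnmeas f -> measurable E -> 0 < t ->
  {ae mu, forall x, E x -> ((t * v' x)%:E < riesz_series gam p (fun y => f y * v' y)%R x)%E} ->
  (wmeasure (fun x => U x * v' x `^ (q / p))%R E <= (K * t `^ (- q))%:E *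
    wmeasure (fun x => f x `^ p * U x `^ (p / q) * v' x)%R setT `^ (q / p))%E.

Let p0 : 0 < p := lt_le_trans ltr01 p1.
Let q0 : 0 < q := lt_trans p0 pq.
Let gam0 : 0 < gam. Proof. by rewrite divr_gt0. Qed.
Let gam1 : gam < 1. Proof. by rewrite ltr_pdivrMr// mul1r. Qed.
Let mfu : measurable_fun setT u. Proof. by []. Qed.
Let mfv : measurable_fun setT v. Proof. by []. Qed.
Let mU : measurable_fun setT U. Proof. exact: measurable_positive_version. Qed.
Let mv' : measurable_fun setT v'. Proof. exact: measurable_positive_version. Qed.
Let U0 x : 0 < U x. Proof. exact: positive_version_gt0. Qed.
Let v'0 x : 0 < v' x. Proof. exact: positive_version_gt0. Qed.
Let uU : {ae mu, forall x, u x = U x}. Proof. by apply: positive_version_ae; case: hu. Qed.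
Let vv' : {ae mu, forall x, v x = v' x}. Proof. by apply: positive_version_ae; case: hv. Qed.
Let nU : nnmeas U. Proof. by split => // x; exact: ltW. Qed.
Let nv' : nnmeas v'. Proof. by split => // x; exact: ltW. Qed.

(** Dictionary between the original weights and the data of [mixed_weak_type]: the pair
    [U1], [V], the exponent [b] and weight [z], and the substitution for [f]. *)
Lemma mixed_bound_of (U1 V z : Rn -> R) (b : R) (H : (Rn -> R) -> Rn -> R) K :
  0 < K ->
  (forall H E (t : R), nnmeas H -> measurable E -> 0 < t ->
   {ae mu, forall x, E x -> ((t * (V x `^ (gam / p) * z x `^ b))%:E <
     riesz_series gam p (fun y => H y `^ p^-1 * z y `^ b)%R x)%E} ->
   (wmeasure (fun x => U1 x * V x)%R E <= (K * t `^ (- (p / gam)))%:E *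
     wmeasure (fun x => H x * U1 x `^ gam)%R setT `^ gam^-1)%E) ->
  (forall x, V x `^ (gam / p) * z x `^ b = v' x) ->
  (forall x, U1 x * V x = U x * v' x `^ (q / p)) ->
  (forall f, nnmeas f -> nnmeas (H f)) ->
  (forall f x, 0 <= f x -> H f x `^ p^-1 * z x `^ b = f x * v' x) ->
  (forall f x, H f x * U1 x `^ gam = f x `^ p * U x `^ (p / q) * v' x) ->
  mixed_bound.
Proof.
move=> K0 HK e1 e2 nH e3 e4; exists K => // f E t nf mE t0 HE.
have -> : (fun x => U x * v' x `^ (q / p)) = (fun x => U1 x * V x).
  by apply/funext => x; rewrite e2.
have -> : (fun x => f x `^ p * U x `^ (p / q) * v' x) = (fun x => H f x * U1 x `^ gam).
  by apply/funext => x; rewrite e4.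
have qE : q = p / gam by rewrite /gam invf_div mulrC divfK// gt_eqF.
have -> : q / p = gam^-1 by rewrite /gam invf_div.
rewrite {1}qE; apply: HK => //; first exact: nH.
have -> : (fun y => H f y `^ p^-1 * z y `^ b) = (fun y => f y * v' y).
  by apply/funext => y; apply: e3; exact: (proj2 nf).
by apply: filterS HE => x; rewrite e1.
Qed.

(** The exponent [b = (p - 1) / q] makes [V ^ (gam / p) * z ^ b] equal to [v], and
    [p^-1 + b <= 1] holds because [p <= q]. *)
Lemma mixed_bound_A1 : A1 u -> A1 (fun x => v x `^ (q / p)) -> mixed_bound.
Proof.
move=> hA1u hA1v.
have [tU [C1 C11 hC1]] := A1_A1_const hA1u mfu mU U0 uU.
pose V x := v' x `^ (q / p).
have V0 x : 0 < V x by rewrite powR_gt0.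
have mV : measurable_fun setT V by exact: (measurableT_comp (measurable_powR _) mv').
have [tV [C2 C21 hC2]] : strict_weight V /\ exists2 C, 1 <= C & A1_const C V.
  apply: A1_A1_const hA1v _ mV V0 _.
    exact: (measurableT_comp (measurable_powR _) mfv).
  by apply: filterS vv' => x ->.
pose C := Num.max C1 C2.
have C1C : 1 <= C by rewrite le_max C11.
have hCU : A1_const C U by apply: A1_const_le hC1 _ => //; rewrite le_max lexx.
have hCV : A1_const C V by apply: A1_const_le hC2 _ => //; rewrite le_max lexx orbT.
have [kap [k0 gk1 test]] := testing_A1 hn tU hCU tV hCV C1C gam0 gam1.
pose b := (p - 1) / q.
have b0 : 0 <= b by rewrite divr_ge0 ?subr_ge0// ltW.
have pb : p^-1 + b <= 1.
  apply: (@le_trans _ _ (p^-1 + (p - 1) / p)).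
    by rewrite lerD2l ler_wpM2l ?subr_ge0// lef_pV2 ?posrE// ltW.
  by rewrite le_eqVlt; apply/orP; left; apply/eqP; field; rewrite gt_eqF.
have [K K0 HK] := mixed_weak_type hn tU hCU tV tV hCV C1C p1 b0 pb gam0 gam1 k0 gk1 test.
have vE x : exists c, v' x = expR c by exact: expR_lnE.
apply: (@mixed_bound_of U V V b (fun f x => f x `^ p * v' x) K K0 HK).
- move=> x; have [c cE] := vE x; rewrite /V cE !expR_powR -expRD; congr expR.
  by rewrite /gam /b; field; rewrite !gt_eqF.
- by [].
- by move=> f nf; apply: nnmeasM => //; exact: nnmeas_powR.
- move=> f x f0; rewrite powRM ?powR_ge0 ?(ltW (v'0 x))// -powRrM mulfV ?gt_eqF// powRr1//.
  rewrite -mulrA; congr (_ * _); have [c cE] := vE x; rewrite /V cE !expR_powR -expRD.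
  by congr expR; rewrite /b; field; rewrite !gt_eqF.
- by move=> f x; rewrite mulrAC.
Qed.

(** The A1 weight [u v ^ (- q / p')] times [V = v ^ q] is [u v ^ (q / p)], and
    [V ^ (gam / p)] is already [v], so that [z] can be trivial. *)
Lemma mixed_bound_Ainfty :
  let w := fun x => u x * v x `^ (- over_conjugate q p) in
  A1 w -> Ainfty_wrt w (fun x => v x `^ q) -> mixed_bound.
Proof.
move=> w hA1 hAinf; rewrite /w over_conjugateE// in hA1 hAinf.
set o := q * (1 - p^-1) in hA1 hAinf.
pose U1 x := U x * v' x `^ (- o); pose V x := v' x `^ q.
have mu0 : measurable_fun setT (fun x => u x * v x `^ (- o)).
  by apply: measurable_funM => //; exact: (measurableT_comp (measurable_powR _) mfv).
have mV0 : measurable_fun setT (fun x => v x `^ q).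
  exact: (measurableT_comp (measurable_powR _) mfv).
have mU1 : measurable_fun setT U1.
  by apply: measurable_funM => //; exact: (measurableT_comp (measurable_powR _) mv').
have mV : measurable_fun setT V by exact: (measurableT_comp (measurable_powR _) mv').
have U10 x : 0 < U1 x by rewrite mulr_gt0// powR_gt0.
have V0 x : 0 < V x by rewrite powR_gt0.
have ae1 : {ae mu, forall x, u x * v x `^ (- o) = U1 x}.
  by apply: filterS2 uU vv' => x -> ->.
have ae2 : {ae mu, forall x, v x `^ q = V x} by apply: filterS vv' => x ->.
have [tU [C C1 hC]] := A1_A1_const hA1 mu0 mU1 U10 ae1.
have C0 : 0 < C := lt_le_trans ltr01 C1.
have [tV [d [K' npb]]] := Ainfty_negative_power_bound hAinf mu0 mV0 mV ae1 ae2 V0 tU hC C0.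
have [kap [k0 gk1 test]] := testing_Ainfty hn tU hC tV npb C1 gam0 gam1.
have hC1 : A1_const C (@unit_weight R n).
  apply: nearW => y a l l0 _; rewrite wmeasure_cst; last exact: measurable_cube.
  by rewrite mul1e mu_cube ?(ltW l0)// lee_fin mulr1 ler_peMl ?exprn_ge0 ?(ltW l0).
have pb : p^-1 + 0 <= 1 by rewrite addr0 invf_le1.
have [K K0 HK] := mixed_weak_type hn tU hC tV strict_weight_one hC1 C1 p1 (lexx 0) pb gam0 gam1 k0 gk1 test.
have vE x : exists c, v' x = expR c by exact: expR_lnE.
apply: (@mixed_bound_of U1 V unit_weight 0 (fun f x => f x `^ p * v' x `^ p) K K0 HK).
- move=> x; rewrite powRr0 mulr1; have [c cE] := vE x; rewrite /V cE !expR_powR.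
  by congr expR; rewrite /gam; field; rewrite !gt_eqF.
- move=> x; rewrite /U1 /V -mulrA; congr (_ * _); have [c cE] := vE x.
  rewrite cE !expR_powR -expRD; congr expR; rewrite /o; field.
  by rewrite gt_eqF.
- by move=> f nf; apply: nnmeasM; exact: nnmeas_powR.
- move=> f x f0; rewrite powRr0 mulr1 powRM ?powR_ge0// -!powRrM mulfV ?gt_eqF//.
  by rewrite !powRr1// ltW.
- move=> f x; rewrite /U1 powRM ?powR_ge0 ?(ltW (U0 x))// -powRrM.
  rewrite -!mulrA; congr (_ * _); rewrite mulrCA; congr (_ * _).
  have [c cE] := vE x; rewrite cE !expR_powR -expRD; congr expR.
  by rewrite /o /gam; field; rewrite !gt_eqF.
Qed.

End cases.
End assembly.

(** * The weak-type inequality for the commutator *)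

Section operator_bound.
Context {R : realType} {n : nat}.
Local Notation Rn := 'rV[R]_n.
Local Notation mu := (@lebesgue_rV R n).
Local Notation operator := ({mfun Rn >-> R} -> {mfun Rn >-> R}).
Implicit Types (x y : Rn).

Lemma admissible_mul_weight (f v : {mfun Rn >-> R}) (M : R) :
  (forall x, `|f x| <= M) -> compact_support f -> loc_integrable v -> admissible (f * v).
Proof.
move=> fM cf iv; split; last first.
  by apply: (compact_support_sub cf) => x fx0; rewrite mfun_mulE fx0 mul0r.
have [r fr] := compact_sub_sball cf.
have cB : compact (sball (0 : Rn) r) by exact: compact_cube.
have mB := @measurable_sball R n 0 r.
have M0 : 0 <= M := le_trans (normr_ge0 _) (fM 0).
have iB : mu.-integrable setT ((EFin \o v) \_ (sball 0 r)).
  by apply/(integrable_mkcond _ mB); exact: iv.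
apply: (le_integrable measurableT (g := fun x => (M%:E * ((EFin \o v) \_ (sball 0 r)) x)%E)).
- by apply/measurable_EFinP.
- move=> x _; rewrite patchE; case: ifPn => [_|xB].
    change (`|(f x * v x)%:E| <= `|(M * v x)%:E|)%E.
    rewrite !abse_EFin lee_fin !normrM ler_wpM2r//.
    by rewrite (le_trans (fM x))// ler_norm.
  have -> : (EFin \o (f * v)) x = 0%E.
    change ((f x * v x)%:E = 0%E); have [->|fx0] := eqVneq (f x) 0; first by rewrite mul0r.
    by exfalso; move/negP: xB; apply; rewrite inE; apply: fr; apply: subset_closure.
  by rewrite abse0.
- exact: integrableZl.
Qed.

Section kernel.
Variables (K : Rn -> R) (T : operator) (delta p gam : R) (b : {mfun Rn >-> R}) (m : nat).
Hypotheses (hn : (0 < n)%N) (hK : standard_kernel K) (hrep : everywhere_represented K T)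
  (d0 : 0 < delta) (hb : Lambda delta b)
  (hal : m%:R * delta = n%:R * ((1 - gam) / p)) (aln : m%:R * delta <= n%:R).

(** Since [b] is Hoelder continuous, the kernel of the commutator is bounded by that of
    the fractional integral of order [m delta]; the singularity has become integrable and
    no cancellation is needed any more. *)
Lemma iter_commutator_le_riesz : exists2 c, 0 < c & forall g, admissible g ->
  {ae mu, forall x, (`|iter_commutator m b T g x|%:E <=
    (c * Lambda_norm delta b ^+ m)%:E * riesz_series gam p (fun y => `|g y|)%R x)%E}.
Proof.
have [_ [c0 [hc0 _ _]]] := hK.
pose c := Num.max c0 1; have c1 : 0 < c by rewrite lt_max ltr01 orbT.
set L := Lambda_norm delta b; have L0 : 0 <= L := Lambda_norm_ge0 hb.
exists (c * 2 `^ n%:R); first by rewrite mulr_gt0// powR_gt0.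
move=> g hg; apply: filterS (iter_commutator_le hK hrep d0 hb m hg) => x /le_trans; apply.
rewrite mulrAC /riesz_series -hal.
apply: (integral_kernel_le hn (h := fun y => `|g y|)) => //.
- by rewrite mulr_ge0// ltW.
- by rewrite mulr_ge0 ?exprn_ge0// ltW.
- exact: measurable_commutator_kernel hK _ _ _.
- by split => //; exact: measurableT_comp.
move=> y xy; rewrite !normrM ler_wpM2r// normrX.
have e0 : 0 < enorm (x - y) by apply: enorm_gt0; rewrite subr_eq0.
have bE : `|b x - b y| ^+ m <= L ^+ m * enorm (x - y) `^ (m%:R * delta).
  rewrite (mulrC m%:R) powRrM powR_mulrn ?powR_ge0//.
  rewrite -exprMn lerXn2r ?nnegrE ?mulr_ge0 ?powR_ge0//.
  exact: lipschitz_Lambda_norm.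
apply: (le_trans (ler_pM _ _ bE (hc0 _ _ xy))); rewrite ?exprn_ge0//.
have E0 : 0 < enorm (x - y) ^+ n by rewrite exprn_gt0.
rewrite [leRHS](_ : _ = L ^+ m * enorm (x - y) `^ (m%:R * delta) * (c / enorm (x - y) ^+ n)).
  rewrite ler_wpM2l ?mulr_ge0 ?exprn_ge0 ?powR_ge0//.
  by rewrite ler_pM2r ?invr_gt0// le_max lexx.
by ring.
Qed.

End kernel.
End operator_bound.

Theorem theorem17 (R : realType) (n m : nat) (hm : (0 < m)%N)
  (K : 'rV[R]_n -> R)
  (T : {mfun 'rV[R]_n >-> R} -> {mfun 'rV[R]_n >-> R})
  (hT : calderon_zygmund K T) (hrep : everywhere_represented K T)
  (delta : R) (hdelta0 : 0 < delta)
  (hdelta : delta < Num.min (n%:R / m%:R) 1)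
  (b : {mfun 'rV[R]_n >-> R}) (hb : Lambda delta b)
  (p : R) (hp1 : 1 <= p) (hp : p < n%:R / (m%:R * delta))
  (q : R) (hq : q^-1 = p^-1 - m%:R * delta / n%:R)
  (u v : {mfun 'rV[R]_n >-> R}) (hu : weight u) (hv : weight v)
  (huv :
     (A1 u /\ A1 (fun x => v x `^ (q / p))) \/
     (let w := fun x => u x * v x `^ (- over_conjugate q p) in
      A1 w /\ Ainfty_wrt w (fun x => v x `^ q))) :
  exists2 C : R, 0 < C &
    forall (t : R) (f : {mfun 'rV[R]_n >-> R}),
      0 < t -> (exists M : R, forall x, `|f x| <= M) -> compact_support f ->
      (wmeasure (fun x => u x * v x `^ (q / p))%R
         [set x | (t < `|iter_commutator m b T (f * v) x| / v x)%R] `^ q^-1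
       <= (C / t * Lambda_norm delta b ^+ m)%R%:E *
          (\int[lebesgue_rV n]_x
             (`|f x| `^ p * u x `^ (p / q) * v x)%R%:E) `^ p^-1)%E.
Proof.
have [hK _ _ _] := hT.
have p0 : 0 < p := lt_le_trans ltr01 hp1.
have m0 : 0 < m%:R :> R by rewrite ltr0n.
have hdn : delta < n%:R / m%:R by move: hdelta; rewrite lt_min => /andP[].
have hn : (0 < n)%N.
  rewrite lt0n; apply/eqP => n0; move: hdn; rewrite n0 mul0r ltNge.
  by rewrite (ltW hdelta0).
have n0 : 0 < n%:R :> R by rewrite ltr0n.
have al0 : 0 < m%:R * delta by rewrite mulr_gt0.
have aln : m%:R * delta <= n%:R by rewrite mulrC -ler_pdivlMr// ltW.
have qi0 : 0 < q^-1.
  rewrite hq subr_gt0 -[ltRHS]div1r ltr_pdivlMr// mulrAC ltr_pdivrMr// mul1r mulrC.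
  by rewrite -ltr_pdivlMr.
have q0 : 0 < q by rewrite -invr_gt0.
have pq : p < q.
  by rewrite -ltf_pV2 ?posrE// hq gtrBl divr_gt0.
have hal : m%:R * delta = n%:R * ((1 - p / q) / p).
  by rewrite hq; field; rewrite !gt_eqF.
have [_ upos] := hu; have [ilv vpos] := hv.
have uU := positive_version_ae upos; have vv' := positive_version_ae vpos.
pose v' := positive_version v; pose U := positive_version u.
have [Kb Kb0 HKb] : mixed_bound u v p q.
  by case: huv => [[hA hB]|[hA hB]]; [exact: mixed_bound_A1|exact: mixed_bound_Ainfty].
have [c c0 Hc] := iter_commutator_le_riesz hn hK hrep hdelta0 hb hal aln.
exists (Kb `^ q^-1 * c); first by rewrite mulr_gt0// powR_gt0.
move=> t f t0 [M fM] cf.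
set S := iter_commutator m b T (f * v); set E := [set x | _].
set L := Lambda_norm delta b; have L0 : 0 <= L := Lambda_norm_ge0 hb.
have hg := admissible_mul_weight fM cf ilv.
have mU : measurable_fun setT U by exact: measurable_positive_version.
have mv' : measurable_fun setT v' by exact: measurable_positive_version.
have mpow (h : 'rV[R]_n -> R) r : measurable_fun setT h ->
    measurable_fun setT (fun x => h x `^ r).
  by move=> mh; exact: (measurableT_comp (measurable_powR _) mh).
(* where [v <= 0] the quotient, possibly a division by zero, is at most [0 < t] *)
have mE : measurable E.
  have -> : E = [set x | 0 < v x] `&` [set x | 0 < `|S x| - t * v x].
    apply/seteqP; split => x; rewrite /E /=.
      move=> tS; have vx : 0 < v x.
        rewrite ltNge; apply/negP => vx; move: tS; rewrite ltNge => /negP; apply.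
        by apply: le_trans (ltW t0); rewrite mulr_ge0_le0// invr_le0.
      by split => //; rewrite subr_gt0 -ltr_pdivlMr.
    by move=> [vx]; rewrite subr_gt0 -ltr_pdivlMr.
  apply: measurableI; apply: measurable_superlevel => //.
  apply: measurable_funB; first exact: measurableT_comp.
  exact: measurable_funM.
have -> : wmeasure (fun x => u x * v x `^ (q / p)) E =
    wmeasure (fun x => U x * v' x `^ (q / p)) E.
  apply: eq_wmeasure_ae => //.
  - by apply: measurable_funM => //; exact: mpow.
  - by apply: measurable_funM => //; exact: mpow.
  - by apply: filterS2 uU vv' => x -> ->.
have -> : (\int[lebesgue_rV n]_x (`|f x| `^ p * u x `^ (p / q) * v x)%:E)%E =
    wmeasure (fun x => `|f x| `^ p * U x `^ (p / q) * v' x) setT.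
  apply: eq_wmeasure_ae => //.
  - by apply: measurable_funM => //; apply: measurable_funM; apply: mpow => //; exact: measurableT_comp.
  - by apply: measurable_funM => //; apply: measurable_funM; apply: mpow => //; exact: measurableT_comp.
  - by apply: filterS2 uU vv' => x -> ->.
have nU : nnmeas U by split => // x; exact: ltW (positive_version_gt0 _ _).
have nv' : nnmeas v' by split => // x; exact: ltW (positive_version_gt0 _ _).
have nf : nnmeas (fun x => `|f x|) by split => //; exact: measurableT_comp.
set W := wmeasure _ setT; have W0 : (0 <= W)%E.
  apply: wmeasure_ge0; apply: nnmeasM => //.
  by apply: nnmeasM; exact: nnmeas_powR.
pose I x := riesz_series (p / q) p (fun y => `|f y| * v' y) x.
have HE : {ae lebesgue_rV n, forall x, E x ->
    ((t * v' x)%:E < (c * L ^+ m)%:E * I x)%E}.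
  have [vv2 vpos2] := (vv', vpos).
  apply: filterS3 (Hc _ hg) vv2 vpos2 => x Hx vx v0 Ex.
  have -> : I x = riesz_series (p / q) p (fun y => `|(f * v) y|) x.
    apply: eq_eseriesr => j _; congr (_ * _)%E.
    apply: eq_wmeasure_ae; [|exact: measurableT_comp|exact: measurable_sball|].
      by apply: measurable_funM => //; exact: measurableT_comp.
    apply: filterS2 vv' vpos => y vy vy0.
    rewrite -[v' y]vy.
    by rewrite mfun_mulE normrM (gtr0_norm vy0).
  by apply: lt_le_trans Hx; rewrite -[v' x]vx lte_fin -ltr_pdivlMr.
(* for a constant [b] the commutator vanishes and there is no level to rescale *)
have [Lz|Lp] := eqVneq (L ^+ m) 0.
  have -> : wmeasure (fun x => U x * v' x `^ (q / p)) E = 0%E.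
    apply: wmeasure_null => //; first by apply: nnmeasM => //; exact: nnmeas_powR.
    have [N [mN N0 sub]] := HE; apply/eqP; rewrite eq_le measure_ge0 andbT -N0.
    apply: le_measure; rewrite ?inE// => x Ex; apply: sub => /= /(_ Ex).
    rewrite Lz mulr0 mul0e lte_fin ltNge mulr_ge0 ?(ltW t0)//.
    exact: (proj2 nv').
  by rewrite poweR0r ?gt_eqF// Lz mulr0 mul0e.
have D0 : 0 < c * L ^+ m by rewrite mulr_gt0// lt_neqAle eq_sym Lp exprn_ge0.
set D := c * L ^+ m in D0 HE.
have tD0 : 0 < t / D by rewrite divr_gt0.
have weak := HKb _ E (t / D) nf mE tD0.
have {}weak : (wmeasure (fun x => U x * v' x `^ (q / p))%R E <=
    (Kb * (t / D) `^ (- q))%:E * W `^ (q / p))%E.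
  apply: weak; apply: filterS HE => x Hx /Hx {}Hx.
  by rewrite mulrAC [_ / D]mulrC EFinM lte_pdivrMl.
have nUv : nnmeas (fun x => U x * v' x `^ (q / p)).
  by apply: nnmeasM => //; exact: nnmeas_powR.
have k0 : 0 < Kb * (t / D) `^ (- q) by rewrite mulr_gt0// powR_gt0.
apply: (@le_trans _ _ (((Kb * (t / D) `^ (- q))%:E * W `^ (q / p)) `^ q^-1)%E).
  apply: gt0_ler_poweR => //; first exact: ltW.
  - by rewrite in_itv /= wmeasure_ge0//= leey.
  - by rewrite in_itv /= leey andbT mule_ge0 ?poweR_ge0// lee_fin ltW.
rewrite poweRM ?poweR_ge0 ?lee_fin ?(ltW k0)// -poweRrM.
have -> : q / p * q^-1 = p^-1 by rewrite mulrAC mulfV ?mul1r// gt_eqF.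
rewrite poweR_EFin; apply: lee_wpmul2r; first exact: poweR_ge0.
rewrite lee_fin (powRM _ (ltW Kb0) (powR_ge0 _ _)) -powRrM mulNr mulfV ?gt_eqF//.
rewrite powR_inv1 ?(ltW tD0)// invf_div /D le_eqVlt; apply/orP; left; apply/eqP.
by ring.
Qed.
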